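(* Let $\{\Pr_n\}$ be a sequence of data-generating processes and let the model selection device be such that Conditions ASTE($\Pr$), SM($\Pr$), SE($\Pr$) and HLMS($\Pr$) (defined in the context) hold with $\Pr=\Pr_n$ for each $n$. Then the generic post-double-selection estimator $\check\alpha$ based on $\hat I$ obeys $$([\bar{\mathrm{E}}v_i^2]^{-1}\bar{\mathrm{E}}[v_i^2\zeta_i^2][\bar{\mathrm{E}}v_i^2]^{-1})^{-1/2}\sqrt n(\check\alpha-\alpha_0)\rightsquigarrow N(0,1).$$ Moreover, the result continues to hold if $\bar{\mathrm{E}}[v_i^2]$ and $\bar{\mathrm{E}}[v_i^2\zeta_i^2]$ are replaced by $\mathbb{E}_n[\hat v_i^2]$ and $\mathbb{E}_n[\hat v_i^2\hat\zeta_i^2]$, where $\hat\zeta_i:=[y_i-d_i\check\alpha-x_i'\check\beta]\{n/(n-\hat s-1)\}^{1/2}$, $\hat v_i:=d_i-x_i'\hat\beta$, and $\hat\beta\in\arg\min_\beta\{\mathbb{E}_n[(d_i-x_i'\beta)^2]:\beta_j=0\ \forall j\notin\hat I\}$.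
   Context: Setting: for each $n$, under $\Pr=\Pr_n$, data $(y_i,d_i,z_i)$, $i=1,\dots,n$, are independent (not necessarily identically distributed). Notation: $\mathbb{E}_n[f]=\frac1n\sum_i f(\omega_i)$, $\bar{\mathrm{E}}[f]=\frac1n\sum_i\mathrm{E}[f(\omega_i)]$; $\|\cdot\|_0$ counts nonzero entries; $a\vee b=\max\{a,b\}$. $c,C,q$ are absolute constants; $\ell_n\nearrow\infty$, $\delta_n\searrow0$, $\Delta_n\searrow0$ absolute positive sequences (not depending on $\Pr$). $\phi_{\min}(m)[M]$, $\phi_{\max}(m)[M]$ denote the min/max of $\delta'M\delta/\|\delta\|^2$ over $1\le\|\delta\|_0\le m$. Model selector: provides possibly data-dependent sets $\hat I_1,\hat I_2,\hat I_3\subseteq\{1,\dots,p\}$ with $\hat I=\hat I_1\cup\hat I_2\cup\hat I_3$; $\hat s=|\hat I|$, $\hat s_j=|\hat I_j|$. Generic post-double-selection estimator: $(\check\alpha,\check\beta)=\arg\min_{\alpha\in\mathbb{R},\beta\in\mathbb{R}^p}\{\mathbb{E}_n[(y_i-d_i\alpha-x_i'\beta)^2]:\beta_j=0\ \forall j\notin\hat I\}$. Condition ASTE($\Pr$): (i) data obey $y_i=d_i\alpha_0+g(z_i)+\zeta_i$, $\mathrm{E}[\zeta_i\mid z_i,d_i]=0$, $d_i=m(z_i)+v_i$, $\mathrm{E}[v_i\mid z_i]=0$; $x_i=P(z_i)\in\mathbb{R}^p$ a dictionary depending on $n$ but not on $\Pr$. (ii) $|\alpha_0|\le C$. (iii)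 there exist $s\ge1$, $\beta_{m0},\beta_{g0}$ with $m(z_i)=x_i'\beta_{m0}+r_{mi}$, $g(z_i)=x_i'\beta_{g0}+r_{gi}$, $\|\beta_{m0}\|_0,\|\beta_{g0}\|_0\le s$, $\{\bar{\mathrm{E}}r_{mi}^2\}^{1/2},\{\bar{\mathrm{E}}r_{gi}^2\}^{1/2}\le C\sqrt{s/n}$. (iv) $s^2\log^2(p\vee n)/n\le\delta_n$ and $\hat s_3\le C(1\vee\hat s_1\vee\hat s_2)$. (v) with $\tilde v_i=v_i+r_{mi}$, $\tilde\zeta_i=\zeta_i+r_{gi}$: $|\bar{\mathrm{E}}[\tilde v_i^2\tilde\zeta_i^2]-\bar{\mathrm{E}}[v_i^2\zeta_i^2]|\le\delta_n$, $\bar{\mathrm{E}}[|\tilde v_i|^q+|\tilde\zeta_i|^q]\le C$ for some $q>4$, and $\max_{i\le n}\|x_i\|_\infty^2 sn^{-1/2+2/q}\le\delta_n$ with probability $\ge1-\Delta_n$. Condition SE($\Pr$): with probability $\ge1-\Delta_n$, $\kappa'\le\phi_{\min}(\ell_ns)[\mathbb{E}_nx_ix_i']\le\phi_{\max}(\ell_ns)[\mathbb{E}_nx_ix_i']\le\kappa''$ for absolute constants $0<\kappa'<\kappa''<\infty$. Condition SM($\Pr$): for absolute $0<c<C<\infty$, $4<q<\infty$, and for both $(\tilde y_i,\epsilon_i)=(y_i,\zeta_i)$ and $(d_i,v_i)$: (i) $\bar{\mathrm{E}}|d_i|^q\le C$, $c\le\mathrm{E}[\zeta_i^2\mid x_i,v_i]\le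 C$, $c\le\mathrm{E}[v_i^2\mid x_i]\le C$ a.s.; (ii) $\bar{\mathrm{E}}|\epsilon_i|^q+\bar{\mathrm{E}}\tilde y_i^2+\max_{j\le p}\{\bar{\mathrm{E}}[x_{ij}^2\tilde y_i^2]+\bar{\mathrm{E}}|x_{ij}^3\epsilon_i^3|+1/\bar{\mathrm{E}}[x_{ij}^2]\}\le C$; (iii) $\log^3p/n\le\delta_n$; (iv) with probability $\ge1-\Delta_n$, $\max_{j\le p}\{|(\mathbb{E}_n-\bar{\mathrm{E}})[x_{ij}^2\epsilon_i^2]|+|(\mathbb{E}_n-\bar{\mathrm{E}})[x_{ij}^2\tilde y_i^2]|\}+\max_{i\le n}\|x_i\|_\infty^2s\log(n\vee p)/n\le\delta_n$. Condition HLMS($\Pr$): with probability $\ge1-\Delta_n$, $|\hat I|\le Cs$, $\min_{\beta:\beta_j=0,j\notin\hat I_1}\sqrt{\mathbb{E}_n[(m(z_i)-x_i'\beta)^2]}\le\delta_nn^{-1/4}$ and $\min_{\beta:\beta_j=0,j\notin\hat I_2}\sqrt{\mathbb{E}_n[(g(z_i)-x_i'\beta)^2]}\le\delta_nn^{-1/4}$. *)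

(* Defs.v *)
From HB Require Import structures.
From mathcomp Require Import all_boot all_order all_algebra.
From mathcomp Require Import all_classical all_reals all_analysis.
Set Implicit Arguments.
Unset Strict Implicit.
Unset Printing Implicit Defensive.
Import Order.TTheory GRing.Theory Num.Theory.
Import numFieldNormedType.Exports.
Local Open Scope classical_set_scope.
Local Open Scope ring_scope.

Section Generic.
Context {R : realType}.

Definition avg (n : nat) (f : 'I_n -> R) : R := (n%:R)^-1 * \sum_(i < n) f i.

Definition xdot (p : nat) (x b : 'I_p -> R) : R := \sum_(j < p) x j * b j.

Definition l0 (p : nat) (b : 'I_p -> R) : nat := #|[set j | b j != 0]|.

Definition supported (p : nat) (I : {set 'I_p}) (b : 'I_p -> R) : Prop :=
  forall j, j \notin I -> b j = 0.

Definition supnorm (p : nat) (x : 'I_p -> R) : R := \big[Num.max/0]_(j < p) `|x j|.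

Definition sparse_ratios (p : nat) (m : R) (M : 'I_p -> 'I_p -> R) : set R :=
  [set (\sum_(j < p) \sum_(k < p) dl j * M j k * dl k) / (\sum_(j < p) dl j ^+ 2)
   | dl in [set dl : 'I_p -> R | (1 <= l0 dl)%N /\ (l0 dl)%:R <= m]].
Definition phi_min (p : nat) (m : R) (M : 'I_p -> 'I_p -> R) : R := inf (sparse_ratios m M).
Definition phi_max (p : nat) (m : R) (M : 'I_p -> 'I_p -> R) : R := sup (sparse_ratios m M).

Definition Phi (t : R) : R := fine (normal_prob 0 1 `]-oo, t]).

End Generic.

Section Prob.
Context {R : realType} {dT : measure_display} {T : measurableType dT}.
Local Open Scope ereal_scope.

Definition Ebar (P : probability T R) (n : nat) (f : 'I_n -> T -> R) : \bar R :=
  ((n%:R)^-1)%:E * \sum_(i < n) 'E_P[f i].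

Definition preims {dU : measure_display} {U : measurableType dU} (Y : T -> U)
  : set (set T) := [set Y @^-1` B | B in measurable].

Definition cond_exp_version (P : probability T R) (G : set (set T)) (X W : T -> R) : Prop :=
  [/\ P.-integrable setT (EFin \o X),
      (forall B : set R, measurable B -> G (W @^-1` B)),
      P.-integrable setT (EFin \o W) &
      forall A, G A -> \int[P]_(w in A) (X w)%:E = \int[P]_(w in A) (W w)%:E].

Definition cond_exp_zero (P : probability T R) (G : set (set T)) (X : T -> R) : Prop :=
  cond_exp_version P G X (fun=> 0%R).

Definition cond_exp_between (P : probability T R) (G : set (set T)) (X : T -> R)
  (c C : R) : Prop :=
  exists W, cond_exp_version P G X W /\ {ae P, forall w, (c <= W w <= C)%R}.

Definition mutually_independent (P : probability T R) (n : nat) (G : 'I_n -> set (set T))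
  : Prop :=
  forall A : 'I_n -> set T, (forall i, G i (A i)) ->
    P (\bigcap_(i in [set: 'I_n]) A i) = \prod_(i < n) P (A i).

End Prob.

(* The model at a fixed sample size n (all objects below are for one n).     *)
(* Data omega_i = (y_i, d_i, z_i), i < n, are random elements on a           *)
(* probability space (T, P); z_i takes values in a measurable space Zt;       *)
(* x_i = Pd(z_i) in R^p is the dictionary.                                   *)
Section Model.
Context {R : realType} {dT : measure_display} {T : measurableType dT}
        {dZ : measure_display} {Zt : measurableType dZ}.

Definition xreg (n p : nat) (Pd : Zt -> 'I_p -> R) (z : 'I_n -> T -> Zt)
  (i : 'I_n) (w : T) : 'I_p -> R := Pd (z i w).

Definition zeta (n : nat) (y d : 'I_n -> T -> R) (z : 'I_n -> T -> Zt)
  (alpha0 : R) (g : Zt -> R) (i : 'I_n) (w : T) : R :=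
  y i w - d i w * alpha0 - g (z i w).

Definition vres (n : nat) (d : 'I_n -> T -> R) (z : 'I_n -> T -> Zt)
  (m : Zt -> R) (i : 'I_n) (w : T) : R := d i w - m (z i w).

Definition rerr (n p : nat) (Pd : Zt -> 'I_p -> R) (z : 'I_n -> T -> Zt)
  (h : Zt -> R) (b0 : 'I_p -> R) (i : 'I_n) (w : T) : R :=
  h (z i w) - xdot (Pd (z i w)) b0.

Definition maxx2 (n p : nat) (Pd : Zt -> 'I_p -> R) (z : 'I_n -> T -> Zt) (w : T) : R :=
  \big[Num.max/0]_(i < n) (supnorm (Pd (z i w)) ^+ 2).

Definition sig_zd (n : nat) (z : 'I_n -> T -> Zt) (d : 'I_n -> T -> R) (i : 'I_n)
  : set (set T) := <<s preims (z i) `|` preims (d i) >>.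
Definition sig_z (n : nat) (z : 'I_n -> T -> Zt) (i : 'I_n) : set (set T) :=
  <<s preims (z i) >>.
Definition sig_xv (n p : nat) (Pd : Zt -> 'I_p -> R) (z : 'I_n -> T -> Zt)
  (v : 'I_n -> T -> R) (i : 'I_n) : set (set T) :=
  <<s (\bigcup_(j in [set: 'I_p]) preims (fun w => Pd (z i w) j)) `|` preims (v i) >>.
Definition sig_x (n p : nat) (Pd : Zt -> 'I_p -> R) (z : 'I_n -> T -> Zt)
  (i : 'I_n) : set (set T) :=
  <<s \bigcup_(j in [set: 'I_p]) preims (fun w => Pd (z i w) j) >>.
Definition sig_omega (n : nat) (y d : 'I_n -> T -> R) (z : 'I_n -> T -> Zt)
  (i : 'I_n) : set (set T) :=
  <<s preims (y i) `|` preims (d i) `|` preims (z i) >>.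

Local Open Scope ereal_scope.

Definition ASTE (P : probability T R) (n p : nat) (y d : 'I_n -> T -> R)
  (z : 'I_n -> T -> Zt) (Pd : Zt -> 'I_p -> R) (alpha0 : R) (g m : Zt -> R)
  (s : R) (bm0 bg0 : 'I_p -> R) (I1 I2 I3 : T -> {set 'I_p})
  (C q delta Delta : R) : Prop :=
  let ze := zeta y d z alpha0 g in
  let v := vres d z m in
  let rm := rerr Pd z m bm0 in
  let rg := rerr Pd z g bg0 in
  let vt := fun i w => (v i w + rm i w)%R in
  let zt := fun i w => (ze i w + rg i w)%R in
  [/\
      (forall i, cond_exp_zero P (sig_zd z d i) (ze i)) /\
      (forall i, cond_exp_zero P (sig_z z i) (v i)),
      (`|alpha0| <= C)%R,
      [/\ (1 <= s)%R, ((l0 bm0)%:R <= s)%R, ((l0 bg0)%:R <= s)%R,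
          Ebar P (fun i w => rm i w ^+ 2)%R <= ((C * Num.sqrt (s / n%:R)) ^+ 2)%:E &
          Ebar P (fun i w => rg i w ^+ 2)%R <= ((C * Num.sqrt (s / n%:R)) ^+ 2)%:E],
      (s ^+ 2 * ln (maxn p n)%:R ^+ 2 / n%:R <= delta)%R /\
      (forall w, (#|I3 w|%:R <= C * Num.max 1 (Num.max #|I1 w|%:R #|I2 w|%:R))%R) &
      [/\ `| Ebar P (fun i w => vt i w ^+ 2 * zt i w ^+ 2)%R
             - Ebar P (fun i w => v i w ^+ 2 * ze i w ^+ 2)%R | <= delta%:E,
          (4 < q)%R,
          Ebar P (fun i w => `|vt i w| `^ q + `|zt i w| `^ q)%R <= C%:E &
          P [set w | (maxx2 Pd z w * s * (n%:R `^ (- 2^-1 + 2 / q)) <= delta)%R]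
            >= (1 - Delta)%:E]].

Definition SE (P : probability T R) (n p : nat) (z : 'I_n -> T -> Zt)
  (Pd : Zt -> 'I_p -> R) (s : R) (kap1 kap2 ell Delta : R) : Prop :=
  let Gram := fun w (j k : 'I_p) => avg (fun i => Pd (z i w) j * Pd (z i w) k)%R in
  P [set w | (kap1 <= phi_min (ell * s) (Gram w)
              /\ phi_min (ell * s) (Gram w) <= phi_max (ell * s) (Gram w)
              /\ phi_max (ell * s) (Gram w) <= kap2)%R] >= (1 - Delta)%:E.

Definition SM_pair (P : probability T R) (n p : nat) (z : 'I_n -> T -> Zt)
  (Pd : Zt -> 'I_p -> R) (s : R) (yt eps : 'I_n -> T -> R) (C q delta Delta : R)
  : Prop :=
  let x := fun i w j => Pd (z i w) j in
  Ebar P (fun i w => `|eps i w| `^ q)%R + Ebar P (fun i w => yt i w ^+ 2)%R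
  + \big[maxe/0]_(j < p)
      (Ebar P (fun i w => x i w j ^+ 2 * yt i w ^+ 2)%R
       + Ebar P (fun i w => `|x i w j ^+ 3 * eps i w ^+ 3|)%R
       + (Ebar P (fun i w => x i w j ^+ 2)%R)^-1) <= C%:E
  /\
  P [set w |
      \big[maxe/0]_(j < p)
        (`| (avg (fun i => x i w j ^+ 2 * eps i w ^+ 2)%R)%:E
             - Ebar P (fun i w => x i w j ^+ 2 * eps i w ^+ 2)%R |
         + `| (avg (fun i => x i w j ^+ 2 * yt i w ^+ 2)%R)%:E
             - Ebar P (fun i w => x i w j ^+ 2 * yt i w ^+ 2)%R |)
      + (maxx2 Pd z w * s * ln (maxn n p)%:R / n%:R)%:E <= delta%:E]
    >= (1 - Delta)%:E.

Definition SM (P : probability T R) (n p : nat) (y d : 'I_n -> T -> R)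
  (z : 'I_n -> T -> Zt) (Pd : Zt -> 'I_p -> R) (alpha0 : R) (g m : Zt -> R)
  (s : R) (c C q delta Delta : R) : Prop :=
  let ze := zeta y d z alpha0 g in
  let v := vres d z m in
  [/\ (4 < q)%R,
      [/\ Ebar P (fun i w => `|d i w| `^ q)%R <= C%:E,
          (forall i, cond_exp_between P (sig_xv Pd z v i) (fun w => ze i w ^+ 2)%R c C) &
          (forall i, cond_exp_between P (sig_x Pd z i) (fun w => v i w ^+ 2)%R c C)],
      SM_pair P z Pd s y ze C q delta Delta,
      SM_pair P z Pd s d v C q delta Delta &
      (ln p%:R ^+ 3 / n%:R <= delta)%R].

Definition approx_min (n p : nat) (Pd : Zt -> 'I_p -> R) (z : 'I_n -> T -> Zt)
  (h : Zt -> R) (I : {set 'I_p}) (w : T) : R :=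
  inf [set Num.sqrt (avg (fun i => (h (z i w) - xdot (Pd (z i w)) b) ^+ 2)%R)
      | b in [set b | supported I b]].

Definition HLMS (P : probability T R) (n p : nat) (z : 'I_n -> T -> Zt)
  (Pd : Zt -> 'I_p -> R) (g m : Zt -> R) (s : R) (I1 I2 I3 : T -> {set 'I_p})
  (C delta Delta : R) : Prop :=
  P [set w | (#|I1 w :|: I2 w :|: I3 w|%:R <= C * s
              /\ approx_min Pd z m (I1 w) w <= delta * n%:R `^ (- 4^-1)
              /\ approx_min Pd z g (I2 w) w <= delta * n%:R `^ (- 4^-1))%R]
    >= (1 - Delta)%:E.

End Model.

Section Estimators.
Context {R : realType} {dT : measure_display} {T : measurableType dT}
        {dZ : measure_display} {Zt : measurableType dZ}.

Definition is_pds_estimator (n p : nat) (y d : 'I_n -> T -> R) (z : 'I_n -> T -> Zt)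
  (Pd : Zt -> 'I_p -> R) (I : T -> {set 'I_p}) (ac : T -> R) (bc : T -> 'I_p -> R)
  : Prop :=
  forall w, supported (I w) (bc w) /\
    forall (a : R) (b : 'I_p -> R), supported (I w) b ->
      avg (fun i => (y i w - d i w * ac w - xdot (Pd (z i w)) (bc w)) ^+ 2)
      <= avg (fun i => (y i w - d i w * a - xdot (Pd (z i w)) b) ^+ 2).

Definition is_d_projection (n p : nat) (d : 'I_n -> T -> R) (z : 'I_n -> T -> Zt)
  (Pd : Zt -> 'I_p -> R) (I : T -> {set 'I_p}) (bh : T -> 'I_p -> R) : Prop :=
  forall w, supported (I w) (bh w) /\
    forall b : 'I_p -> R, supported (I w) b ->
      avg (fun i => (d i w - xdot (Pd (z i w)) (bh w)) ^+ 2)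
      <= avg (fun i => (d i w - xdot (Pd (z i w)) b) ^+ 2).

Definition stat_oracle (P : probability T R) (n : nat) (y d : 'I_n -> T -> R)
  (z : 'I_n -> T -> Zt) (alpha0 : R) (g m : Zt -> R) (ac : T -> R) (w : T) : R :=
  let ze := zeta y d z alpha0 g in
  let v := vres d z m in
  let Ev2 := fine (Ebar P (fun i w => v i w ^+ 2)) in
  let Ev2z2 := fine (Ebar P (fun i w => v i w ^+ 2 * ze i w ^+ 2)) in
  (Num.sqrt (Ev2^-1 * Ev2z2 * Ev2^-1))^-1 * Num.sqrt n%:R * (ac w - alpha0).

Definition stat_plugin (n p : nat) (y d : 'I_n -> T -> R) (z : 'I_n -> T -> Zt)
  (Pd : Zt -> 'I_p -> R) (alpha0 : R) (I : T -> {set 'I_p})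
  (ac : T -> R) (bc bh : T -> 'I_p -> R) (w : T) : R :=
  let shat : R := #|I w|%:R in
  let zh := fun i : 'I_n =>
    (y i w - d i w * ac w - xdot (Pd (z i w)) (bc w)) * Num.sqrt (n%:R / (n%:R - shat - 1)) in
  let vh := fun i : 'I_n => d i w - xdot (Pd (z i w)) (bh w) in
  let Ev2 := avg (fun i => vh i ^+ 2) in
  let Ev2z2 := avg (fun i => vh i ^+ 2 * zh i ^+ 2) in
  (Num.sqrt (Ev2^-1 * Ev2z2 * Ev2^-1))^-1 * Num.sqrt n%:R * (ac w - alpha0).

End Estimators.

(* Z_n (defined on the n-th probability space) converges in distribution to N(0,1):
   Pr_n(Z_n <= t) -> Phi(t) for every t (Phi is continuous) *)
Definition converges_to_std_normal {R : realType} (dT : nat -> measure_display)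
  (T : forall n, measurableType (dT n)) (P : forall n, probability (T n) R)
  (Zs : forall n, T n -> R) : Prop :=
  forall t : R, (fun n => fine (P n [set w | Zs n w <= t])) @ \oo --> Phi t.

(* Main.v *)
(* The residual e of d after projection on the selected regressors is orthogonal to
   them, so (alpha_check - alpha0) ||e||^2 equals <v, zeta> plus <r_m, zeta>, <v, r_g>
   and products of two estimation errors. Sparse eigenvalues, a Bernstein bound for
   max_j |<x_j, v>| and max_j |<x_j, zeta>|, and the quality of the selection make each
   such error o(n^(-1/4)); hence the products are o(n^(-1/2)), and the two cross
   terms are o(n^(-1/2)) by orthogonality and a variance bound. The main term
   sqrt n <v, zeta> is asymptotically normal by Lindeberg's exchange argument, run on the
   heat flow of Phi. The variance estimators converge because the fitted residuals
   differ from the true ones by functions that are small in norm, while the maxima of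
   the true ones are o(n^(1/4)) by the moment conditions. Slutsky's lemma concludes. *)
Require Import Defs.
From HB Require Import structures.
From mathcomp Require Import all_boot all_order all_algebra.
From mathcomp Require Import all_classical all_reals all_analysis.
From mathcomp Require Import measurable_realfun.
From mathcomp Require Import ring lra.
Set Implicit Arguments.
Unset Strict Implicit.
Unset Printing Implicit Defensive.
Import Order.TTheory GRing.Theory Num.Theory.
Import numFieldNormedType.Exports.
Local Open Scope classical_set_scope.
Local Open Scope ring_scope.

(** * Taylor bounds along a ray *)

(** The probability spaces change with [n], so there is no common space for the convergence. The
    arguments are split into inequalities at a fixed sample size and limits along one filter [whp]
    on pairs of an index and an outcome, where stochastic orders obey the ordinary calculus of
    limits. Rates are counted in powers of [root8 n], the eighth root of [n]: fitting errors are
    [o(root8 ^ -2)], the error of the estimator is [o(root8 ^ -3)], maxima of residuals are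
    [o(root8 ^ 2)]. Two difficulties shape the rest. The scores have third moments only, too few for
    a direct exponential bound; they are truncated at [sqrt (n / L)], and higher moments together
    with the bound on the regressors show that nothing is cut. The exponent in that bound on the
    regressors is the one for which the sums of residual and approximation error have moments, so
    these sums, and not the residuals alone, carry the maxima and the variance estimators. *)

Section RealDerivative.
Context {R : realType}.
Implicit Types (f g : R -> R) (x a b k h t : R).

Lemma der_eq f x a b : is_derive x 1 f a -> a = b -> is_derive x 1 f b.
Proof. by move=> + <-. Qed.

Lemma der_add f g x a b : is_derive x 1 f a -> is_derive x 1 g b ->
  is_derive x 1 (fun y => f y + g y) (a + b).
Proof. exact: is_deriveD. Qed.

Lemma der_opp f x a : is_derive x 1 f a -> is_derive x 1 (fun y => - f y) (- a).
Proof. exact: is_deriveN. Qed.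

Lemma der_mul f g x a b : is_derive x 1 f a -> is_derive x 1 g b ->
  is_derive x 1 (fun y => f y * g y) (f x * b + g x * a).
Proof. exact: is_deriveM. Qed.

Lemma der_cst k x : is_derive x 1 (fun=> k) 0.
Proof. exact: is_derive_cst. Qed.

Lemma der_id x : is_derive x 1 (fun y : R => y) 1.
Proof. exact: is_derive_id. Qed.

Lemma der_comp f g x a b : is_derive (g x) 1 f a -> is_derive x 1 g b ->
  is_derive x 1 (fun y => f (g y)) (a * b).
Proof. exact: is_derive1_comp. Qed.

Lemma der_inv f x a : f x != 0 -> is_derive x 1 f a ->
  is_derive x 1 (fun y => (f y)^-1) (- (f x) ^- 2 * a).
Proof. exact: is_deriveV. Qed.

Lemma der_aff x h t : is_derive t 1 (fun u => x + u * h) h.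
Proof.
apply: (der_eq (der_add (der_cst x t) (der_mul (der_id t) (der_cst h t)))).
by rewrite mulr0 mulr1 !add0r.
Qed.

End RealDerivative.

Section Taylor.
Context {R : realType}.

(** Parametrizing the segment by [t] in [0, 1] treats both signs of [h] at once. Derivatives are
    asked for on the segment only, since the heat flow below is smooth for positive times only. *)
Lemma mvt_ray (f f1 : R -> R) (x h : R) :
  (forall t : R, 0 <= t <= 1 -> is_derive (x + t * h) 1 f (f1 (x + t * h))) ->
  exists2 t, 0 <= t <= 1 & f (x + h) - f x = f1 (x + t * h) * h.
Proof.
move=> df; pose gg t := f (x + t * h).
have dgg (t : R) : t \in `[0, 1]%R -> is_derive (t : R) 1 gg (f1 (x + t * h) * h).
  rewrite in_itv /= => t01.
  exact: (@der_comp _ f (fun u => x + u * h) t _ _ (df t t01) (der_aff x h t)).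
have cg : {within `[0, 1], continuous gg}.
  apply: derivable_within_continuous => t t01.
  exact: (@ex_derive _ _ _ _ _ _ _ (dgg t t01)).
have dgo (t : R) : t \in `]0, 1[%R -> is_derive t 1 gg (f1 (x + t * h) * h).
  by move=> t01; apply: dgg; exact: subset_itv_oo_cc.
have h01 : (0 : R) <= 1 by exact: ler01.
have [t] := MVT_segment h01 dgo cg.
rewrite in_itv /= => t01; rewrite /gg mul1r mul0r addr0 => ->.
by exists t => //; rewrite subr0 mulr1.
Qed.

Lemma taylor2_ray (f f1 f2 : R -> R) (x h K : R) :
  (forall t : R, 0 <= t <= 1 -> is_derive (x + t * h) 1 f (f1 (x + t * h))) ->
  (forall t : R, 0 <= t <= 1 -> is_derive (x + t * h) 1 f1 (f2 (x + t * h))) ->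
  (forall t : R, 0 <= t <= 1 -> `|f2 (x + t * h)| <= K) ->
  `|f (x + h) - f x - f1 x * h| <= K * h ^+ 2.
Proof.
move=> d0 d1 b2; have [t /andP[t0 t1] ->] := mvt_ray d0.
have [|u /andP[u0 u1] e] := @mvt_ray f1 f2 x (t * h).
  move=> u /andP[u0 u1]; rewrite mulrA; apply: d1.
  by rewrite mulr_ge0//= mulr_ile1.
have -> : `|f1 (x + t * h) * h - f1 x * h| = `|f2 (x + u * (t * h))| * (t * `|h|) * `|h|.
  by rewrite -mulrBl e !normrM (ger0_norm t0).
have bK : `|f2 (x + u * (t * h))| <= K.
  by rewrite mulrA; apply: b2; rewrite mulr_ge0//= mulr_ile1.
have -> : K * h ^+ 2 = K * `|h| * `|h| by rewrite -(real_normK (num_real h)) expr2 mulrA.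
by rewrite ler_wpM2r// ler_pM ?mulr_ge0// ler_piMl.
Qed.

Lemma taylor3_ray (f f1 f2 f3 : R -> R) (x h K : R) :
  (forall t : R, 0 <= t <= 1 -> is_derive (x + t * h) 1 f (f1 (x + t * h))) ->
  (forall t : R, 0 <= t <= 1 -> is_derive (x + t * h) 1 f1 (f2 (x + t * h))) ->
  (forall t : R, 0 <= t <= 1 -> is_derive (x + t * h) 1 f2 (f3 (x + t * h))) ->
  (forall t : R, 0 <= t <= 1 -> `|f3 (x + t * h)| <= K) ->
  `|f (x + h) - f x - f1 x * h - 2^-1 * f2 x * h ^+ 2| <= K * `|h| ^+ 3.
Proof.
move=> d0 d1 d2 b3.
(* [gg] is [f] minus its quadratic Taylor polynomial at [x], up to a constant. Its derivative [gg1]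
   is the first-order remainder of [f1], which [taylor2_ray] bounds. *)
pose gg y := f y - (f1 x * y + 2^-1 * f2 x * ((y - x) * (y - x))).
pose gg1 y := f1 y - (f1 x + f2 x * (y - x)).
have dg (t : R) : 0 <= t <= 1 -> is_derive (x + t * h) 1 gg (gg1 (x + t * h)).
  move=> t01; have d := d0 t t01; rewrite /gg /gg1.
  apply: (der_eq (der_add d (der_opp (der_add
    (der_mul (der_cst (f1 x) _) (der_id _))
    (der_mul (der_cst (2^-1 * f2 x) _)
       (der_mul (der_add (der_id _) (der_cst (- x) _)) (der_add (der_id _) (der_cst (- x) _)))))))).
  by field.
have [t t01] := mvt_ray dg; have [t0 t1] := andP t01.
have tt (u : R) : 0 <= u <= 1 -> 0 <= u * t <= 1.
  by move=> /andP[u0 u1]; rewrite mulr_ge0//= mulr_ile1.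
have b : `|f1 (x + t * h) - f1 x - f2 x * (t * h)| <= K * (t * h) ^+ 2.
  apply: (@taylor2_ray f1 f2 f3) => u /tt; rewrite mulrA.
  - exact: d1.
  - exact: d2.
  - exact: b3.
move=> e.
have -> : f (x + h) - f x - f1 x * h - 2^-1 * f2 x * h ^+ 2 = gg (x + h) - gg x.
  by rewrite /gg; field.
rewrite e normrM exprS [leRHS]mulrA [K * `|h|]mulrC -mulrA [leRHS]mulrC ler_wpM2r//.
have -> : gg1 (x + t * h) = f1 (x + t * h) - f1 x - f2 x * (t * h) by rewrite /gg1; ring.
apply: (le_trans b); have K0 : 0 <= K by apply: le_trans (b3 _ t01).
rewrite ler_wpM2l// exprMn real_normK ?num_real// ler_piMl ?sqr_ge0//.
by rewrite exprn_ile1.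
Qed.

End Taylor.

(** * Gaussian smoothing *)

Section NormalCdf.
Context {R : realType}.
Implicit Types x t s a h : R.

Let npdf := @normal_pdf R 0 1.

Lemma npdfE x : npdf x = normal_peak 1 * expR (- (2^-1 * (x * x))).
Proof.
rewrite /npdf normal_pdfE ?oner_neq0// /normal_fun subr0 expr1n.
congr (_ * expR _); rewrite expr2 mulNr mulrC.
by [].
Qed.

Lemma npdf_der x : is_derive x 1 npdf (- x * npdf x).
Proof.
rewrite (_ : npdf = fun x => normal_peak 1 * expR (- (2^-1 * (x * x)))); last first.
  by apply/funext => y; rewrite npdfE.
have dq : is_derive x 1 (fun y : R => - (2^-1 * (y * y))) (- x).
  apply: (der_eq (der_opp (der_mul (der_cst 2^-1 x) (der_mul (der_id x) (der_id x))))).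
  by field.
apply: (der_eq (der_mul (der_cst (normal_peak 1) x)
  (@der_comp _ expR _ x _ _ (is_derive_expR _) dq))).
by ring.
Qed.

Lemma npdf_ge0 x : 0 <= npdf x.
Proof. exact: normal_pdf_ge0. Qed.

Let A : R := 9 * normal_peak 1.

(** The inequality [exp u >= 1 + u ^ 2 / 2] at [u = x ^ 2 / 2] lets the density absorb a factor of
    degree 4. All polynomials met in the derivatives of [Phi] and of the heat flow are dominated by
    multiples of [1 + x ^ 4]. *)
Lemma npdf_poly_bound x : (1 + x ^+ 4) * npdf x <= A.
Proof.
rewrite npdfE mulrCA /A [leRHS]mulrC ler_wpM2l ?normal_peak_ge0//.
rewrite expRN ler_pdivrMr ?expR_gt0//.
have y0 : 0 <= 2^-1 * (x * x) by rewrite mulr_ge0// -expr2 sqr_ge0.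
have := expR_ge1Dxn 1 y0; rewrite (_ : 2`!%:R = 2 :> R)//.
move: (expR _) => e.
rewrite (_ : (2^-1 * (x * x)) ^+ 2 / 2 = x ^+ 4 / 8); last by field.
have := exprn_even_ge0 x (isT : ~~ odd 4).
by move: (x ^+ 4) => u; lra.
Qed.

Lemma Phi_der x : is_derive x 1 (@Phi R) (npdf x).
Proof.
have xu : x < x + 1 by rewrite ltrDl.
have i : (@lebesgue_measure R).-integrable [set` Interval -oo%O (BRight (x + 1))] (EFin \o npdf).
  apply: (integrableS _ _ (subsetT _)) => //; exact: integrable_normal_pdf.
have c : {for x, continuous npdf} by apply: continuous_normal_pdf; rewrite oner_neq0.
have [d e] := continuous_FTC1 xu i (ltNyr x) c.
by have dd := derivableP d; rewrite -derive1E e in dd; exact: dd.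
Qed.

(** Seen as a random variable under the normal law, the identity has distribution function [Phi];
    monotonicity and the limits at infinity are then those of any [cdf]. *)
Let idn : measurableTypeR R -> R := idfun.

#[local] HB.instance Definition _ :=
  @isMeasurableFun.Build _ _ _ _ idn (@measurable_id _ _ setT).

Let N01 : probability (measurableTypeR R) R := normal_prob 0 1.

Lemma PhiE x : (Phi x)%:E = cdf (idn : {RV N01 >-> R}) x.
Proof. by rewrite /Phi fineK// fin_num_measure. Qed.

Lemma Phi_ge0 x : 0 <= Phi x.
Proof. by rewrite -lee_fin PhiE cdf_ge0. Qed.

Lemma Phi_le1 x : Phi x <= 1.
Proof. by rewrite -lee_fin PhiE cdf_le1. Qed.

Lemma Phi_nondecreasing x t : x <= t -> Phi x <= Phi t.
Proof. by move=> xt; rewrite -lee_fin !PhiE; exact: cdf_nondecreasing. Qed.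

Lemma Phi_cvgy : @Phi R x @[x --> +oo] --> (1 : R).
Proof.
have := cvg_cdfy1 (idn : {RV N01 >-> R}).
rewrite (_ : cdf _ = EFin \o @Phi R); last by apply/funext => x; rewrite -PhiE.
by move/fine_cvgP => [].
Qed.

Lemma Phi_cvgNy : @Phi R x @[x --> -oo] --> (0 : R).
Proof.
have := cvg_cdfNy0 (idn : {RV N01 >-> R}).
rewrite (_ : cdf _ = EFin \o @Phi R); last by apply/funext => x; rewrite -PhiE.
by move/fine_cvgP => [].
Qed.

Lemma Phi_continuous : continuous (@Phi R).
Proof.
move=> x; apply: differentiable_continuous; apply/derivable1_diffP.
exact: (@ex_derive _ _ _ _ _ _ _ (Phi_der x)).
Qed.

Lemma Phi_tail (eta : R) : 0 < eta ->
  exists2 M : R, 0 < M & Phi (- M) <= eta /\ 1 - eta <= Phi M.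
Proof.
move=> e0.
have h1 : \forall x \near +oo, `|1 - Phi x| <= eta.
  by have /cvgrPdist_le := Phi_cvgy; apply.
have h2 : \forall x \near -oo, `|0 - Phi x| <= eta.
  by have /cvgrPdist_le := Phi_cvgNy; apply.
move: h1 => [M1 [_ h1]]; move: h2 => [M2 [_ h2]].
pose M := Num.max 1 (Num.max (M1 + 1) (- M2 + 1)).
exists M; first by rewrite lt_max ltr01.
split.
- have /h2 : - M < M2 by rewrite ltrNl /M !lt_max ltrDl ltr01 !orbT.
  by rewrite sub0r normrN => /ler_normlW.
- have /h1 : M1 < M by rewrite /M !lt_max ltrDl ltr01 orbT.
  by move=> /ler_normlW; rewrite lerBlDr addrC -lerBlDr.
Qed.

(** Here [r] stands for [1 / sqrt s]. The single factor [rho ^ 4] serves the quadratic and the cubic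
    remainder alike, and also [s ^ -2] in the time remainder. *)
Let rate_bound r rho x : 0 <= r <= rho -> 1 <= rho -> 
  (`|r * x| ^+ 3 <= rho ^+ 4 * `|x| ^+ 3) /\ ((r * x) ^+ 2 <= rho ^+ 4 * x ^+ 2).
Proof.
move=> /andP[r0 rr] rho1; have rho0 : 0 <= rho by apply: le_trans rho1.
split.
  rewrite normrM exprMn ler_wpM2r ?exprn_ge0// (ger0_norm r0).
  apply: (@le_trans _ _ (rho ^+ 3)); first by rewrite lerXn2r ?nnegrE.
  by rewrite [leRHS]exprS ler_peMl ?exprn_ge0.
rewrite exprMn ler_wpM2r ?sqr_ge0//.
apply: (@le_trans _ _ (rho ^+ 2)); first by rewrite lerXn2r ?nnegrE.
by rewrite (exprD _ 2 2) ler_peMl ?exprn_ge0// exprn_ege1.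
Qed.

Let A_ge0 : 0 <= A.
Proof. by rewrite mulr_ge0// normal_peak_ge0. Qed.

Let poly_small x : `|x| <= 1 + x ^+ 4 /\ `|x| ^+ 3 <= 1 + x ^+ 4 /\ `|x ^+ 2 - 1| <= 1 + x ^+ 4.
Proof.
have -> : x ^+ 4 = `|x| ^+ 4 by rewrite -normrX ger0_norm// exprn_even_ge0.
have -> : x ^+ 2 = `|x| ^+ 2 by rewrite real_normK// num_real.
move: `|x| (normr_ge0 x) => {}x x0.
have pw k : (k <= 4)%N -> x ^+ k <= 1 + x ^+ 4.
  move=> k4; have [x1|x1] := leP x 1.
    by apply: (@le_trans _ _ 1); rewrite ?exprn_ile1// lerDl exprn_ge0.
  apply: (@le_trans _ _ (x ^+ 4)); last by rewrite lerDr.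
  by rewrite ler_weXn2l// ltW.
split; first exact: (pw 1%N).
split; first exact: pw.
rewrite (exprM x 2 2) ler_norml; have : 0 <= x ^+ 2 by rewrite exprn_ge0.
by move: (x ^+ 2) => u u0; apply/andP; split; nra.
Qed.

Let npdf1 x : `|- x * npdf x| <= A.
Proof.
apply: le_trans (npdf_poly_bound x); rewrite normrM normrN (ger0_norm (npdf_ge0 x)).
by rewrite ler_wpM2r ?npdf_ge0// (poly_small x).1.
Qed.

Let npdf2 x : `|(x ^+ 2 - 1) * npdf x| <= A.
Proof.
apply: le_trans (npdf_poly_bound x); rewrite normrM (ger0_norm (npdf_ge0 x)).
by rewrite ler_wpM2r ?npdf_ge0// (poly_small x).2.2.
Qed.

Let npdf_der2 x : is_derive x 1 (fun y => - y * npdf y) ((x ^+ 2 - 1) * npdf x).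
Proof.
apply: (der_eq (der_mul (der_opp (der_id x)) (npdf_der x))).
by ring.
Qed.

(** The same second-order remainder is bounded twice: the cubic bound is the better one for small
    [h], the quadratic one needs only second moments. Lindeberg's condition controls the minimum of
    the two. *)
Let Phi_taylor x h :
  `|Phi (x + h) - Phi x - npdf x * h - 2^-1 * (- x * npdf x) * h ^+ 2| <= A * `|h| ^+ 3 /\
  `|Phi (x + h) - Phi x - npdf x * h - 2^-1 * (- x * npdf x) * h ^+ 2| <= 2 * A * h ^+ 2.
Proof.
split.
  apply: (@taylor3_ray _ Phi npdf (fun y => - y * npdf y) (fun y => (y ^+ 2 - 1) * npdf y)) => t _.
  - exact: Phi_der.
  - exact: npdf_der.
  - exact: npdf_der2.
  - exact: npdf2.
have b1 : `|Phi (x + h) - Phi x - npdf x * h| <= A * h ^+ 2.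
  apply: (@taylor2_ray _ Phi npdf (fun y => - y * npdf y)) => t _.
  - exact: Phi_der.
  - exact: npdf_der.
  - exact: npdf1.
have b2 : `|2^-1 * (- x * npdf x) * h ^+ 2| <= A * h ^+ 2.
  rewrite normrM (ger0_norm (sqr_ge0 h)) ler_wpM2r ?sqr_ge0//.
  rewrite normrM ger0_norm//; have := npdf1 x; have := normr_ge0 (- x * npdf x); lra.
apply: (le_trans (ler_normB _ _)); move: b1 b2; lra.
Qed.

(* [heat t x s] solves the heat equation [d/ds = (1/2) d^2/dx^2]. *)
Definition heat t x s := Phi ((t - x) / Num.sqrt s).
(** [heat1] and [heat2] are the first two derivatives of [heat] in [x]; by the heat equation [heat2]
    is also twice the derivative in time. *)
Definition heat1 t x s := - (npdf ((t - x) / Num.sqrt s) / Num.sqrt s).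
Definition heat2 t x s := - ((t - x) / Num.sqrt s * npdf ((t - x) / Num.sqrt s)) / s.

Let heat_time t x s h : 0 < s -> 0 <= h ->
  `|heat t x (s + h) - heat t x s - 2^-1 * heat2 t x s * h| <= A * s ^- 2 * h ^+ 2.
Proof.
move=> s0 h0; set c := t - x.
pose b v := c / Num.sqrt v.
(* The second derivative in time. Since [b' = - b / (2 v)], each differentiation produces a
   polynomial in [b] times the density and one more power of [1 / v]. *)
pose f2 v := 2^-1 * v ^- 2 * (b v * npdf (b v)) + 4^-1 * v ^- 2 * ((b v - b v ^+ 3) * npdf (b v)).
have pos (u : R) : 0 <= u <= 1 -> 0 < s + u * h /\ s <= s + u * h.
  by move=> /andP[u0 u1]; rewrite ltr_wpDr ?lerDl// mulr_ge0.
have db (v : R) : 0 < v -> is_derive v 1 b (- (2^-1 * b v / v)).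
  move=> v0; have q0 : Num.sqrt v != 0 by rewrite gt_eqF// sqrtr_gt0.
  apply: (der_eq (der_mul (der_cst c v) (der_inv q0 (is_derive1_sqrt v0)))).
  rewrite /b -{5}(sqr_sqrtr (ltW v0)) mulr0 addr0; by field.
apply: (@taylor2_ray _ (heat t x) (fun v => 2^-1 * heat2 t x v) f2) => u /pos; move: (s + u * h) => v [v0 sv].
- apply: (der_eq (@der_comp _ Phi b v _ _ (Phi_der _) (db v v0))).
  by rewrite /heat2 -/c -/(b v); ring.
- have vn : v != 0 by rewrite gt_eqF.
  have dn := @der_comp _ npdf b v _ _ (npdf_der _) (db v v0).
  apply: (der_eq (der_mul (der_cst 2^-1 v) (der_mul (der_opp (der_mul (db v v0) dn)) (der_inv vn (der_id v))))).
  by rewrite /f2 -/(b v) ; field.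
- have vs : v ^- 2 <= s ^- 2.
    by rewrite lef_pV2 ?posrE ?exprn_gt0// lerXn2r ?nnegrE// ltW.
  have nb := npdf_poly_bound (b v); have [p1 [p3 _]] := poly_small (b v).
  have n0 := npdf_ge0 (b v).
  have e1 : `|b v * npdf (b v)| <= A.
    by apply: le_trans nb; rewrite normrM (ger0_norm n0) ler_wpM2r.
  have e2 : `|(b v - b v ^+ 3) * npdf (b v)| <= 2 * A.
    apply: (@le_trans _ _ (2 * ((1 + b v ^+ 4) * npdf (b v)))); last by rewrite ler_pM2l.
    rewrite mulrA normrM (ger0_norm n0) ler_wpM2r//.
    by apply: (le_trans (ler_normB _ _)); rewrite normrX; lra.
  have v2 : 0 <= v ^- 2 by rewrite invr_ge0 exprn_ge0// ltW.
  apply: (@le_trans _ _ (v ^- 2 * A)); last by rewrite mulrC ler_wpM2l.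
  have -> : f2 v = v ^- 2 * (2^-1 * (b v * npdf (b v)) + 4^-1 * ((b v - b v ^+ 3) * npdf (b v))).
    by rewrite /f2; ring.
  rewrite normrM (ger0_norm v2) ler_wpM2l//.
  apply: (le_trans (ler_normD _ _)).
  by rewrite (normrM 2^-1) (normrM 4^-1) !(ger0_norm (_ : 0 <= _^-1))//; lra.
Qed.

(** A move by [h] in space is compared with a wait of length [a] in time. The heat equation merges
    the second-order terms into [h ^+ 2 - a], which has mean 0 when [a] is the variance of [h]. The
    constant is uniform only for times bounded away from 0, hence the parameter [rho]. *)
Lemma heat_step rho : 1 <= rho -> exists2 K : R, 0 <= K &
  forall t x s h a, rho ^- 2 <= s -> 0 <= a ->
  [/\ `|heat t (x + h) s - heat t x (s + a) - heat1 t x s * h - 2^-1 * heat2 t x s * (h ^+ 2 - a)|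
       <= K * (Num.min (h ^+ 2) (`|h| ^+ 3) + a ^+ 2),
      `|heat1 t x s| <= K & `|heat2 t x s| <= K].
Proof.
move=> rho1; have rho0 : 0 < rho by apply: lt_le_trans rho1.
exists ((2 * A + normal_peak 1) * rho ^+ 4).
  by rewrite mulr_ge0 ?exprn_ge0 ?(ltW rho0)// addr_ge0 ?normal_peak_ge0// mulr_ge0.
move=> t x s h a srho a0.
have s0 : 0 < s by apply: lt_le_trans srho; rewrite invr_gt0 exprn_gt0.
pose r := (Num.sqrt s)^-1.
have r0 : 0 <= r by rewrite invr_ge0 sqrtr_ge0.
have rE : r ^+ 2 = s^-1 by rewrite exprVn sqr_sqrtr// ltW.
have r_rho : r <= rho.
  rewrite -(@ler_pXn2r _ 2) ?nnegrE// ?(ltW rho0)// rE -[leRHS]invrK.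
  by rewrite lef_pV2 ?posrE// invr_gt0 exprn_gt0.
have [||R3 R2] := @rate_bound r rho h; rewrite ?r0//.
set P4 := rho ^+ 4 in R2 R3 *.
have P41 : 1 <= P4 by rewrite exprn_ege1.
pose b := (t - x) * r.
have A0 := A_ge0; have pk0 := @normal_peak_ge0 R 1.
have [T3 T2] := Phi_taylor b (- (r * h)).
have e0 : heat t (x + h) s = Phi (b + - (r * h)) by rewrite /heat -/r /b; congr Phi; ring.
have e1 : heat1 t x s = - (npdf b * r) by [].
have e2 : heat2 t x s = - (b * npdf b) * r ^+ 2 by rewrite rE.
have T4 := @heat_time t x s a s0 a0.
have eR : heat t (x + h) s - heat t x (s + a) - heat1 t x s * h - 2^-1 * heat2 t x s * (h ^+ 2 - a)
  = (Phi (b + - (r * h)) - Phi b - npdf b * - (r * h) - 2^-1 * (- b * npdf b) * (- (r * h)) ^+ 2)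
   - (heat t x (s + a) - heat t x s - 2^-1 * heat2 t x s * a).
  rewrite e0 (_ : heat t x s = Phi b)// e1 e2; ring.
have s2 : s ^- 2 <= P4.
  rewrite -exprVn -rE -exprM /P4; rewrite lerXn2r ?nnegrE// ltW//.
split.
- rewrite eR; apply: (le_trans (ler_normB _ _)); rewrite mulrDr; apply: lerD; last first.
    apply: (le_trans T4); rewrite ler_wpM2r ?sqr_ge0//.
    apply: (@le_trans _ _ (A * P4)); first by rewrite ler_wpM2l.
    rewrite ler_wpM2r//; first by rewrite (le_trans ler01).
    lra.
  have fin X z w : X <= 2 * A * z -> z <= P4 * w -> 0 <= w -> X <= (2 * A + normal_peak 1) * P4 * w.
    move: A A0 => B B0 XB zw w0; apply: (le_trans XB).
    apply: (@le_trans _ _ (2 * B * (P4 * w))); first by rewrite ler_wpM2l// mulr_ge0.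
    by rewrite mulrA ler_wpM2r// ler_wpM2r ?(le_trans ler01)// lerDl.
  rewrite /Num.min; case: ifP => _.
    by apply: (fin _ _ _ T2); rewrite ?sqrrN// sqr_ge0.
  apply: (fin _ (`|r * h| ^+ 3)) => //.
  apply: (le_trans T3); rewrite normrN; apply: ler_wpM2r => //.
  by move: A A0 => B B0; lra.
- rewrite e1 normrN normrM (ger0_norm r0) (ger0_norm (npdf_ge0 b)).
  have pk : npdf b <= normal_peak 1 by apply: normal_pdf_ub; rewrite oner_neq0.
  have rP : r <= P4.
    apply: (le_trans r_rho); rewrite /P4 exprS ler_peMr ?(ltW rho0)// exprn_ege1//.
  apply: ler_pM => //; first exact: npdf_ge0.
  by apply: (le_trans pk); lra.
- rewrite e2 normrM normrN (ger0_norm (sqr_ge0 r)).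
  have := npdf1 b; rewrite mulNr normrN => n1.
  apply: ler_pM => //; first exact: sqr_ge0.
    by apply: (le_trans n1); lra.
  have [||_] := @rate_bound r rho 1; rewrite ?r0//.
  by rewrite expr1n !mulr1.
Qed.

Lemma measurable_Phi : measurable_fun setT (@Phi R).
Proof. exact: (continuous_measurable_fun Phi_continuous). Qed.

Let measurable_arg t s : measurable_fun setT (fun x : R => (t - x) / Num.sqrt s).
Proof. by apply: measurable_funM => //; apply: measurable_funB. Qed.

Lemma measurable_heat t s : measurable_fun setT (fun x => heat t x s).
Proof. exact: (measurableT_comp measurable_Phi (measurable_arg t s)). Qed.

Lemma measurable_heat1 t s : measurable_fun setT (fun x => heat1 t x s).
Proof.
apply: measurableT_comp => //; apply: measurable_funM => //.
exact: (measurableT_comp (measurable_normal_pdf 0 1) (measurable_arg t s)).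
Qed.

Lemma measurable_heat2 t s : measurable_fun setT (fun x => heat2 t x s).
Proof.
apply: measurable_funM => //; apply: measurableT_comp => //.
apply: measurable_funM; first exact: (measurable_arg t s).
exact: (measurableT_comp (measurable_normal_pdf 0 1) (measurable_arg t s)).
Qed.

End NormalCdf.

(** * Expectation and independence *)

Section Expectation.
Context {dT : measure_display} {T : measurableType dT} {R : realType}.
Variable P : probability T R.
Implicit Types (X Y : T -> R) (k : R).

Definition itg X : Prop := P.-integrable setT (EFin \o X).
Definition Ex X : R := Rintegral P setT X.

Lemma itg_meas X : itg X -> measurable_fun setT X.
Proof. by move=> /measurable_int /measurable_EFinP. Qed.

Lemma Ex_E X : itg X -> ('E_P[X] = (Ex X)%:E)%E.
Proof.
move=> iX; rewrite unlock /Ex /Rintegral fineK//.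
exact: (integrable_fin_num measurableT iX).
Qed.

Lemma itgD X Y : itg X -> itg Y -> itg (fun w => X w + Y w).
Proof. by move=> iX iY; exact: (integrableD measurableT iX iY). Qed.

Lemma itgB X Y : itg X -> itg Y -> itg (fun w => X w - Y w).
Proof. by move=> iX iY; exact: (integrableB measurableT iX iY). Qed.

Lemma itgZ k X : itg X -> itg (fun w => k * X w).
Proof. by move=> iX; exact: (integrableZl measurableT k iX). Qed.

Lemma itgN X : itg X -> itg (fun w => - X w).
Proof. by move=> iX; exact: (integrableN iX). Qed.

Lemma itg_sum n (X : nat -> T -> R) :
  (forall i, (i < n)%N -> itg (X i)) -> itg (fun w => \sum_(i < n) X i w).
Proof.
move=> h; rewrite /itg (_ : _ \o _ = fun w => (\sum_(i < n) (X i w)%:E)%E).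
  by apply: integrable_sum => // i _; apply: h.
by apply/funext => w /=; rewrite sumEFin.
Qed.

Lemma itg_cst k : itg (fun=> k).
Proof. exact: finite_measure_integrable_cst. Qed.

Lemma itg_le Y X : measurable_fun setT X -> (forall w, `|X w| <= Y w) -> itg Y -> itg X.
Proof.
move=> mX le; apply: le_integrable => //; first exact/measurable_EFinP.
by move=> w _ /=; rewrite lee_fin (le_trans (le w))// ler_norm.
Qed.

Lemma itg_bounded k X : measurable_fun setT X -> (forall w, `|X w| <= k) -> itg X.
Proof. by move=> mX b; apply: (itg_le mX b); exact: itg_cst. Qed.

Lemma itg_abs X : itg X -> itg (fun w => `|X w|).
Proof.
move=> iX; apply: (@le_integrable _ _ _ _ _ _ _ (EFin \o X)) => //.
  by apply/measurable_EFinP; apply: measurableT_comp => //; exact: itg_meas.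
by move=> w _ /=; rewrite lee_fin normr_id.
Qed.

Lemma itg_mulb k X Y : measurable_fun setT X -> (forall w, `|X w| <= k) -> itg Y ->
  itg (fun w => X w * Y w).
Proof.
move=> mX b iY; apply: (@itg_le (fun w => k * `|Y w|)).
- by apply: measurable_funM => //; exact: itg_meas.
- by move=> w; rewrite normrM ler_wpM2r.
- by apply: itgZ; exact: itg_abs.
Qed.

Lemma ExD X Y : itg X -> itg Y -> Ex (fun w => X w + Y w) = Ex X + Ex Y.
Proof. by move=> iX iY; exact: RintegralD. Qed.

Lemma ExB X Y : itg X -> itg Y -> Ex (fun w => X w - Y w) = Ex X - Ex Y.
Proof. by move=> iX iY; exact: RintegralB. Qed.

Lemma ExZ k X : itg X -> Ex (fun w => k * X w) = k * Ex X.
Proof. by move=> iX; exact: RintegralZl. Qed.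

Lemma ExN X : itg X -> Ex (fun w => - X w) = - Ex X.
Proof.
move=> iX; rewrite -mulN1r -ExZ//; congr Ex; apply/funext => w.
by rewrite mulN1r.
Qed.

Lemma Ex_cst k : Ex (fun=> k) = k.
Proof. by rewrite /Ex Rintegral_cst// (_ : _ setT = 1%E) ?mulr1//; exact: probability_setT. Qed.

Lemma Ex_sum n (X : nat -> T -> R) : (forall i, (i < n)%N -> itg (X i)) ->
  Ex (fun w => \sum_(i < n) X i w) = \sum_(i < n) Ex (X i).
Proof.
elim: n => [_|n IH h].
  rewrite big_ord0 -[RHS]Ex_cst; congr Ex; apply/funext => w.
  by rewrite big_ord0.
rewrite big_ord_recr /= -IH; last by move=> i ni; apply: h; rewrite ltnS ltnW.
have s : itg (fun w => \sum_(i < n) X i w).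
  by apply: itg_sum => i ni; apply: h; rewrite ltnS ltnW.
rewrite -(ExD s (h n (ltnSn n))).
by congr Ex; apply/funext => w; rewrite big_ord_recr.
Qed.

Lemma Ex_le X Y : itg X -> itg Y -> (forall w, X w <= Y w) -> Ex X <= Ex Y.
Proof. by move=> iX iY le; apply: le_Rintegral. Qed.

Lemma Ex_ge0 X : (forall w, 0 <= X w) -> 0 <= Ex X.
Proof. by move=> h; apply: Rintegral_ge0. Qed.

Lemma Ex_abs X : itg X -> `|Ex X| <= Ex (fun w => `|X w|).
Proof. by move=> iX; apply: le_normr_Rintegral. Qed.

Lemma Ex_le_bound X Y : measurable_fun setT X -> (forall w, `|X w| <= Y w) -> itg Y ->
  `|Ex X| <= Ex Y.
Proof.
move=> mX le iY; have iX := itg_le mX le iY.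
apply: (le_trans (Ex_abs iX)); apply: Ex_le => //; exact: itg_abs.
Qed.

Lemma Ex_indic A : measurable A -> (Ex (\1_A))%:E = P A.
Proof.
move=> mA; rewrite /Ex /Rintegral integral_indic// setIT fineK//.
by rewrite fin_num_measure.
Qed.

Lemma itg_indic A : measurable A -> itg (\1_A).
Proof.
by move=> mA; apply: (@itg_bounded 1) => // w; rewrite ger0_norm// indicE lern1 leq_b1.
Qed.

Lemma markov_ge X t : 0 < t -> itg X -> (forall w, 0 <= X w) ->
  (P [set w | t <= X w]%R <= (Ex X / t)%:E)%E.
Proof.
move=> t0 iX X0; have mX := itg_meas iX.
have mA : measurable [set w | t <= X w]%R.
  rewrite -[X in measurable X]setTI.
  by apply: (measurable_fun_le (f := cst t)) => //.
rewrite -Ex_indic// lee_fin ler_pdivlMr// mulrC -ExZ; last exact: itg_indic.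
apply: Ex_le => // [|w]; first by apply: itgZ; exact: itg_indic.
rewrite indicE; case: (boolP (w \in _)) => [/set_mem /= tX|_]; first by rewrite mulr1.
by rewrite mulr0.
Qed.

Lemma itg_of_bound X k : measurable_fun setT X -> (forall w, 0 <= X w) ->
  ('E_P[X] <= k%:E)%E -> itg X.
Proof.
move=> mX X0; rewrite unlock => h; apply/integrableP; split; first exact/measurable_EFinP.
rewrite (eq_integral (EFin \o X)); last by move=> w _ /=; rewrite ger0_norm.
by apply: (le_lt_trans h); rewrite ltry.
Qed.

End Expectation.

(** * Independence of two variables and of finite sequences *)

Section Independence.
Context {dT : measure_display} {T : measurableType dT} {R : realType}.
Variable P : probability T R.

Definition indep2 (X Y : T -> R) : Prop := forall A B : set R, measurable A -> measurable B ->
  P (X @^-1` A `&` Y @^-1` B) = (P (X @^-1` A) * P (Y @^-1` B))%E.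

Lemma indep2_comp X Y (f g : R -> R) : measurable_fun setT f -> measurable_fun setT g ->
  indep2 X Y -> indep2 (f \o X) (g \o Y).
Proof.
move=> mf mg h A B mA mB; apply: (h (f @^-1` A) (g @^-1` B)).
  by rewrite -[X in measurable X]setTI; exact: mf.
by rewrite -[X in measurable X]setTI; exact: mg.
Qed.

(** The joint law and the product of the marginal laws agree on rectangles, hence everywhere, and
    Tonelli's theorem factors the integral. *)
Lemma indep2_ge0 (X Y : T -> R) : measurable_fun setT X -> measurable_fun setT Y ->
  indep2 X Y -> (forall w, 0 <= X w) -> (forall w, 0 <= Y w) ->
  (\int[P]_w (X w * Y w)%:E = \int[P]_w (X w)%:E * \int[P]_w (Y w)%:E)%E.
Proof.
move=> mX mY iXY X0 Y0.
pose X' : {mfun T >-> R} := HB.pack_for {mfun T >-> R} X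
  (isMeasurableFun.Build _ _ _ _ X mX).
pose Y' : {mfun T >-> R} := HB.pack_for {mfun T >-> R} Y
  (isMeasurableFun.Build _ _ _ _ Y mY).
have mXY : measurable_fun setT (fun w => (X' w, Y' w)) by exact: measurable_fun_pair.
pose XY : {mfun T >-> (R * R)%type} :=
  HB.pack_for {mfun T >-> (R * R)%type} (fun w => (X' w, Y' w))
  (isMeasurableFun.Build _ _ _ _ _ mXY).
have pu := @product_measure_unique _ _ _ _ _ (distribution P X') (distribution P Y')
   (distribution P XY).
have {}pu : forall S, measurable S -> (distribution P X' \x distribution P Y')%E S = distribution P XY S.
  apply: pu => A B mA mB; rewrite /distribution /pushforward /= -iXY//.
(* Absolute values make the integrand nonnegative on the whole plane, as Tonelli's theorem requires;
   on the range of [X] and [Y] they change nothing. *)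
pose h (z : R * R) : \bar R := (`|z.1| * `|z.2|)%:E.
have mh : measurable_fun setT h.
  apply/measurable_EFinP; apply: measurable_funM.
    apply: (@measurableT_comp _ _ _ (R * R)%type R R (fun x : R => `|x|) setT fst); [exact: normr_measurable|exact: measurable_fst].
  apply: (@measurableT_comp _ _ _ (R * R)%type R R (fun x : R => `|x|) setT snd); [exact: normr_measurable|exact: measurable_snd].
have h0 z : (0 <= h z)%E by rewrite lee_fin mulr_ge0.
have e1 : (\int[P]_w (X w * Y w)%:E = \int[distribution P XY]_z h z)%E.
  rewrite ge0_integral_distribution//; apply: eq_integral => w _.
  by rewrite /h /= !ger0_norm.
rewrite e1 -(@eq_measure_integral _ _ _ setT _ (distribution P X' \x distribution P Y')%E); last first.
  by move=> S mS _; first [exact: pu|exact: esym (pu S mS)].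
rewrite fubini_tonelli1//.
have mn : measurable_fun setT (fun x : R => `|x|%:E).
  by apply/measurable_EFinP; exact: normr_measurable.
transitivity (\int[distribution P X']_x (`|x|%:E * \int[distribution P Y']_y `|y|%:E))%E.
  apply: eq_integral => x _; rewrite /fubini_F /h /=.
  by rewrite -ge0_integralZl_EFin.
rewrite ge0_integralZr//; last by apply: integral_ge0.
rewrite !ge0_integral_distribution//.
by congr (_ * _)%E; apply: eq_integral => w _ /=; rewrite ger0_norm.
Qed.

Lemma indep2_itg (X Y : T -> R) : indep2 X Y -> itg P X -> itg P Y ->
  itg P (fun w => X w * Y w).
Proof.
move=> iXY iX iY; have mX := itg_meas iX; have mY := itg_meas iY.
have nXY : indep2 (fun w => `|X w|) (fun w => `|Y w|).
  by apply: (@indep2_comp X Y (fun x : R => `|x|) (fun x : R => `|x|)) => //; exact: normr_measurable.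
have mn (Z : T -> R) : measurable_fun setT Z -> measurable_fun setT (fun w : T => `|Z w|).
  by move=> mZ; apply: measurableT_comp.
apply/integrableP; split; first by apply/measurable_EFinP; apply: measurable_funM.
have -> : (\int[P]_x `|(EFin \o (fun w : T => (X w * Y w)%R)) x|
     = \int[P]_x (`|X x| * `|Y x|)%:E)%E.
  by apply: eq_integral => w _ /=; rewrite normrM.
rewrite indep2_ge0//; try exact: mn.
move/integrableP : iX => [_ iX]; move/integrableP : iY => [_ iY].
by apply: lte_mul_pinfty => //; [apply: integral_ge0 => w _|rewrite ge0_fin_numE//; apply: integral_ge0].
Qed.

Lemma indep2_Ex (X Y : T -> R) : indep2 X Y -> itg P X -> itg P Y ->
  Ex P (fun w => X w * Y w) = Ex P X * Ex P Y.
Proof.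
move=> iXY iX iY; have mX := itg_meas iX; have mY := itg_meas iY.
pose p (x : R) := Num.max x 0; pose m (x : R) := Num.max (- x) 0.
have mp : measurable_fun setT p by apply: measurable_maxr.
have mm : measurable_fun setT m by apply: measurable_maxr => //; exact: measurableT_comp.
have p0 x : 0 <= p x by rewrite /p le_max lexx orbT.
have m0 x : 0 <= m x by rewrite /m le_max lexx orbT.
have pb x : `|p x| <= `|x|.
  by rewrite ger0_norm// /p ge_max ler_norm normr_ge0.
have mb x : `|m x| <= `|x|.
  by rewrite ger0_norm// /m ge_max -normrN ler_norm normr_ge0.
have pm x : x = p x - m x.
  rewrite /p /m; have [x0|/ltW x0] := leP 0 x.
    by rewrite max_r ?oppr_le0// subr0.
  by rewrite max_l ?oppr_ge0// sub0r opprK.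
have ig (f : R -> R) Z : measurable_fun setT f -> (forall x, `|f x| <= `|x|) -> itg P Z ->
    itg P (f \o Z).
  move=> mf fb iZ; apply: (itg_le _ (fun w => fb (Z w)) (itg_abs iZ)).
  exact: (measurableT_comp mf (itg_meas iZ)).
have prodE (f g : R -> R) : measurable_fun setT f -> (forall x, `|f x| <= `|x|) ->
    measurable_fun setT g -> (forall x, `|g x| <= `|x|) -> (forall x, 0 <= f x) ->
    (forall x, 0 <= g x) ->
    Ex P (fun w => (f \o X) w * (g \o Y) w) = Ex P (f \o X) * Ex P (g \o Y) /\
    itg P (fun w => (f \o X) w * (g \o Y) w).
  move=> mf fb mg gb f0 g0; have i2 := indep2_comp mf mg iXY.
  have if_ := ig f X mf fb iX; have ig_ := ig g Y mg gb iY.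
  split; last exact: indep2_itg.
  have e := indep2_ge0 (itg_meas if_) (itg_meas ig_) i2 (fun w => f0 (X w)) (fun w => g0 (Y w)).
  by rewrite /Ex /Rintegral e fineM//; exact: (integrable_fin_num measurableT).
have [e1 i1] := prodE p p mp pb mp pb p0 p0.
have [e2 i2] := prodE p m mp pb mm mb p0 m0.
have [e3 i3] := prodE m p mm mb mp pb m0 p0.
have [e4 i4] := prodE m m mm mb mm mb m0 m0.
have EX : Ex P X = Ex P (p \o X) - Ex P (m \o X).
  by rewrite -ExB; [congr Ex; apply/funext => w /=|exact: ig|exact: ig].
have EY : Ex P Y = Ex P (p \o Y) - Ex P (m \o Y).
  by rewrite -ExB; [congr Ex; apply/funext => w /=|exact: ig|exact: ig].
have -> : (fun w => X w * Y w) = (fun w => (((p \o X) w * (p \o Y) w - (p \o X) w * (m \o Y) w)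
    - ((m \o X) w * (p \o Y) w - (m \o X) w * (m \o Y) w))).
  by apply/funext => w; rewrite {1}(pm (X w)) {1}(pm (Y w)) /=; ring.
rewrite ExB ?ExB//; try exact: itgB.
by rewrite e1 e2 e3 e4 EX EY; ring.
Qed.

(* Independence of [X 0, ..., X (n-1)]. *)
Definition iRV (n : nat) (X : nat -> T -> R) : Prop :=
  (forall i, measurable_fun setT (X i)) /\
  forall B : nat -> set R, (forall i, measurable (B i)) ->
    P (\bigcap_(i in `I_n) X i @^-1` B i) = (\prod_(i < n) P (X i @^-1` B i))%E.

Lemma iRV_pred n X : iRV n.+1 X -> iRV n X.
Proof.
move=> [mX h]; split=> // B mB.
pose B' i := if (i < n)%N then B i else setT.
have mB' i : measurable (B' i) by rewrite /B'; case: ifP.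
have := h B' mB'; rewrite big_ord_recr /= {3}/B' ltnn preimage_setT probability_setT mule1.
have -> : (\prod_(i < n) P (X i @^-1` B' i) = \prod_(i < n) P (X i @^-1` B i))%E.
  by apply: eq_bigr => i _; rewrite /B' ltn_ord.
move=> <-; congr (P _); apply/seteqP; split => w hw i /=.
  by move=> _; rewrite /B'; case: ifP => // ni; apply: hw.
by move=> ni; have := hw i (ltnW ni); rewrite /B' ni.
Qed.

Lemma iRV_comp n X (f : nat -> R -> R) : (forall i, measurable_fun setT (f i)) ->
  iRV n X -> iRV n (fun i => f i \o X i).
Proof.
move=> mf [mX h]; split=> [i|B mB]; first exact: measurableT_comp.
apply: (h (fun i => f i @^-1` B i)) => i.
by rewrite -[X in measurable X]setTI; exact: mf.
Qed.

Let cylinders n (X : nat -> T -> R) : set (set T) :=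
  [set A | exists2 B : nat -> set R, (forall i, measurable (B i)) &
     A = \bigcap_(i in `I_n) X i @^-1` B i].

(** The measures [A |-> P (A & X n in C)] and [A |-> P (X n in C) * P A] coincide on the cylinders,
    which are closed under intersection, hence on the sigma-algebra that they generate. Sums and
    products of the first [n] variables are measurable for it. *)
Lemma iRV_group n X (S : T -> R) : iRV n.+1 X -> 
  measurable_fun (setT : set (g_sigma_algebraType (cylinders n X))) S -> indep2 S (X n).
Proof.
move=> iX mS A C mA mC; have [mX hX] := iX; have [_ hX'] := iRV_pred iX.
have mpre i (B : set R) : measurable B -> measurable (X i @^-1` B).
  by move=> mB; rewrite -[X in measurable X]setTI; exact: mX.
have gA : <<s cylinders n X >> (S @^-1` A).
  by have := mS measurableT A mA; rewrite setTI.
have pC0 : 0 <= fine (P (X n @^-1` C)) by rewrite fine_ge0.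
pose k : {nonneg R} := NngNum pC0.
have gm : cylinders n X `<=` measurable.
  move=> _ [B mB ->]; apply: bigcap_measurableType => i _; exact: mpre.
have gT : cylinders n X setT.
  by exists (fun=> setT) => //; apply/seteqP; split.
have gI : setI_closed (cylinders n X).
  move=> _ _ [B mB ->] [B' mB' ->]; exists (fun i => B i `&` B' i).
    by move=> i; apply: measurableI.
  by rewrite -bigcapI; apply: eq_bigcapr => i _; rewrite preimage_setI.
have kE : (fine (P (X n @^-1` C)))%:E = P (X n @^-1` C).
  by rewrite fineK// fin_num_measure//; exact: mpre.
have agree : forall D, cylinders n X D -> mrestr P (mpre n C mC) D = mscale k P D.
  move=> _ [B mB ->]; rewrite /mrestr /mscale /= kE.
  pose B' i := if (i < n)%N then B i else C.
  have mB' i : measurable (B' i) by rewrite /B'; case: ifP.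
  have := hX B' mB'; rewrite big_ord_recr /= {3}/B' ltnn.
  have -> : (\prod_(i < n) P (X i @^-1` B' i) = \prod_(i < n) P (X i @^-1` B i))%E.
    by apply: eq_bigr => i _; rewrite /B' ltn_ord.
  rewrite -hX'// muleC => <-; congr (P _); apply/seteqP; split => w.
    move=> [hw hC] i /=; rewrite ltnS leq_eqVlt => /orP[/eqP ->|ni].
      by rewrite /B' ltnn.
    by rewrite /B' ni; apply: hw.
  move=> hw; split.
    by move=> i ni; have := hw i (ltnW ni); rewrite /B' ni.
  by have := hw n (ltnSn n); rewrite /B' ltnn.
have cov : \bigcup_(k : nat) (setT : set T) = setT.
  by apply/seteqP; split=> // w _; exists 0%N.
have fin_ : forall i : nat, (mrestr P (mpre n C mC) setT < +oo)%E.
  move=> _; rewrite /mrestr setTI; apply: (le_lt_trans (probability_le1 _ _)); last by rewrite ltry.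
  exact (mpre n C mC).
have := @g_sigma_algebra_measure_unique _ R T (cylinders n X) gm (fun=> setT) (fun=> gT) cov
  (mrestr P (mpre n C mC)) (mscale k P) gI agree fin_ _ gA.
move=> e.
have {}e : (P (S @^-1` A `&` X n @^-1` C) = (fine (P (X n @^-1` C)))%:E * P (S @^-1` A))%E := e.
by rewrite e kE muleC.
Qed.

Let cylinder_measurable n X i : (i < n)%N ->
  (forall i, measurable_fun setT (X i)) ->
  measurable_fun (setT : set (g_sigma_algebraType (cylinders n X))) (X i).
Proof.
move=> ni mX _ B mB; rewrite setTI; apply: sub_sigma_algebra.
exists (fun j => if j == i then B else setT) => [j|]; first by case: ifP.
apply/seteqP; split => [w hw j /= nj|w /(_ i ni)]; last by rewrite eqxx.
by case: eqP => [->|].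
Qed.

Lemma iRV_sum n X : iRV n.+1 X -> indep2 (fun w => \sum_(i < n) X i w) (X n).
Proof.
move=> iX; apply: iRV_group => //.
rewrite (_ : (fun w => _) = (fun w => \sum_(i <- enum 'I_n) X i w)); last first.
  by apply/funext => w; rewrite big_enum.
by apply: measurable_sum => i; apply: cylinder_measurable => //; case: iX.
Qed.

Lemma iRV_prod n X : iRV n.+1 X -> indep2 (fun w => \prod_(i < n) X i w) (X n).
Proof.
move=> iX; apply: iRV_group => //.
rewrite (_ : (fun w => _) = (fun w => \prod_(i <- enum 'I_n) X i w)); last first.
  by apply/funext => w; rewrite big_enum.
by apply: measurable_prod => i _; apply: cylinder_measurable => //; case: iX.
Qed.

Lemma iRV_Ex_prod n X : iRV n X -> (forall i, (i < n)%N -> itg P (X i)) ->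
  itg P (fun w => \prod_(i < n) X i w) /\
  Ex P (fun w => \prod_(i < n) X i w) = \prod_(i < n) Ex P (X i).
Proof.
elim: n => [_ _|n IH iX h].
  rewrite big_ord0 (_ : (fun w => _) = fun=> 1).
    by split; [exact: itg_cst|exact: Ex_cst].
  by apply/funext => w; rewrite big_ord0.
have [i1 e1] := IH (iRV_pred iX) (fun i ni => h i (ltnW ni)).
have s := iRV_prod iX; have hn := h n (ltnSn n).
rewrite (_ : (fun w => _) = fun w => (\prod_(i < n) X i w) * X n w); last first.
  by apply/funext => w; rewrite big_ord_recr.
split; first exact: indep2_itg.
by rewrite indep2_Ex// big_ord_recr /= e1.
Qed.

Lemma iRV_Ex_sum2 n X : iRV n X -> (forall i, (i < n)%N -> itg P (fun w => X i w ^+ 2)) ->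
  (forall i, (i < n)%N -> Ex P (X i) = 0) ->
  itg P (fun w => (\sum_(i < n) X i w) ^+ 2) /\
  Ex P (fun w => (\sum_(i < n) X i w) ^+ 2) = \sum_(i < n) Ex P (fun w => X i w ^+ 2).
Proof.
move=> iX h h0.
have i1 i : (i < n)%N -> itg P (X i).
  move=> ni; apply: (@itg_le _ _ _ _ (fun w => 1 + X i w ^+ 2)).
  - by case: iX.
  - move=> w; rewrite -(real_normK (num_real (X i w))).
    by have := sqr_ge0 (`|X i w| - 1); nra.
  - by apply: itgD; [exact: itg_cst|exact: h].
elim: n => [|n IH] in iX h h0 i1 *.
  rewrite big_ord0 (_ : (fun w => _) = fun=> 0).
    by split; [exact: itg_cst|exact: Ex_cst].
  by apply/funext => w; rewrite big_ord0 expr0n.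
have [j1 e1] := IH (iRV_pred iX) (fun i ni => h i (ltnW ni)) (fun i ni => h0 i (ltnW ni))
  (fun i ni => i1 i (ltnW ni)).
have s := iRV_sum iX; have hn := h n (ltnSn n); have in1 := i1 n (ltnSn n).
have is1 : itg P (fun w => \sum_(i < n) X i w).
  by apply: itg_sum => i ni; apply: i1; rewrite ltnS ltnW.
have ip := indep2_itg s is1 in1; have ep := indep2_Ex s is1 in1.
have i2 : itg P (fun w => 2 * ((\sum_(i < n) X i w) * X n w)) by exact: itgZ.
have eF : (fun w => (\sum_(i < n.+1) X i w) ^+ 2) =
   fun w => ((\sum_(i < n) X i w) ^+ 2 + 2 * ((\sum_(i < n) X i w) * X n w)) + X n w ^+ 2.
  by apply/funext => w; rewrite big_ord_recr /=; ring.
rewrite eF; split; first by apply: itgD => //; exact: itgD.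
rewrite ExD ?ExD//; last exact: itgD.
by rewrite ExZ// ep h0// mulr0 mulr0 addr0 big_ord_recr /= e1.
Qed.

End Independence.

(** * Lindeberg's central limit theorem *)

Section LimitTheorems.
Context {dT : measure_display} {T : measurableType dT} {R : realType}.
Variable P : probability T R.

(* Replacing one summand by a Gaussian of the same variance amounts to running the
   heat flow for that time, so no Gaussian variables are needed. *)
Lemma lindeberg_heat (rho K : R) : 0 <= K ->
  (forall t x s h a : R, rho ^- 2 <= s -> 0 <= a ->
    [/\ `|heat t (x + h) s - heat t x (s + a) - heat1 t x s * h - 2^-1 * heat2 t x s * (h ^+ 2 - a)|
       <= K * (Num.min (h ^+ 2) (`|h| ^+ 3) + a ^+ 2),
      `|heat1 t x s| <= K & `|heat2 t x s| <= K]) ->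
  forall (t : R) n (X : nat -> T -> R) (s : R), rho ^- 2 <= s -> iRV P n X ->
  (forall i, (i < n)%N -> itg P (fun w => X i w ^+ 2)) ->
  (forall i, (i < n)%N -> Ex P (X i) = 0) ->
  `|Ex P (fun w => heat t (\sum_(i < n) X i w) s) - heat t 0 (s + \sum_(i < n) Ex P (fun w => X i w ^+ 2))|
  <= K * \sum_(i < n) (Ex P (fun w => Num.min (X i w ^+ 2) (`|X i w| ^+ 3)) + Ex P (fun w => X i w ^+ 2) ^+ 2).
Proof.
move=> K0 hK t; elim=> [|n IH] X s hs iX i2 e0.
  rewrite !big_ord0 addr0 mulr0 (_ : (fun w => _) = fun=> heat t 0 s) ?Ex_cst ?subrr ?normr0//.
  by apply/funext => w; rewrite big_ord0.
have mX i : measurable_fun setT (X i) by case: iX.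
set a := Ex P (fun w => X n w ^+ 2).
have a0 : 0 <= a by apply: Ex_ge0 => w; exact: sqr_ge0.
have hs' : rho ^- 2 <= s + a by apply: (le_trans hs); rewrite lerDl.
(* The last summand is exchanged first, because it is independent of the sum [S] of the others. Its
   variance [a] is added to the time, so the induction runs over all [s]. *)
have := IH X (s + a) hs' (iRV_pred iX) (fun i ni => i2 i (ltnW ni)) (fun i ni => e0 i (ltnW ni)).
rewrite 2!big_ord_recr /= -/a (addrC (\sum_(i < n) Ex P _) a) addrA => IHn.
pose S w := \sum_(i < n) X i w.
have mS : measurable_fun setT S.
  rewrite /S (_ : (fun w => _) = (fun w => \sum_(i <- enum 'I_n) X i w)).
    exact: measurable_sum.
  by apply/funext => w; rewrite big_enum.
pose U w := heat t (S w + X n w) s - heat t (S w) (s + a).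
pose V w := heat1 t (S w) s * X n w.
pose W w := heat2 t (S w) s * (X n w ^+ 2 - a).
have iX1 : itg P (X n).
  apply: (@itg_le _ _ _ _ (fun w => 1 + X n w ^+ 2)) => //.
  - move=> w; rewrite -(real_normK (num_real (X n w))).
    by have := sqr_ge0 (`|X n w| - 1); nra.
  - by apply: itgD; [exact: itg_cst|exact: i2].
have iX2 := i2 n (ltnSn n).
have bnd x u : `|heat t x u| <= 1 by rewrite ger0_norm ?Phi_ge0// Phi_le1.
have iH x u : measurable_fun setT x -> itg P (fun w => heat t (x w) u).
  move=> mx; apply: (@itg_bounded _ _ _ _ 1) => //.
  exact: (measurableT_comp (measurable_heat t u) mx).
have mSX : measurable_fun setT (fun w => S w + X n w) by apply: measurable_funD.
have iU : itg P U by apply: itgB; apply: iH.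
have m1 := measurableT_comp (measurable_heat1 t s) mS.
have m2 := measurableT_comp (measurable_heat2 t s) mS.
have b1 w : `|heat1 t (S w) s| <= K by have [] := hK t (S w) s 0 0 hs (lexx 0).
have b2 w : `|heat2 t (S w) s| <= K by have [] := hK t (S w) s 0 0 hs (lexx 0).
have ii : indep2 P S (X n) by exact: iRV_sum.
have i1S : itg P (fun w => heat1 t (S w) s) by exact: itg_bounded b1.
have i2S : itg P (fun w => heat2 t (S w) s) by exact: itg_bounded b2.
have iXa : itg P (fun w => X n w ^+ 2 - a) by apply: itgB => //; exact: itg_cst.
have indV : indep2 P (fun w => heat1 t (S w) s) (X n).
  exact: (@indep2_comp _ _ _ P S (X n) (fun x => heat1 t x s) id (measurable_heat1 t s)).
have indW : indep2 P (fun w => heat2 t (S w) s) (fun w => X n w ^+ 2 - a).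
  apply: (@indep2_comp _ _ _ P S (X n) (fun x => heat2 t x s) (fun x => x ^+ 2 - a)) => //.
    exact: measurable_heat2.
  by apply: measurable_funB => //; exact: measurable_funX.
have iV : itg P V by exact: indep2_itg.
have iW : itg P W by exact: indep2_itg.
have EV : Ex P V = 0 by rewrite /V indep2_Ex// e0// mulr0.
have EW : Ex P W = 0.
  by rewrite /W indep2_Ex// ExB ?Ex_cst ?subrr ?mulr0//; exact: itg_cst.
have mm : measurable_fun setT (fun w => Num.min (X n w ^+ 2) (`|X n w| ^+ 3)).
  apply: measurable_minr; apply: measurable_funX => //.
  exact: measurableT_comp.
have im : itg P (fun w => Num.min (X n w ^+ 2) (`|X n w| ^+ 3)).
  apply: (itg_le mm _ iX2) => w; rewrite ger0_norm; first by rewrite ge_min lexx.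
  by rewrite le_min sqr_ge0 exprn_ge0.
(* The first- and second-order terms [V] and [W] have mean 0 by independence, so subtracting them
   leaves the mean of [U] unchanged and exposes the Taylor remainder. *)
have step : `|Ex P U| <= K * (Ex P (fun w => Num.min (X n w ^+ 2) (`|X n w| ^+ 3)) + a ^+ 2).
  have -> : Ex P U = Ex P (fun w => (U w - V w) - 2^-1 * W w).
    by rewrite (ExB (itgB iU iV) (itgZ 2^-1 iW)) (ExB iU iV) (ExZ _ iW) EV EW mulr0 !subr0.
  have ic : itg P (fun w => Num.min (X n w ^+ 2) (`|X n w| ^+ 3) + a ^+ 2).
    by apply: itgD => //; exact: itg_cst.
  have -> : Ex P (fun w => Num.min (X n w ^+ 2) (`|X n w| ^+ 3)) + a ^+ 2 =
      Ex P (fun w => Num.min (X n w ^+ 2) (`|X n w| ^+ 3) + a ^+ 2).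
    by rewrite (ExD im (itg_cst P (a ^+ 2))) Ex_cst.
  rewrite -ExZ//; apply: Ex_le_bound; last exact: itgZ.
    exact: (itg_meas (itgB (itgB iU iV) (itgZ 2^-1 iW))).
  move=> w; have [+ _ _] := hK t (S w) s (X n w) a hs a0.
  by rewrite /U /V /W -mulrA.
have EU : Ex P U = Ex P (fun w => heat t (\sum_(i < n.+1) X i w) s) - Ex P (fun w => heat t (S w) (s + a)).
  have -> : (fun w => heat t (\sum_(i < n.+1) X i w) s) = (fun w => heat t (S w + X n w) s).
    by apply/funext => w; rewrite big_ord_recr.
  by rewrite -(ExB (iH _ s mSX) (iH _ (s + a) mS)).
rewrite EU in step.
rewrite mulrDr [leRHS]addrC.
rewrite -(subrKA (Ex P (fun w => heat t (S w) (s + a)))).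
by apply: (le_trans (ler_normD _ _)); apply: lerD; [exact: step|exact: IHn].
Qed.

(** The mean of [heat t (S w) s] is the probability that [S] plus an independent Gaussian of
    variance [s] is at most [t]. Moving the threshold by [delta] absorbs the Gaussian, up to its
    tail beyond [delta / sqrt s]. *)
Lemma heat_sandwich (t delta s : R) (S : T -> R) : 0 < s -> 0 < delta -> measurable_fun setT S ->
  fine (P [set w | S w <= t]) * Phi (delta / Num.sqrt s) <= Ex P (fun w => heat (t + delta) (S w) s) /\
  Ex P (fun w => heat (t - delta) (S w) s) <= fine (P [set w | S w <= t]) + Phi (- (delta / Num.sqrt s)).
Proof.
move=> s0 d0 mS; set A := [set w | S w <= t].
have q0 : 0 < Num.sqrt s by rewrite sqrtr_gt0.
have mA : measurable A.
  by rewrite /A -[X in measurable X]setTI; apply: measurable_fun_le => //.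
have iA := @itg_indic _ _ _ P A mA.
have EA : fine (P A) = Ex P (\1_A) by rewrite -Ex_indic.
have iH u : itg P (fun w => heat u (S w) s).
  apply: (@itg_bounded _ _ _ _ 1).
    exact: (measurableT_comp (measurable_heat u s) mS).
  by move=> w; rewrite ger0_norm ?Phi_ge0// Phi_le1.
rewrite EA; split.
  rewrite mulrC -ExZ//; apply: Ex_le => [||w]; [exact: itgZ|exact: iH|].
  rewrite indicE; case: (boolP (w \in A)) => [/set_mem /= wA|_].
    have {}wA : S w <= t := wA.
    rewrite mulr1; apply: Phi_nondecreasing; rewrite ler_pM2r ?invr_gt0//; lra.
  by rewrite mulr0 Phi_ge0.
set k := Phi (- _).
have -> : Ex P \1_A + k = Ex P (fun w => \1_A w + k).
  by rewrite (ExD iA (itg_cst P k)) Ex_cst.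
apply: Ex_le => [||w]; [exact: iH|exact: (itgD iA (itg_cst P k))|].
rewrite indicE; case: (boolP (w \in A)) => [_|/negP wA].
  by apply: (le_trans (Phi_le1 _)); rewrite lerDl Phi_ge0.
rewrite add0r; apply: Phi_nondecreasing; rewrite -mulNr ler_pM2r ?invr_gt0//.
have : ~ (S w <= t) by move=> h; apply: wA; exact/mem_set.
by move=> /negP; rewrite -ltNge; lra.
Qed.

End LimitTheorems.

(** The admissible Lindeberg sum [e0] depends on [t] and [eta] alone and is chosen before the
    probability space, so that the statement applies to every row of an array. *)
Lemma clt_uniform (R : realType) (t eta : R) : 0 < eta -> exists2 e0 : R, 0 < e0 &
  forall (dT : measure_display) (T : measurableType dT) (P : probability T R) n (X : nat -> T -> R),
  iRV P n X ->
  (forall i, (i < n)%N -> itg P (fun w => X i w ^+ 2)) ->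
  (forall i, (i < n)%N -> Ex P (X i) = 0) ->
  \sum_(i < n) Ex P (fun w => X i w ^+ 2) = 1 ->
  \sum_(i < n) (Ex P (fun w => Num.min (X i w ^+ 2) (`|X i w| ^+ 3)) + Ex P (fun w => X i w ^+ 2) ^+ 2) <= e0 ->
  `|fine (P [set w | \sum_(i < n) X i w <= t]) - Phi t| <= eta.
Proof.
move=> eta0; pose e4 := eta / 4.
have e40 : 0 < e4 by rewrite divr_gt0.
have [r r0 hr] : exists2 r : R, 0 < r & forall x, `|x - t| < r -> `|Phi x - Phi t| <= e4.
  have /cvgrPdist_le/(_ _ e40) := @Phi_continuous R t.
  move=> /nbhs_ballP[r /= r0 h]; exists r => // x xr.
  by rewrite distrC; apply: h; rewrite /ball /= distrC.
have [M M0 [MN MP]] := Phi_tail e40.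
pose delta := r / 4; have d0 : 0 < delta by rewrite divr_gt0.
(* With [s = rho ^ -2], the second entry makes the smoothing Gaussian exceed [delta] with
   probability at most [e4]; the third makes the extra variance [s] move the final threshold by at
   most [r / 4]. *)
pose rho := Num.max 1 (Num.max (M / delta) (4 * (`|t| + delta) / r)).
have rho1 : 1 <= rho by rewrite le_max lexx.
have rho0 : 0 < rho by apply: lt_le_trans rho1.
have rhoM : M <= delta * rho by rewrite -ler_pdivrMl// mulrC !le_max lexx orbT.
have rhor : (`|t| + delta) / rho <= r / 4.
  rewrite ler_pdivrMr//; have : 4 * (`|t| + delta) / r <= rho by rewrite !le_max lexx !orbT.
  by rewrite ler_pdivrMr//; lra.
have [K K0 hK] := @heat_step R rho rho1.
exists (e4 / (K + 1)); first by rewrite divr_gt0// ltr_wpDl.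
move=> dT T P n X iX i2 m0 v1 hsum.
pose s := rho ^- 2; have s0 : 0 < s by rewrite invr_gt0 exprn_gt0.
have sq : (Num.sqrt s)^-1 = rho.
  by rewrite /s -exprVn sqrtr_sqr ger0_norm ?invrK// invr_ge0 ltW.
have mX i : measurable_fun setT (X i) by case: iX.
have mS : measurable_fun setT (fun w => \sum_(i < n) X i w).
  rewrite (_ : (fun w => _) = (fun w => \sum_(i <- enum 'I_n) X i w)).
    exact: measurable_sum.
  by apply/funext => w; rewrite big_enum.
have lin u := @lindeberg_heat _ _ _ P rho K K0 hK u n X s (lexx _) iX i2 m0.
rewrite v1 in lin.
have {}lin u : `|Ex P (fun w => heat u (\sum_(i < n) X i w) s) - heat u 0 (s + 1)| <= e4.
  apply: (le_trans (lin u)); apply: (le_trans (ler_wpM2l K0 hsum)).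
  have K1 : 0 < K + 1 by rewrite ltr_wpDl.
  by rewrite mulrA ler_pdivrMr// mulrC ler_wpM2l ?(ltW e40)// lerDl.
(* After all exchanges the flow has run from 0 for the time [s + 1], so [Phi (u / sqrt (s + 1))]
   remains; [1 / sqrt (1 + s) >= 1 - s] and [s <= 1 / rho] keep its argument near [t]. *)
have near_t u : `|u - t| <= delta -> `|heat u 0 (s + 1) - Phi t| <= e4.
  move=> ut; apply: hr; rewrite subr0.
  pose b := (Num.sqrt (s + 1))^-1.
  have s1 : 1 <= s + 1 by rewrite lerDr ltW.
  have sq1 : 1 <= Num.sqrt (s + 1) by rewrite -[leLHS]sqrtr1 ler_sqrt// (le_trans ler01).
  have sq2 : Num.sqrt (s + 1) ^+ 2 = s + 1 by rewrite sqr_sqrtr// (le_trans ler01).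
  have b0 : 0 < b by rewrite invr_gt0 (lt_le_trans ltr01).
  have b1 : b <= 1 by rewrite invf_le1// (lt_le_trans ltr01).
  have bs : 1 - s <= b.
    have bq : b * Num.sqrt (s + 1) = 1 by rewrite mulVf// gt_eqF// (lt_le_trans ltr01).
    by move: bq sq1 sq2 b0 b1 s0; rewrite -/b; move: (Num.sqrt _) b => q b; nra.
  have sr : s <= rho^-1.
    by rewrite /s -exprVn expr2 ler_piMr ?invr_ge0 ?(ltW rho0)// invf_le1.
  rewrite -/b.
  have -> : u * b - t = (u - t) - u * (1 - b) by ring.
  apply: (le_lt_trans (ler_normB _ _)).
  have ub : `|u| <= `|t| + delta.
    by rewrite -[u](subrK t) addrC (le_trans (ler_normD _ _))// lerD2l.
  have : `|u * (1 - b)| <= (`|t| + delta) / rho.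
    rewrite normrM; apply: ler_pM => //; rewrite ger0_norm ?subr_ge0//; lra.
  move: ut rhor; rewrite /delta; move: r0; lra.
have [up lo] := @heat_sandwich _ _ _ P t delta s _ s0 d0 mS.
rewrite sq in up lo.
set p := fine _ in up lo *.
have p1 : p <= 1.
  rewrite -lee_fin fineK ?fin_num_measure//; first apply: probability_le1.
    by rewrite -[X in measurable X]setTI; apply: measurable_fun_le.
  by rewrite -[X in measurable X]setTI; apply: measurable_fun_le.
have p0 : 0 <= p by rewrite fine_ge0.
have P1 : 1 - e4 <= Phi (delta * rho) by apply: (le_trans MP); exact: Phi_nondecreasing.
have P2 : Phi (- (delta * rho)) <= e4.
  by apply: le_trans MN; apply: Phi_nondecreasing; rewrite lerN2.
have L1 := lin (t + delta); have L2 := lin (t - delta).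
have N1 := near_t (t + delta) _; have N2 := near_t (t - delta) _.
have {}N1 := N1 ltac:(by rewrite addrC addKr ger0_norm// ltW).
have {}N2 := N2 ltac:(by rewrite addrC addKr normrN ger0_norm// ltW).
move: up lo L1 L2 N1 N2; rewrite !ler_norml.
set E1 := Ex P _; set E2 := Ex P _; set h1 := heat _ _ _; set h2 := heat _ _ _.
move=> up lo /andP[_ L1] /andP[L2 _] /andP[_ N1] /andP[N2 _].
have : p * (1 - e4) <= p * Phi (delta * rho) by rewrite ler_wpM2l.
have : p * e4 <= e4 by rewrite ler_piMl// ltW.
have : eta = 4 * e4 by rewrite /e4; field.
move=> ee pe pp; apply/andP; split; [lra|nra].
Qed.

(** * Conditional moments *)

Lemma measurable_preimage d1 d2 (T1 : measurableType d1) (T2 : measurableType d2) (f : T1 -> T2)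
  (B : set T2) : measurable_fun setT f -> measurable B -> measurable (f @^-1` B).
Proof. by move=> mf mB; rewrite -[X in measurable X]setTI; exact: mf. Qed.

Section Conditioning.
Context {dT : measure_display} {T : measurableType dT} {R : realType}.
Variable P : probability T R.

Import HBNNSimple.

(** Nonnegativity of [D] in mean on each event [f in B] passes to nonnegative simple weights, and
    then to [f] by dominated convergence. The conditioning sigma-algebra enters only through these
    events, so it can remain a plain set of sets. *)
Lemma Ex_mul_ge0 (D f : T -> R) : itg P D -> measurable_fun setT f ->
  (forall B : set R, measurable B -> 0 <= Ex P (fun w => \1_(f @^-1` B) w * D w)) ->
  (forall w, 0 <= f w) -> itg P (fun w => f w * D w) ->
  0 <= Ex P (fun w => f w * D w).
Proof.
move=> iD mf hB f0 ifD.
have mE : measurable_fun setT (EFin \o (fun x : R => Num.max x 0)).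
  by apply/measurable_EFinP; exact: measurable_maxr.
(* The approximants are functions of a real variable; after composition with [f] their level sets
   are preimages under [f], the events about which [hB] speaks. *)
pose h k := nnsfun_approx measurableT mE k.
have mhf k : measurable_fun setT (fun w => h k (f w)).
  by apply: (measurableT_comp _ mf).
have mhk k y : measurable (h k @^-1` [set y]).
  by apply: (measurable_preimage (measurable_funP (h k))).
have h_cvg (x : R) : 0 <= x -> h k x @[k --> \oo] --> x.
  move=> x0.
  have cv := @cvg_nnsfun_approx _ _ _ _ measurableT _ mE _ x.
  have e0 : forall y : R, setT y -> (0 <= (Num.max y 0)%R%:E)%E.
    by move=> y _; rewrite lee_fin le_max lexx orbT.
  have {}cv := cv e0 Logic.I.
  by rewrite /= max_l// in cv; move/fine_cvgP : cv => [].
have h_le k (x : R) : 0 <= x -> h k x <= x.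
  move=> x0; have cv := h_cvg x x0; rewrite -[leRHS](cvg_lim _ cv)//.
  apply: (@nondecreasing_cvgn_le _ (fun k => h k x)) => [m n mn|].
    by have /(_ m n mn)/lefP := nd_nnsfun_approx measurableT mE.
  by apply/cvg_ex; exists x.
have ih k : itg P (fun w => h k (f w) * D w).
  apply: (@itg_le _ _ _ _ (fun w => `|f w * D w|)).
  - exact: (measurable_funM (mhf k) (itg_meas iD)).
  - by move=> w; rewrite !normrM ler_wpM2r// !ger0_norm ?h_le.
  - exact: itg_abs.
have simple k : 0 <= Ex P (fun w => h k (f w) * D w).
  have -> : (fun w => h k (f w) * D w) =
     (fun w => \sum_(y <- finmap.enum_fset (fset_set (range (h k))))
        y * (\1_(f @^-1` (h k @^-1` [set y])) w * D w)).
    apply/funext => w; rewrite fimfunE fsbig_finite//= mulr_suml.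
    by apply: eq_bigr => y _; rewrite mulrA.
  have : forall y, y \in finmap.enum_fset (fset_set (range (h k))) -> 0 <= y.
    by move=> y; rewrite in_fset_set// inE => -[x _ <-].
  elim: (finmap.enum_fset _) => [_|y s IH hs].
    by apply: Ex_ge0 => w; rewrite big_nil.
  have iy z : itg P (fun w => z * (\1_(f @^-1` (h k @^-1` [set z])) w * D w)).
    apply: itgZ; apply: (@itg_mulb _ _ _ _ 1) => //.
      by apply: measurable_indic; apply: (measurable_preimage mf); exact: mhk.
    by move=> w; rewrite ger0_norm// indicE lern1 leq_b1.
  have is_ : itg P (fun w => \sum_(z <- s) z * (\1_(f @^-1` (h k @^-1` [set z])) w * D w)).
    elim: s {IH hs} => [|z s IH].
      rewrite (_ : (fun w => _) = fun=> 0); first exact: itg_cst.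
      by apply/funext => w; rewrite big_nil.
    rewrite (_ : (fun w => _) = fun w => z * (\1_(f @^-1` (h k @^-1` [set z])) w * D w) +
      \sum_(z <- s) z * (\1_(f @^-1` (h k @^-1` [set z])) w * D w)); first exact: itgD (iy z) IH.
    by apply/funext => w; rewrite big_cons.
  rewrite (_ : (fun w => _) = fun w => y * (\1_(f @^-1` (h k @^-1` [set y])) w * D w) +
      \sum_(z <- s) z * (\1_(f @^-1` (h k @^-1` [set z])) w * D w)); last first.
    by apply/funext => w; rewrite big_cons.
  rewrite (ExD (iy y) is_); apply: addr_ge0; last first.
    by apply: IH => z zs; apply: hs; rewrite inE zs orbT.
  rewrite ExZ; last first.
    apply: (@itg_mulb _ _ _ _ 1) => //.
      by apply: measurable_indic; apply: (measurable_preimage mf); exact: mhk.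
    by move=> w; rewrite ger0_norm// indicE lern1 leq_b1.
  apply: mulr_ge0; first by apply: hs; rewrite inE eqxx.
  by apply: hB; exact: mhk.
have [|||||_ _ cv] := @dominated_convergence _ _ _ P setT measurableT
  (fun k => EFin \o (fun w => h k (f w) * D w)) (EFin \o (fun w => f w * D w))
  (EFin \o (fun w => `|f w * D w|)).
- by move=> k; exact: (measurable_int P (ih k)).
- exact: (measurable_int P ifD).
- apply: aeW => w _; apply: cvg_EFin; first exact: nearW.
  by apply: cvgMl; apply: h_cvg.
- exact: itg_abs.
- apply: aeW => w k _ /=.
  by rewrite lee_fin !normrM ler_wpM2r// !ger0_norm ?h_le.
have {}cv : Ex P (fun w => h k (f w) * D w) @[k --> \oo] --> Ex P (fun w => f w * D w).
  apply: fine_cvg; rewrite fineK; last exact: (integrable_fin_num measurableT ifD).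
  exact: cv.
rewrite -(cvg_lim _ cv)//; apply: limr_ge; first by apply/cvg_ex; exists (Ex P (fun w => f w * D w)).
exact: nearW.
Qed.

Lemma Ex_set_indic (A : set T) (X : T -> R) : measurable A -> itg P X ->
  (\int[P]_(w in A) (X w)%:E)%E = (Ex P (fun w => \1_A w * X w))%:E.
Proof.
move=> mA iX; rewrite integral_mkcond -Ex_E ?unlock.
  apply: eq_integral => w _; rewrite /= patchE indicE.
  by case: ifP => _; rewrite ?mul1r ?mul0r.
apply: (@itg_mulb _ _ _ _ 1) => //.
by move=> w; rewrite ger0_norm// indicE lern1 leq_b1.
Qed.

(** The rule for pulling out a known factor: [Ex_mul_ge0] is applied to [X] and to [- X], with the
    positive and the negative part of [f] as weights. *)
Lemma cond_exp_zero_mul (G : set (set T)) (X f : T -> R) :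
  G `<=` measurable -> (forall B : set R, measurable B -> G (f @^-1` B)) ->
  cond_exp_zero P G X -> itg P (fun w => f w * X w) -> Ex P (fun w => f w * X w) = 0.
Proof.
move=> Gm fG [iX _ _ hA] ifX.
have mf : measurable_fun setT f.
  by move=> _ B mB; rewrite setTI; apply: Gm; apply: fG.
have h0 (g : R -> R) : measurable_fun setT g -> forall B : set R, measurable B ->
    Ex P (fun w => \1_((g \o f) @^-1` B) w * X w) = 0.
  move=> mg B mB; have mgB : measurable (g @^-1` B).
    by exact: (measurable_preimage mg mB).
  have GA : G ((g \o f) @^-1` B) by apply: (fG (g @^-1` B)).
  apply: EFin_inj; rewrite -Ex_set_indic//; last exact: Gm.
  by rewrite hA// integral0_eq.
pose p (x : R) := Num.max x 0; pose m (x : R) := Num.max (- x) 0.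
have mp : measurable_fun setT p by apply: measurable_maxr.
have mm : measurable_fun setT m by apply: measurable_maxr => //; exact: measurableT_comp.
have part (g : R -> R) : measurable_fun setT g -> (forall x, 0 <= g x) ->
    (forall x, `|g x| <= `|x|) -> itg P (fun w => g (f w) * X w) /\ Ex P (fun w => g (f w) * X w) = 0.
  move=> mg g0 gb.
  have mgf : measurable_fun setT (fun w => g (f w)) by exact: (measurableT_comp mg mf).
  have ig : itg P (fun w => g (f w) * X w).
    apply: (@itg_le _ _ _ _ (fun w => `|f w * X w|)).
    - exact: (measurable_funM mgf (itg_meas iX)).
    - by move=> w; rewrite !normrM ler_wpM2r.
    - exact: itg_abs.
  split=> //; apply/eqP; rewrite eq_le; apply/andP; split.
    rewrite -oppr_ge0 -ExN//.
    have -> : (fun w => - (g (f w) * X w)) = (fun w => g (f w) * - X w).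
      by apply/funext => w; rewrite mulrN.
    apply: Ex_mul_ge0 => //; first exact: itgN.
      move=> B mB; rewrite (_ : (fun w => _) = (fun w => - (\1_((g \o f) @^-1` B) w * X w))).
        rewrite ExN ?(h0 g)// ?oppr0//.
        apply: (@itg_mulb _ _ _ _ 1) => //.
          apply: measurable_indic; exact: (measurable_preimage mgf).
        by move=> w; rewrite ger0_norm// indicE lern1 leq_b1.
      by apply/funext => w; rewrite mulrN.
    rewrite (_ : (fun w => _) = (fun w => - (g (f w) * X w))); first exact: itgN.
    by apply/funext => w; rewrite mulrN.
  by apply: Ex_mul_ge0 => // B mB; rewrite (h0 g).
have p0 x : 0 <= p x by rewrite /p le_max lexx orbT.
have m0 x : 0 <= m x by rewrite /m le_max lexx orbT.
have [i1 e1] := part p mp p0 (fun x => ltac:(by rewrite ger0_norm// /p ge_max ler_norm normr_ge0)).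
have [i2 e2] := part m mm m0 (fun x => ltac:(by rewrite ger0_norm// /m ge_max -normrN ler_norm normr_ge0)).
have -> : (fun w => f w * X w) = (fun w => p (f w) * X w - m (f w) * X w).
  apply/funext => w; rewrite -mulrBl; congr (_ * _); rewrite /p /m.
  have [x0|/ltW x0] := leP 0 (f w); first by rewrite max_r ?oppr_le0// subr0.
  by rewrite max_l ?oppr_ge0// sub0r opprK.
by rewrite (ExB i1 i2) e1 e2 subr0.
Qed.

(** The version [W] lies between [c] and [C] almost surely, so [X - c] and [C - X] have nonnegative
    mean on every event of [G], and [Ex_mul_ge0] extends this to the weight [f]. *)
Lemma cond_exp_between_mul (G : set (set T)) (X f : T -> R) (c C : R) :
  G `<=` measurable -> (forall B : set R, measurable B -> G (f @^-1` B)) ->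
  cond_exp_between P G X c C -> (forall w, 0 <= f w) -> itg P f -> itg P (fun w => f w * X w) ->
  c * Ex P f <= Ex P (fun w => f w * X w) <= C * Ex P f.
Proof.
move=> Gm fG [W [[iX _ iW hA] Wb]] f0 if_ ifX.
have mf : measurable_fun setT f.
  by move=> _ B mB; rewrite setTI; apply: Gm; apply: fG.
have i1 A : measurable A -> itg P (fun w => \1_A w * X w).
  move=> mA; apply: (@itg_mulb _ _ _ _ 1) => //.
  by move=> w; rewrite ger0_norm// indicE lern1 leq_b1.
have i1W A : measurable A -> itg P (fun w => \1_A w * W w).
  move=> mA; apply: (@itg_mulb _ _ _ _ 1) => //.
  by move=> w; rewrite ger0_norm// indicE lern1 leq_b1.
have XW A : G A -> Ex P (fun w => \1_A w * X w) = Ex P (fun w => \1_A w * W w).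
  by move=> GA; apply: EFin_inj; rewrite -!Ex_set_indic ?hA//; exact: Gm.
have aeb : {ae P, forall w, (c <= W w <= C)} := Wb.
have ic A k : measurable A -> itg P (fun w => \1_A w * k).
  move=> mA; apply: (@itg_mulb _ _ _ _ 1) => //; last exact: itg_cst.
  by move=> w; rewrite ger0_norm// indicE lern1 leq_b1.
have ae_Ex (Y Z : T -> R) : itg P Y -> itg P Z -> {ae P, forall w, Y w <= Z w} -> Ex P Y <= Ex P Z.
  move=> iY iZ YZ.
  pose V w := Num.max (Y w - Z w) 0.
  have mV : measurable_fun setT V.
    by apply: measurable_maxr => //; exact: (measurable_funB (itg_meas iY) (itg_meas iZ)).
  have V0 w : 0 <= V w by rewrite /V le_max lexx orbT.
  have iV : itg P V.
    apply: (@itg_le _ _ _ _ (fun w => `|Y w - Z w|)) => //; last by apply: itg_abs; exact: itgB.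
    by move=> w; rewrite ger0_norm// /V ge_max ler_norm normr_ge0.
  have : Ex P V = 0.
    rewrite /Ex /Rintegral (@ae_eq_integral _ _ _ P setT (cst 0%E)) ?integral_cst ?mul0e//.
      exact/measurable_EFinP.
    by apply: filterS YZ => w yz _ /=; rewrite /V max_r// subr_le0.
  have : Ex P (fun w => Y w - Z w) <= Ex P V.
    by apply: Ex_le => //; [exact: itgB|move=> w; rewrite /V le_max lexx].
  by rewrite ExB// => h e; move: h; rewrite e subr_le0.
have iY k (b : bool) : itg P (fun w => f w * ((-1) ^+ b * (X w - k))).
  have -> : (fun w => f w * ((-1) ^+ b * (X w - k))) = (fun w => (-1) ^+ b * (f w * X w - k * f w)).
    by apply/funext => w; ring.
  by apply: itgZ; apply: itgB => //; exact: itgZ.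
(* The sign handles both bounds: [b = false] with [k = c] for the lower one, [b = true] with [k = C]
   for the upper one. *)
have key k (b : bool) : (forall A, G A -> 0 <= Ex P (fun w => \1_A w * ((-1) ^+ b * (X w - k)))) ->
    0 <= (-1) ^+ b * (Ex P (fun w => f w * X w) - k * Ex P f).
  move=> h; have -> : (-1) ^+ b * (Ex P (fun w => f w * X w) - k * Ex P f) = 
     Ex P (fun w => f w * ((-1) ^+ b * (X w - k))).
    have -> : (fun w => f w * ((-1) ^+ b * (X w - k))) = (fun w => (-1) ^+ b * (f w * X w - k * f w)).
      by apply/funext => w; ring.
    by rewrite (ExZ _ (itgB ifX (itgZ k if_))) (ExB ifX (itgZ k if_)) (ExZ _ if_).
  apply: Ex_mul_ge0 => //; last by move=> B mB; apply: h; apply: fG.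
  by apply: itgZ; apply: itgB => //; exact: itg_cst.
have prep A k (b : bool) : G A -> Ex P (fun w => \1_A w * ((-1) ^+ b * (X w - k))) =
    (-1) ^+ b * (Ex P (fun w => \1_A w * W w) - Ex P (fun w => \1_A w * k)).
  move=> GA; rewrite -XW// -(ExB (i1 _ (Gm _ GA)) (ic _ k (Gm _ GA))).
  rewrite -ExZ; last by apply: itgB; [exact: i1 (Gm _ GA)|exact: ic (Gm _ GA)].
  by congr Ex; apply/funext => w; ring.
apply/andP; split.
  have := key c false; rewrite expr0 mul1r subr_ge0; apply => A GA.
  rewrite (prep _ _ false)// expr0 mul1r subr_ge0.
  apply: ae_Ex; [exact: ic (Gm _ GA)|exact: i1W (Gm _ GA)|].
  by apply: filterS aeb => w /andP[cw _]; rewrite ler_wpM2l// indicE.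
have := key C true; rewrite expr1 mulN1r oppr_ge0 subr_le0; apply => A GA.
rewrite (prep _ _ true)// expr1 mulN1r oppr_ge0 subr_le0.
apply: ae_Ex; [exact: i1W (Gm _ GA)|exact: ic (Gm _ GA)|].
by apply: filterS aeb => w /andP[_ cw]; rewrite ler_wpM2l// indicE.
Qed.

End Conditioning.

(** * Exponential and truncation bounds *)

Section Concentration.
Context {dT : measure_display} {T : measurableType dT} {R : realType}.
Variable P : probability T R.

(** The function [(1 + y + y ^ 2) exp (- y)] has derivative [y (1 - y) exp (- y)], so it is at least
    its value 1 at the origin for all arguments up to 1. *)
Lemma expR_quadratic (x : R) : `|x| <= 1 -> expR x <= 1 + x + x ^+ 2.
Proof.
rewrite ler_norml => /andP[x1 x2].
pose g (y : R) := (1 + y + y ^+ 2) * expR (- y).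
pose g1 (y : R) := y * (1 - y) * expR (- y).
have dg (y : R) : is_derive y 1 g (g1 y).
  have de : is_derive y 1 (fun u : R => expR (- u)) (expR (- y) * - 1).
    exact: (@der_comp _ expR (fun u => - u) y _ _ (is_derive_expR _) (der_opp (der_id y))).
  have dp : is_derive y 1 (fun u : R => 1 + u + u ^+ 2) (1 + 2 * y).
    have -> : (fun u : R => 1 + u + u ^+ 2) = (fun u : R => 1 + u + u * u).
      by apply/funext => u; rewrite expr2.
    apply: (der_eq (der_add (der_add (der_cst 1 y) (der_id y)) (der_mul (der_id y) (der_id y)))).
    by ring.
  by apply: (der_eq (der_mul dp de)); rewrite /g1; ring.
have [t /andP[t0 t1]] := @mvt_ray R g g1 0 x (fun t _ => dg _).
rewrite !add0r => e.
have g0 : g 0 = 1 by rewrite /g oppr0 expR0; ring.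
have : 0 <= g x - g 0.
  rewrite e /g1.
  have -> : t * x * (1 - t * x) * expR (- (t * x)) * x = t * x ^+ 2 * (1 - t * x) * expR (- (t * x)).
    by ring.
  rewrite mulr_ge0 ?expR_ge0// mulr_ge0//; first by rewrite mulr_ge0// sqr_ge0.
  by nra.
rewrite g0 subr_ge0 /g expRN ler_pdivlMr ?expR_gt0// mul1r.
exact.
Qed.

(** Markov's inequality for the exponential of the sum over [B], the largest rate at which
    [expR_quadratic] applies to terms bounded by [B]. Truncation destroys centring, so the bound
    keeps the means of the terms. *)
Lemma chernoff n (Y : nat -> T -> R) (B u : R) : 0 < B -> iRV P n Y ->
  (forall i w, `|Y i w| <= B) ->
  (P [set w | u <= \sum_(i < n) Y i w]%R <=
   (expR (- (u / B) + \sum_(i < n) (`|Ex P (Y i)| / B + Ex P (fun w => Y i w ^+ 2) / B ^+ 2)))%:E)%E.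
Proof.
move=> B0 iY bY; have mY i : measurable_fun setT (Y i) by case: iY.
pose e (x : R) := expR (x / B).
have me : measurable_fun setT e.
  by apply: measurableT_comp => //; exact: measurable_funM.
have iZ := @iRV_comp _ _ _ P n Y (fun=> e) (fun=> me) iY.
have bZ i w : `|(e \o Y i) w| <= expR 1.
  rewrite /e /= ger0_norm ?expR_ge0// ler_expR ler_pdivrMr// mul1r.
  exact: ler_normlW.
have itZ i : itg P (e \o Y i).
  exact: (@itg_bounded _ _ _ P (expR 1) (e \o Y i) (measurableT_comp me (mY i)) (bZ i)).
have itY i : itg P (Y i) by exact: (itg_bounded P (mY i) (bY i)).
have itY2 i : itg P (fun w => Y i w ^+ 2).
  apply: (@itg_bounded _ _ _ _ (B ^+ 2)); first exact: measurable_funX.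
  by move=> w; rewrite normrX lerXn2r ?nnegrE// ltW.
have [itp ep] := iRV_Ex_prod iZ (fun i _ => itZ i).
have eS w : \prod_(i < n) (e \o Y i) w = expR ((\sum_(i < n) Y i w) / B).
  by rewrite mulr_suml expR_sum.
have -> : [set w | u <= \sum_(i < n) Y i w] = [set w | expR (u / B) <= \prod_(i < n) (e \o Y i) w].
  by apply/seteqP; split => w /=; rewrite eS ler_expR ler_pM2r// invr_gt0.
apply: (le_trans (markov_ge (expR_gt0 _) itp _)).
  by move=> w; rewrite eS expR_ge0.
rewrite lee_fin expRD expRN mulrC ler_pM2l ?invr_gt0 ?expR_gt0// ep expR_sum.
apply: ler_prod => i _; apply/andP; split.
  by apply: Ex_ge0 => w; exact: expR_ge0.
have i1 : itg P (fun w => B^-1 * Y i w) by exact: itgZ.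
have i2 : itg P (fun w => B ^- 2 * Y i w ^+ 2) by exact: itgZ.
apply: (@le_trans _ _ (Ex P (fun w => (1 + B^-1 * Y i w) + B ^- 2 * Y i w ^+ 2))).
  apply: Ex_le => //; first by apply: itgD => //; apply: itgD => //; exact: itg_cst.
  move=> w; rewrite /e /=; have /expR_quadratic : `|Y i w / B| <= 1.
    by rewrite normrM normfV (gtr0_norm B0) ler_pdivrMr// mul1r.
  by rewrite exprMn exprVn [_ / B]mulrC [X in _ + _ + X]mulrC.
rewrite (ExD (itgD (itg_cst P 1) i1) i2) (ExD (itg_cst P 1) i1) Ex_cst !ExZ//.
apply: le_trans (expR_ge1Dx _); rewrite -addrA lerD2l lerD// mulrC //.
by rewrite ler_pM2r ?invr_gt0// ler_norm.
Qed.

(** Truncation at level [B]: the truncated part has variance at most [B] times the sum of the means,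
    while the part above [B] is paid for in mean, once for itself and once for its centring. *)
Lemma lln_bound n (W : nat -> T -> R) (B c : R) : 0 <= B -> 0 < c -> iRV P n W ->
  (forall i w, 0 <= W i w) -> (forall i, (i < n)%N -> itg P (W i)) ->
  itg P (fun w => `|\sum_(i < n) (W i w - Ex P (W i))|) /\
  Ex P (fun w => `|\sum_(i < n) (W i w - Ex P (W i))|) <=
  c + B / c * (\sum_(i < n) Ex P (W i)) + 2 * \sum_(i < n) Ex P (fun w => W i w * (B < W i w)%R%:R).
Proof.
move=> B0 c0 iW W0 itW; have mW i : measurable_fun setT (W i) by case: iW.
have mi (b : R -> bool) : measurable_fun setT b -> measurable_fun setT (fun x : R => x * (b x)%:R).
  move=> mb; apply: measurable_funM => //.
  exact: (measurableT_comp (f := fun x : bool => x%:R : R)).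
pose f1 (x : R) := x * (x <= B)%R%:R; pose f2 (x : R) := x * (B < x)%R%:R.
have m1 : measurable_fun setT f1 by apply: mi; exact: measurable_fun_ler.
have m2 : measurable_fun setT f2 by apply: mi; exact: measurable_fun_ltr.
have f12 x : x = f1 x + f2 x.
  by rewrite /f1 /f2; case: leP => _; rewrite ?mulr1 ?mulr0 ?addr0 ?add0r.
have f1b x : 0 <= x -> 0 <= f1 x <= B.
  by rewrite /f1 => x0; have [xB|xB] := leP x B; rewrite /= ?mulr1 ?mulr0 ?x0 ?xB ?lexx ?B0.
have f1x x : 0 <= x -> f1 x <= x.
  by rewrite /f1 => x0; have [xB|xB] := leP x B; rewrite /= ?mulr1 ?mulr0.
have f2b x : 0 <= x -> 0 <= f2 x <= x.
  by rewrite /f2 => x0; have [xB|xB] := leP x B; rewrite /= ?mulr1 ?mulr0 ?x0 ?lexx.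
have it1 i : itg P (fun w => f1 (W i w)).
  apply: (@itg_bounded _ _ _ _ B); first exact: (measurableT_comp m1 (mW i)).
  by move=> w; have /andP[? ?] := f1b _ (W0 i w); rewrite ger0_norm.
have it2 i : (i < n)%N -> itg P (fun w => f2 (W i w)).
  move=> ni; apply: (itg_le _ _ (itW i ni)); first exact: (measurableT_comp m2 (mW i)).
  by move=> w; have /andP[? ?] := f2b _ (W0 i w); rewrite ger0_norm.
pose g i (x : R) := f1 x - Ex P (fun w => f1 (W i w)).
have mg i : measurable_fun setT (g i) by exact: measurable_funB.
have iG := iRV_comp mg iW.
have itG i : itg P (g i \o W i) by apply: itgB => //; exact: itg_cst.
have itG2 i : itg P (fun w => (g i \o W i) w ^+ 2).
  apply: (@itg_bounded _ _ _ _ (B ^+ 2)).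
    by apply: measurable_funX; exact: (measurableT_comp (mg i) (mW i)).
  move=> w; rewrite normrX lerXn2r ?nnegrE//= /g.
  have /andP[? ?] := f1b _ (W0 i w).
  have : 0 <= Ex P (fun w => f1 (W i w)) <= B.
    apply/andP; split; first by apply: Ex_ge0 => v; have /andP[] := f1b _ (W0 i v).
    rewrite -(Ex_cst P B); apply: Ex_le => //; first exact: itg_cst.
    by move=> v; have /andP[] := f1b _ (W0 i v).
  by move=> /andP[? ?]; rewrite ler_norml; apply/andP; split; lra.
have EG i : Ex P (g i \o W i) = 0.
  by rewrite [LHS](ExB (it1 i) (itg_cst P _)) Ex_cst subrr.
have EG2 i : (i < n)%N -> Ex P (fun w => (g i \o W i) w ^+ 2) <= B * Ex P (W i).
  move=> ni; set k := Ex P (fun w => f1 (W i w)).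
  have it12 : itg P (fun w => f1 (W i w) ^+ 2).
    apply: (@itg_bounded _ _ _ _ (B ^+ 2)).
      by apply: measurable_funX; exact: (measurableT_comp m1 (mW i)).
    by move=> w; have /andP[? ?] := f1b _ (W0 i w); rewrite normrX lerXn2r ?nnegrE// ger0_norm.
  have -> : (fun w => (g i \o W i) w ^+ 2) = (fun w => f1 (W i w) ^+ 2 - (2 * k * f1 (W i w) - k ^+ 2)).
    by apply/funext => w; rewrite /g /= -/k; ring.
  have i3 := itgB (itgZ (2 * k) (it1 i)) (itg_cst P (k ^+ 2)).
  rewrite (ExB it12 i3) (ExB (itgZ (2 * k) (it1 i)) (itg_cst P (k ^+ 2))) ExZ// Ex_cst -/k.
  have : Ex P (fun w => f1 (W i w) ^+ 2) <= B * Ex P (W i).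
    rewrite -ExZ; last exact: itW.
    apply: Ex_le => //; first by apply: itgZ; exact: itW.
    move=> w; have /andP[? ?] := f1b _ (W0 i w); have ? := f1x _ (W0 i w).
    by rewrite expr2 ler_pM.
  have := sqr_ge0 k; rewrite expr2; lra.
pose S1 w := \sum_(i < n) (g i \o W i) w.
pose S2 w := \sum_(i < n) f2 (W i w).
have [itS2 ES2] := iRV_Ex_sum2 iG (fun i _ => itG2 i) (fun i _ => EG i).
have itS : itg P (fun w => \sum_(i < n) (W i w - Ex P (W i))).
  by apply: (@itg_sum _ _ _ P n (fun i w => W i w - Ex P (W i))) => i ni; apply: itgB; [exact: itW|exact: itg_cst].
have itSf2 : itg P S2 by apply: (@itg_sum _ _ _ P n (fun i w => f2 (W i w))).
have ESf2 : Ex P S2 = \sum_(i < n) Ex P (fun w => f2 (W i w)).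
  exact: (@Ex_sum _ _ _ P n (fun i w => f2 (W i w))).
have S2_0 w : 0 <= S2 w.
  by apply: sumr_ge0 => i _; have /andP[] := f2b _ (W0 i w).
have EW i : (i < n)%N -> Ex P (W i) = Ex P (fun w => f1 (W i w)) + Ex P (fun w => f2 (W i w)).
  move=> ni; rewrite -(ExD (it1 i) (it2 i ni)); congr Ex; apply/funext => w; exact: f12.
have dec w : \sum_(i < n) (W i w - Ex P (W i)) = S1 w + (S2 w - Ex P S2).
  rewrite ESf2 /S1 /S2 -sumrB -big_split /=; apply: eq_bigr => i _.
  by rewrite (EW i (ltn_ord i)) /g /= [W i w in LHS]f12; ring.
split; first exact: itg_abs.
have itR : itg P (fun w => (c + c^-1 * S1 w ^+ 2) + (S2 w + Ex P S2)).
  apply: itgD; first by apply: itgD; [exact: itg_cst|exact: itgZ].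
  by apply: itgD => //; exact: itg_cst.
apply: (@le_trans _ _ (Ex P (fun w => (c + c^-1 * S1 w ^+ 2) + (S2 w + Ex P S2)))).
  apply: Ex_le => //; first exact: itg_abs.
  move=> w; rewrite dec; apply: (le_trans (ler_normD _ _)); apply: lerD.
    (* The elementary inequality [|S| <= c + S ^ 2 / c] passes from the second moment to the first;
       the free constant [c] is balanced later. *)
    rewrite -[S1 w ^+ 2](real_normK (num_real (S1 w))).
    move: `|S1 w| (normr_ge0 (S1 w)) => a a0.
    rewrite -(ler_pM2l c0) mulrDr mulrA divff ?gt_eqF// mul1r.
    by have := sqr_ge0 (a - c); rewrite !expr2; nra.
  have ? : 0 <= Ex P S2 by exact: Ex_ge0.
  by apply: (le_trans (ler_normB _ _)); rewrite !ger0_norm.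
rewrite (ExD (itgD (itg_cst P c) (itgZ c^-1 itS2)) (itgD itSf2 (itg_cst P (Ex P S2)))).
rewrite (ExD (itg_cst P c) (itgZ c^-1 itS2)) (ExZ _ itS2) (ExD itSf2 (itg_cst P (Ex P S2))) !Ex_cst ES2.
rewrite ESf2 [X in _ <= X + _](_ : _ = c + c^-1 * (B * \sum_(i < n) Ex P (W i))); last by ring.
apply: lerD; last by lra.
rewrite lerD2l ler_pM2l ?invr_gt0// mulr_sumr; apply: ler_sum => i _; exact: EG2.
Qed.

End Concentration.

(** * Truncation inequalities for products of squares *)

Section PowerBounds.
Context {R : realType}.
Implicit Types a b K q : R.

Lemma pow4_le_powR a K q : 0 < K -> 4 <= q -> K <= a -> a ^+ 4 <= K `^ (4 - q) * a `^ q.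
Proof.
move=> K0 q4 Ka; have a0 : 0 < a by apply: lt_le_trans Ka.
have -> : a `^ q = a ^+ 4 * a `^ (q - 4).
  rewrite -powR_mulrn ?(ltW a0)// -powRD; first by rewrite subrKC.
  by apply/implyP => _; rewrite gt_eqF.
rewrite mulrCA ler_peMr ?exprn_ge0 ?(ltW a0)//.
have -> : K `^ (4 - q) = (K `^ (q - 4))^-1 by rewrite -powRN opprB.
rewrite mulrC ler_pdivlMr ?powR_gt0// mul1r ge0_ler_powR ?nnegrE ?subr_ge0// ltW//.
Qed.

(** If [a] exceeds [K], so does the larger of the two factors; its fourth power dominates the
    product and is itself dominated by the power [q]. Only the second moment of [b] meets the factor
    [K ^ 2], which is useful when [b] is small in mean square. *)
Lemma mul_sq_le a b K q : 0 <= a -> 0 <= b -> 0 < K -> 4 <= q ->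
  a ^+ 2 * b ^+ 2 <= K ^+ 2 * b ^+ 2 + K `^ (4 - q) * (a `^ q + b `^ q).
Proof.
move=> a0 b0 K0 q4; have Kq : 0 <= K `^ (4 - q) by exact: powR_ge0.
have [aK|Ka] := leP a K.
  apply: (@le_trans _ _ (K ^+ 2 * b ^+ 2)).
    by rewrite ler_wpM2r ?sqr_ge0// lerXn2r ?nnegrE// ltW.
  by rewrite lerDl mulr_ge0// addr_ge0// powR_ge0.
apply: (@le_trans _ _ (K `^ (4 - q) * (a `^ q + b `^ q))); last first.
  by rewrite lerDr mulr_ge0// sqr_ge0.
have [ba|ab] := leP b a.
  apply: (@le_trans _ _ (a ^+ 4)).
    by rewrite (exprD _ 2 2) ler_wpM2l ?sqr_ge0// lerXn2r ?nnegrE.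
  apply: (le_trans (pow4_le_powR K0 q4 (ltW Ka))).
  by rewrite ler_wpM2l// lerDl powR_ge0.
apply: (@le_trans _ _ (b ^+ 4)).
  by rewrite (exprD _ 2 2) ler_wpM2r ?sqr_ge0// lerXn2r ?nnegrE// ltW.
apply: (le_trans (pow4_le_powR K0 q4 (ltW (lt_trans Ka ab)))).
by rewrite ler_wpM2l// lerDr powR_ge0.
Qed.

(** A product of squares above [K ^ 4] forces the larger factor above [K], where its fourth power is
    controlled by its power [q]. The statement is symmetric, so [b <= a] may be assumed. *)
Lemma mul_sq_tail a b K q : 0 <= a -> 0 <= b -> 0 < K -> 4 <= q ->
  a ^+ 2 * b ^+ 2 * (K ^+ 4 < a ^+ 2 * b ^+ 2)%R%:R <= K `^ (4 - q) * (a `^ q + b `^ q).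
Proof.
move=> a0 b0 K0 q4; have Kq : 0 <= K `^ (4 - q) by exact: powR_ge0.
have r0 : 0 <= K `^ (4 - q) * (a `^ q + b `^ q) by rewrite mulr_ge0// addr_ge0// powR_ge0.
case: ltP => [|_]; last by rewrite mulr0.
rewrite mulr1 => h; wlog ba : a b a0 b0 r0 h / b <= a.
  move=> wl; have [ba|/ltW ab] := leP b a; first exact: wl.
  have := wl b a b0 a0; rewrite [b ^+ 2 * _]mulrC [b `^ q + _]addrC.
  exact.
have ab4 : a ^+ 2 * b ^+ 2 <= a ^+ 4.
  by rewrite (exprD _ 2 2) ler_wpM2l ?sqr_ge0// lerXn2r ?nnegrE.
have Ka : K <= a.
  by rewrite -(@ler_pXn2r _ 4) ?nnegrE// ?(ltW K0)// (le_trans (ltW h)).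
apply: (le_trans ab4); apply: (le_trans (pow4_le_powR K0 q4 Ka)).
by rewrite ler_wpM2l// lerDl powR_ge0.
Qed.

End PowerBounds.

(** * Least squares after double selection *)

Section LeastSquares.
Context {R : realType}.

Lemma cauchy_schwarz_sum n (u v : 'I_n -> R) :
  (\sum_(i < n) u i * v i) ^+ 2 <= (\sum_(i < n) u i ^+ 2) * (\sum_(i < n) v i ^+ 2).
Proof.
set A := \sum_(i < n) u i ^+ 2; set B := \sum_(i < n) u i * v i; set C := \sum_(i < n) v i ^+ 2.
have A0 : 0 <= A by apply: sumr_ge0 => i _; exact: sqr_ge0.
have C0 : 0 <= C by apply: sumr_ge0 => i _; exact: sqr_ge0.
have h a b : 0 <= a ^+ 2 * A - 2 * a * b * B + b ^+ 2 * C.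
  have -> : a ^+ 2 * A - 2 * a * b * B + b ^+ 2 * C = \sum_(i < n) (a * u i - b * v i) ^+ 2.
    rewrite !mulr_sumr -sumrB -big_split /=; apply: eq_bigr => i _; ring.
  by apply: sumr_ge0 => i _; exact: sqr_ge0.
have [C_eq0|Cn0] := eqVneq C 0.
  (* For [C = 0] the choice [a = B], [b = A + 1] already gives [B ^ 2 (A + 2) <= 0], hence
     [B = 0]. *)
  have := h 1 (A * B + B); rewrite C_eq0; have := h B (A + 1); rewrite C_eq0.
  by rewrite !mulr0 !addr0 => h1 h2; nra.
have Cp : 0 < C by rewrite lt_def Cn0.
have := h C B.
have -> : C ^+ 2 * A - 2 * C * B * B + B ^+ 2 * C = C * (A * C - B ^+ 2) by ring.
by rewrite pmulr_rge0// subr_ge0.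
Qed.

Section Inner.
Context {n : nat}.
Implicit Types (f g h : 'I_n -> R) (a b : R).

Definition ip f g : R := avg (fun i => f i * g i).
Definition nrm f : R := Num.sqrt (avg (fun i => f i ^+ 2)).

Lemma avg_ge0 f : (forall i, 0 <= f i) -> 0 <= avg f.
Proof. by move=> h; rewrite /avg mulr_ge0 ?invr_ge0// sumr_ge0. Qed.

Lemma avgD f g : avg (fun i => f i + g i) = avg f + avg g.
Proof. by rewrite /avg big_split mulrDr. Qed.

Lemma avgZ a f : avg (fun i => a * f i) = a * avg f.
Proof. by rewrite /avg -mulr_sumr mulrCA. Qed.

Lemma avg_le f g : (forall i, f i <= g i) -> avg f <= avg g.
Proof. by move=> h; rewrite /avg ler_wpM2l ?invr_ge0// ler_sum. Qed.

Lemma ipC f g : ip f g = ip g f.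
Proof. by rewrite /ip; congr avg; apply/funext => i; rewrite mulrC. Qed.

Lemma ipDr f g h : ip f (fun i => g i + h i) = ip f g + ip f h.
Proof. by rewrite /ip -avgD; congr avg; apply/funext => i; rewrite mulrDr. Qed.

Lemma ipZr a f g : ip f (fun i => a * g i) = a * ip f g.
Proof. by rewrite /ip -avgZ; congr avg; apply/funext => i; rewrite mulrCA. Qed.

Lemma ipBr f g h : ip f (fun i => g i - h i) = ip f g - ip f h.
Proof.
rewrite -[- ip f h]mulN1r -ipZr -ipDr; congr ip.
by apply/funext => i; rewrite mulN1r.
Qed.

Lemma ipDl f g h : ip (fun i => g i + h i) f = ip g f + ip h f.
Proof. by rewrite !(ipC _ f) ipDr. Qed.

Lemma ipBl f g h : ip (fun i => g i - h i) f = ip g f - ip h f.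
Proof. by rewrite !(ipC _ f) ipBr. Qed.

Lemma ipff f : ip f f = avg (fun i => f i ^+ 2).
Proof. by []. Qed.

Lemma nrm_ge0 f : 0 <= nrm f. Proof. exact: sqrtr_ge0. Qed.

Lemma nrm_sq f : nrm f ^+ 2 = ip f f.
Proof. by rewrite /nrm sqr_sqrtr// avg_ge0// => i; exact: sqr_ge0. Qed.

Lemma nrm_le f a : 0 <= a -> ip f f <= a ^+ 2 -> nrm f <= a.
Proof. by move=> a0 h; rewrite -(@ler_pXn2r _ 2) ?nnegrE ?nrm_ge0// nrm_sq. Qed.

Lemma ip_le f g : `|ip f g| <= nrm f * nrm g.
Proof.
rewrite -(@ler_pXn2r _ 2) ?nnegrE ?mulr_ge0 ?nrm_ge0// exprMn !nrm_sq real_normK ?num_real//.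
rewrite /ip /avg exprMn; have := cauchy_schwarz_sum f g.
move: (n%:R)^-1 (\sum_(i < n) _) (\sum_(i < n) f i ^+ 2) (\sum_(i < n) g i ^+ 2) => k B A C h.
rewrite [leRHS](_ : _ = k ^+ 2 * (A * C)); last by ring.
by rewrite ler_wpM2l ?sqr_ge0.
Qed.

Lemma nrmD f g : nrm (fun i => f i + g i) <= nrm f + nrm g.
Proof.
apply: nrm_le; first by rewrite addr_ge0 ?nrm_ge0.
rewrite ipDr !ipDl sqrrD -!nrm_sq (ipC g f).
have := ip_le f g; have := ler_norm (ip f g); lra.
Qed.

Lemma nrmZ a f : nrm (fun i => a * f i) = `|a| * nrm f.
Proof.
rewrite /nrm -sqrtr_sqr -sqrtrM ?sqr_ge0// -avgZ; congr (Num.sqrt (avg _)).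
by apply/funext => i; rewrite exprMn.
Qed.

Lemma nrmN f : nrm (fun i => - f i) = nrm f.
Proof. by rewrite /nrm; congr (Num.sqrt (avg _)); apply/funext => i; rewrite sqrrN. Qed.

Lemma nrmB f g : nrm (fun i => f i - g i) <= nrm f + nrm g.
Proof. by rewrite -(nrmN g); exact: nrmD. Qed.

Lemma nrm_dist f g : `|nrm f - nrm g| <= nrm (fun i => f i - g i).
Proof.
have h f' g' : nrm f' <= nrm (fun i => f' i - g' i) + nrm g'.
  have {1}-> : f' = (fun i => (f' i - g' i) + g' i) by apply/funext => i; rewrite subrK.
  exact: nrmD.
rewrite ler_norml; apply/andP; split; last by rewrite lerBlDr h.
rewrite lerNl opprB lerBlDr -(nrmN (fun i => f i - g i)).
by rewrite (_ : (fun i => _) = (fun i => g i - f i)) ?h//; apply/funext => i; rewrite opprB.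
Qed.

Lemma nrm_mul_sup f g a : 0 <= a -> (forall i, `|f i| <= a) ->
  nrm (fun i => f i * g i) <= a * nrm g.
Proof.
move=> a0 h; apply: nrm_le; first by rewrite mulr_ge0// nrm_ge0.
rewrite exprMn nrm_sq !ipff -avgZ; apply: avg_le => i.
by rewrite exprMn ler_wpM2r ?sqr_ge0// -(real_normK (num_real (f i))) lerXn2r ?nnegrE.
Qed.

Lemma minimizer_orth f h : (forall t : R, ip f f <= ip (fun i => f i - t * h i) (fun i => f i - t * h i)) ->
  ip f h = 0.
Proof.
move=> H; set B := ip f h; set A := ip h h.
have A0 : 0 <= A by rewrite /A -nrm_sq sqr_ge0.
(* The optimal step would be [B / A]; the denominator [A + 1] avoids the case [A = 0] and still
   decreases the norm unless [B = 0]. *)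
have := H (B / (A + 1)); set t := B / (A + 1).
have e1 k : ip (fun i => t * h i) k = t * ip h k by rewrite ipC ipZr ipC.
rewrite ipBl !ipBr !e1 !ipZr (ipC h f) -/A -/B => h1.
have Bt : B = t * (A + 1) by rewrite /t divfK// gt_eqF// ltr_wpDl.
have : t = 0 by move: h1; rewrite Bt; nra.
by rewrite Bt => ->; rewrite mul0r.
Qed.

End Inner.

(** * Sparse vectors under a restricted eigenvalue bound *)

Section Sparse.
Context {n p : nat}.
Variable x : 'I_n -> 'I_p -> R.
Implicit Types (b dl : 'I_p -> R) (f g : 'I_n -> R).

Definition Xb b (i : 'I_n) : R := xdot (x i) b.

Lemma XbD b b' i : Xb (fun j => b j + b' j) i = Xb b i + Xb b' i.
Proof. by rewrite /Xb /xdot -big_split; apply: eq_bigr => j _; rewrite mulrDr. Qed.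

Lemma XbZ (a : R) b i : Xb (fun j => a * b j) i = a * Xb b i.
Proof. by rewrite /Xb /xdot mulr_sumr; apply: eq_bigr => j _; rewrite mulrCA. Qed.

Lemma XbB b b' i : Xb (fun j => b j - b' j) i = Xb b i - Xb b' i.
Proof. by rewrite /Xb /xdot -sumrB; apply: eq_bigr => j _; rewrite mulrBr. Qed.

Lemma l0E b : l0 b = #|[pred j | b j != 0]|.
Proof. by rewrite /l0; apply: eq_card => j; rewrite !inE; apply/idP/idP; rewrite inE. Qed.

Lemma l0_supported (I : {set 'I_p}) b : supported I b -> (l0 b <= #|I|)%N.
Proof.
move=> h; rewrite l0E; apply: subset_leq_card; apply/fintype.subsetP => j; rewrite inE => bj.
by apply: contraNT bj => jI; rewrite h.
Qed.

Lemma l0_sub (I : {set 'I_p}) b b' : supported I b' -> (l0 (fun j => b j - b' j)%R <= l0 b + #|I|)%N.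
Proof.
move=> h; rewrite !l0E.
apply: (@leq_trans #|[predU [pred j | b j != 0] & I]|).
  apply: subset_leq_card; apply/fintype.subsetP => j; rewrite !inE => bj.
  case: (boolP (j \in I)) => [|jI]; first by rewrite orbT.
  by rewrite orbF; move: bj; rewrite h// subr0.
by rewrite -(leq_add2r #|[predI [pred j | b j != 0] & I]|) cardUI leq_addr.
Qed.

Lemma supportedB (I : {set 'I_p}) b b' : supported I b -> supported I b' ->
  supported I (fun j => b j - b' j).
Proof. by move=> h h' j jI; rewrite h// h'// subrr. Qed.

Lemma l1_le_l2 b : (\sum_(j < p) `|b j|) ^+ 2 <= (l0 b)%:R * \sum_(j < p) b j ^+ 2.
Proof.
have -> : \sum_(j < p) `|b j| = \sum_(j < p) (b j != 0)%:R * `|b j|.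
  by apply: eq_bigr => j _; case: eqP => [->|_]; rewrite ?normr0 ?mulr0 ?mul1r.
apply: (le_trans (cauchy_schwarz_sum _ _)).
have -> : \sum_(j < p) ((b j != 0)%:R : R) ^+ 2 = (l0 b)%:R.
  rewrite l0E -sum1_card natr_sum [RHS]big_mkcond /=; apply: eq_bigr => j _.
  by rewrite inE; case: (b j != 0); rewrite ?expr1n ?expr0n.
rewrite ler_wpM2l//; apply: ler_sum => j _.
by rewrite real_normK ?num_real.
Qed.

Variables (k kap : R).
Hypothesis kap0 : 0 < kap.
Hypothesis k0 : 0 <= k.
Hypothesis RE : forall dl, (l0 dl)%:R <= k -> kap * (\sum_(j < p) dl j ^+ 2) <= ip (Xb dl) (Xb dl).

Lemma sparse_l1 b : (l0 b)%:R <= k -> \sum_(j < p) `|b j| <= Num.sqrt (k / kap) * nrm (Xb b).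
Proof.
move=> lb; rewrite -(@ler_pXn2r _ 2) ?nnegrE ?mulr_ge0 ?sqrtr_ge0//; last by apply: sumr_ge0.
apply: (le_trans (l1_le_l2 b)); rewrite exprMn nrm_sq sqr_sqrtr ?divr_ge0 ?(ltW kap0)//.
have s0 : 0 <= \sum_(j < p) b j ^+ 2 by apply: sumr_ge0 => j _; exact: sqr_ge0.
apply: (@le_trans _ _ (k * \sum_(j < p) b j ^+ 2)); first by rewrite ler_wpM2r.
by rewrite -mulrA ler_wpM2l// ler_pdivlMl// RE.
Qed.

(** Duality between the maximum and the l1 norm, followed by [sparse_l1]: on sparse vectors the l1
    norm costs a factor [sqrt (k / kap)] over the empirical norm of the fit. This turns a bound over
    single regressors into one over all sparse combinations. *)
Lemma sparse_ip f lam b : 0 <= lam -> (forall j, `|ip (fun i => x i j) f| <= lam) -> (l0 b)%:R <= k ->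
  `|ip f (Xb b)| <= lam * Num.sqrt (k / kap) * nrm (Xb b).
Proof.
move=> lam0 hl lb; rewrite -mulrA; apply: le_trans (ler_wpM2l lam0 (sparse_l1 lb)).
have -> : ip f (Xb b) = \sum_(j < p) b j * ip (fun i => x i j) f.
  rewrite /ip /avg /Xb /xdot.
  under eq_bigr do rewrite mulr_sumr.
  rewrite exchange_big /= mulr_sumr; apply: eq_bigr => j _.
  rewrite mulrCA; congr (_ * _); rewrite mulr_sumr; apply: eq_bigr => i _; ring.
apply: (le_trans (ler_norm_sum _ _ _)); rewrite mulr_sumr; apply: ler_sum => j _.
by rewrite normrM mulrC ler_wpM2r.
Qed.

Lemma sparse_sup M b i : 0 <= M -> (forall j, `|x i j| <= M) -> (l0 b)%:R <= k ->
  `|Xb b i| <= M * Num.sqrt (k / kap) * nrm (Xb b).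
Proof.
move=> M0 hM lb; rewrite -mulrA; apply: le_trans (ler_wpM2l M0 (sparse_l1 lb)).
apply: (le_trans (ler_norm_sum _ _ _)); rewrite mulr_sumr; apply: ler_sum => j _.
by rewrite normrM ler_wpM2r.
Qed.

End Sparse.

(** * Deterministic error bounds for the two least squares fits, in units of [tau] *)

Section DoubleSelection.
Context {n p : nat}.
Variables (x : 'I_n -> 'I_p -> R) (I : {set 'I_p}).
Variables (y d ze v g m rm rg : 'I_n -> R) (bm0 bg0 bm bg bc bh : 'I_p -> R) (a0 ac k tau : R).
Hypothesis dE : forall i, d i = m i + v i.
Hypothesis yE : forall i, y i = d i * a0 + g i + ze i.
Hypothesis mE : forall i, m i = Xb x bm0 i + rm i.
Hypothesis gE : forall i, g i = Xb x bg0 i + rg i.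
Hypothesis lm : (l0 bm0)%:R + #|I|%:R <= k.
Hypothesis lg : (l0 bg0)%:R + #|I|%:R <= k.
Hypothesis tau0 : 0 <= tau.
Hypothesis hv : forall b, (l0 b)%:R <= k -> `|ip v (Xb x b)| <= tau * nrm (Xb x b).
Hypothesis hz : forall b, (l0 b)%:R <= k -> `|ip ze (Xb x b)| <= tau * nrm (Xb x b).
Hypothesis sm : supported I bm.
Hypothesis sg : supported I bg.
Hypothesis tm : nrm (fun i => m i - Xb x bm i) <= tau.
Hypothesis tg : nrm (fun i => g i - Xb x bg i) <= tau.
Hypothesis trm : nrm rm <= tau.
Hypothesis trg : nrm rg <= tau.
Hypothesis sh : supported I bh.
Hypothesis sc : supported I bc.
Hypothesis mh : forall b, supported I b ->
  avg (fun i => (d i - Xb x bh i) ^+ 2) <= avg (fun i => (d i - Xb x b i) ^+ 2).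
Hypothesis mc : forall a b, supported I b ->
  avg (fun i => (y i - d i * ac - Xb x bc i) ^+ 2) <= avg (fun i => (y i - d i * a - Xb x b i) ^+ 2).

Let e i := d i - Xb x bh i.

Let orth_e b : supported I b -> ip e (Xb x b) = 0.
Proof.
move=> sb; apply: minimizer_orth => t.
have := mh (b := fun j => bh j + t * b j); rewrite !ipff.
have s : supported I (fun j => bh j + t * b j) by move=> j jI; rewrite sh// sb// mulr0 addr0.
move/(_ s); congr (_ <= avg _); apply/funext => i; rewrite /e XbD XbZ; ring.
Qed.

Let eh i := y i - d i * ac - Xb x bc i.

Let orth_eh b : supported I b -> ip eh (Xb x b) = 0.
Proof.
move=> sb; apply: minimizer_orth => t.
have := mc ac (b := fun j => bc j + t * b j); rewrite !ipff.
have s : supported I (fun j => bc j + t * b j) by move=> j jI; rewrite sc// sb// mulr0 addr0.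
move/(_ s); congr (_ <= avg _); apply/funext => i; rewrite /eh XbD XbZ; ring.
Qed.

Let orth_ehd : ip eh d = 0.
Proof.
apply: minimizer_orth => t.
have := mc (ac + t) sc; rewrite !ipff.
congr (_ <= avg _); apply/funext => i; rewrite /eh; ring.
Qed.

Let sparse_of_supp (b : 'I_p -> R) : supported I b -> (l0 b)%:R <= k.
Proof.
move=> sb; apply: le_trans lm; apply: (@le_trans _ _ (#|I|%:R)); last by rewrite lerDr.
by rewrite ler_nat l0_supported.
Qed.

Let self_bound (h C : R) : 0 <= h -> 0 <= C -> h ^+ 2 <= C * h -> h <= C.
Proof.
move=> h0 C0 hh; have [->//|hn] := eqVneq h 0.
have hp : 0 < h by rewrite lt_def hn.
by rewrite -(ler_pM2r hp) -expr2.
Qed.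

Let u i := e i - v i.

Lemma pds_residual : nrm (fun i => (d i - Xb x bh i) - v i) <= 3 * tau.
Proof.
pose h := Xb x (fun j => bh j - bm j).
have sb := supportedB sh sm.
have hh : nrm h <= 2 * tau.
  apply: self_bound; rewrite ?nrm_ge0 ?mulr_ge0// nrm_sq.
  (* The normal equations, tested on the difference [h] between the fit and the reference
     approximation. Each of the two terms is at most [tau * nrm h], and one factor [nrm h]
     cancels. *)
  have -> : ip h h = ip v h + ip (fun i => m i - Xb x bm i) h.
    have : ip e h = 0 by apply: orth_e.
    have -> : e = (fun i => (v i + (m i - Xb x bm i)) - h i).
      by apply/funext => i; rewrite /e dE /h XbB; ring.
    by rewrite ipBl ipDl => /eqP; rewrite subr_eq0 => /eqP.
  have := hv (sparse_of_supp sb); have := ip_le (fun i => m i - Xb x bm i) h.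
  have : nrm (fun i => m i - Xb x bm i) * nrm h <= tau * nrm h by rewrite ler_wpM2r ?nrm_ge0.
  rewrite -/h; have := ler_norm (ip v h); have := ler_norm (ip (fun i => m i - Xb x bm i) h).
  by lra.
have -> : (fun i => (d i - Xb x bh i) - v i) = (fun i => (m i - Xb x bm i) - h i).
  by apply/funext => i; rewrite dE /h XbB; ring.
by apply: (le_trans (nrmB _ _)); move: tm hh; lra.
Qed.

Lemma pds_m_fit : nrm (Xb x (fun j => bm0 j - bh j)) <= 4 * tau.
Proof.
have -> : Xb x (fun j => bm0 j - bh j) = (fun i => ((d i - Xb x bh i) - v i) - rm i).
  by apply/funext => i; rewrite XbB dE mE; ring.
by apply: (le_trans (nrmB _ _)); move: trm pds_residual; lra.
Qed.

Lemma sparse_m : (@l0 R p (fun j => (bm0 j - bh j)%R))%:R <= k.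
Proof. by apply: le_trans lm; rewrite -natrD ler_nat l0_sub. Qed.

Lemma sparse_g : (@l0 R p (fun j => (bg0 j - bc j)%R))%:R <= k.
Proof. by apply: le_trans lg; rewrite -natrD ler_nat l0_sub. Qed.

(** The residual of [y] is orthogonal to [d] and to the selected regressors, hence to [e];
    conversely [e] is orthogonal to the fit with coefficients [bc], which therefore drops out. The
    constant is 9 = 4 + 2 + 3: the fit of [m] against [ze], the sparse part of [g] against [v], and
    the error of [e] against the approximation error of [g]. *)
Lemma pds_alpha : 
  `|(ac - a0) * ip (fun i => d i - Xb x bh i) (fun i => d i - Xb x bh i) - ip v ze|
  <= `|ip rm ze| + `|ip v rg| + 9 * tau ^+ 2.
Proof.
rewrite -/e.
have ed : ip e d = ip e e.
  have -> : d = (fun i => e i + Xb x bh i) by apply/funext => i; rewrite /e subrK.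
  by rewrite ipDr orth_e// addr0.
have key : (ac - a0) * ip e e = ip e g + ip e ze.
  have h1 : ip eh e = 0.
    by rewrite /e ipBr orth_ehd orth_eh// subrr.
  have : ip e eh = 0 by rewrite ipC.
  have -> : eh = (fun i => (g i + ze i - (ac - a0) * d i) - Xb x bc i).
    by apply/funext => i; rewrite /eh yE; ring.
  rewrite ipBr orth_e// subr0 ipBr ipZr ipDr ed => /eqP; rewrite subr_eq0 => /eqP ->.
  by [].
have ez : ip e ze = ip v ze + ip rm ze + ip ze (Xb x (fun j => bm0 j - bh j)).
  have -> : e = (fun i => (v i + rm i) + Xb x (fun j => bm0 j - bh j) i).
    by apply/funext => i; rewrite /e dE mE XbB; ring.
  by rewrite ipDl ipDl; congr (_ + _ + _); exact: ipC.
(* Orthogonality of [e] allows the subtraction of any selected combination from [g]; the reference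
   [bg] is taken, so no rate for the fit of [y] enters here. *)
have eg : ip e g = ip v (Xb x (fun j => bg0 j - bg j)) + ip v rg + ip u (fun i => g i - Xb x bg i).
  have -> : ip e g = ip e (fun i => g i - Xb x bg i) by rewrite ipBr orth_e// subr0.
  have {1}-> : e = (fun i => v i + u i) by apply/funext => i; rewrite /u; ring.
  rewrite ipDl; congr (_ + _).
  have {1}-> : (fun i => g i - Xb x bg i) = (fun i => Xb x (fun j => bg0 j - bg j) i + rg i).
    by apply/funext => i; rewrite gE XbB; ring.
  by rewrite ipDr.
have b1 : `|ip ze (Xb x (fun j => bm0 j - bh j))| <= tau * (4 * tau).
  apply: (le_trans (hz sparse_m)); apply: ler_wpM2l => //; exact: pds_m_fit.
have b2 : `|ip v (Xb x (fun j => bg0 j - bg j))| <= tau * (2 * tau).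
  have sgg : (@l0 R p (fun j => (bg0 j - bg j)%R))%:R <= k by apply: le_trans lg; rewrite -natrD ler_nat l0_sub.
  apply: (le_trans (hv sgg)); apply: ler_wpM2l => //.
  have -> : Xb x (fun j => bg0 j - bg j) = (fun i => (g i - Xb x bg i) - rg i).
    by apply/funext => i; rewrite XbB gE; ring.
  by apply: (le_trans (nrmB _ _)); move: tg trg; lra.
have b3 : `|ip u (fun i => g i - Xb x bg i)| <= 3 * tau * tau.
  apply: (le_trans (ip_le _ _)); apply: ler_pM; rewrite ?nrm_ge0//; exact: pds_residual.
have -> : (ac - a0) * ip e e - ip v ze = (ip rm ze + ip v rg) + (ip ze (Xb x (fun j => bm0 j - bh j))
   + (ip v (Xb x (fun j => bg0 j - bg j)) + ip u (fun i => g i - Xb x bg i))).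
  by rewrite key eg ez; ring.
apply: (le_trans (ler_normD _ _)); apply: lerD; first exact: ler_normD.
apply: (le_trans (ler_normD _ _)).
have := ler_normD (ip v (Xb x (fun j => bg0 j - bg j))) (ip u (fun i => g i - Xb x bg i)).
by move: b1 b2 b3; rewrite expr2; lra.
Qed.

(** The regression of [y] fits [g] only up to the error made on the coefficient of [d]. There is no
    circularity: [pds_alpha] does not rely on this bound, so the rate of [ac] can be inserted
    afterwards. *)
Lemma pds_g_fit : nrm (Xb x (fun j => bg0 j - bc j)) <= 4 * tau + `|ac - a0| * nrm d.
Proof.
pose h := Xb x (fun j => bc j - bg j).
have sb := supportedB sc sg.
have C0 : 0 <= `|ac - a0| * nrm d by rewrite mulr_ge0 ?nrm_ge0.
have hh : nrm h <= 2 * tau + `|ac - a0| * nrm d.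
  apply: self_bound; rewrite ?nrm_ge0 ?addr_ge0 ?mulr_ge0// ?nrm_ge0// nrm_sq.
  have -> : ip h h = ip (fun i => g i - Xb x bg i) h + ip ze h - (ac - a0) * ip d h.
    have : ip eh h = 0 by apply: orth_eh.
    have -> : eh = (fun i => (((g i - Xb x bg i) + ze i) - (ac - a0) * d i) - h i).
      by apply/funext => i; rewrite /eh yE /h XbB; ring.
    rewrite ipBl ipBl ipDl (ipC (fun i => (ac - a0) * d i)) ipZr (ipC h d).
    by move=> /eqP; rewrite subr_eq0 => /eqP.
  have := hz (sparse_of_supp sb); rewrite -/h.
  have := ip_le (fun i => g i - Xb x bg i) h.
  have : nrm (fun i => g i - Xb x bg i) * nrm h <= tau * nrm h by rewrite ler_wpM2r ?nrm_ge0.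
  have := ler_norm (ip ze h); have := ler_norm (ip (fun i => g i - Xb x bg i) h).
  have : - ((ac - a0) * ip d h) <= `|ac - a0| * (nrm d * nrm h).
    by apply: (le_trans (ler_norm _)); rewrite normrN normrM ler_wpM2l// ip_le.
  rewrite mulrDl mulrA; lra.
have -> : Xb x (fun j => bg0 j - bc j) = (fun i => ((g i - Xb x bg i) - rg i) - h i).
  by apply/funext => i; rewrite /h !XbB gE; ring.
apply: (le_trans (nrmB _ _)); have := nrmB (fun i => g i - Xb x bg i) rg.
by move: tg trg hh; lra.
Qed.

End DoubleSelection.

End LeastSquares.

(** * Convergence in probability along an array *)

Section WithHighProbability.
Context {R : realType} (dT : nat -> measure_display) (T : forall n, measurableType (dT n)).
Variable P : forall n, probability (T n) R.

(* [X @ whp --> l] is convergence in probability of the array [X]. *)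
Definition whp : set_system {n & T n} := fun Q =>
  forall eta : R, 0 < eta -> \forall n \near \oo, exists A : set (T n),
    [/\ measurable A, (P n (~` A) <= eta%:E)%E & forall w, A w -> Q (existT _ n w)].

(** The filter structure makes sums, products and comparisons of quantities that vanish in
    probability instances of the general lemmas on limits. *)
Global Instance whp_filter : Filter whp.
Proof.
split.
- by move=> eta eta0; apply: nearW => n; exists setT; rewrite setCT measure0 lee_fin ltW.
- move=> Q1 Q2 h1 h2 eta eta0; have e2 : 0 < eta / 2 by rewrite divr_gt0.
  apply: filterS2 (h1 _ e2) (h2 _ e2) => n [A [mA PA hA]] [B [mB PB hB]].
  exists (A `&` B); split; first exact: measurableI.
    rewrite setCI; apply: (le_trans (measureU2 _ _ _)); try exact: measurableC.
    by rewrite (splitr eta) EFinD; exact: leeD.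
  by move=> w [Aw Bw]; split; [exact: hA|exact: hB].
- move=> Q1 Q2 sQ h eta eta0; apply: filterS (h _ eta0) => n [A [mA PA hA]].
  by exists A; split=> // w Aw; apply: sQ; exact: hA.
Qed.

Lemma whp_index : @projT1 _ _ @ whp --> \oo.
Proof.
move=> Q [N _ hN] eta eta0; exists N => // n Nn.
by exists setT; split=> [//||w _]; [rewrite setCT measure0 lee_fin ltW|exact: hN].
Qed.

Lemma whp_seq (u : nat -> R) (l : R) : u n @[n --> \oo] --> l -> u (projT1 x) @[x --> whp] --> l.
Proof. by move=> h; apply: (cvg_comp _ u whp_index h). Qed.

Lemma whp_near (Q : nat -> Prop) : (\forall n \near \oo, Q n) -> \forall x \near whp, Q (projT1 x).
Proof. by move=> h; exact: (whp_index h). Qed.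

(** Integrability is asked for only eventually, since the moment bounds of the conditions are
    extracted for [0 < n]. *)
Lemma whp_markov (X : forall n, T n -> R) : (forall n w, 0 <= X n w) ->
  (\forall n \near \oo, itg (P n) (X n)) -> Ex (P n) (X n) @[n --> \oo] --> (0 : R) ->
  X (projT1 x) (projT2 x) @[x --> whp] --> (0 : R).
Proof.
move=> X0 iX cX; apply/cvgrPdist_le => e e0 eta eta0.
have /cvgrPdist_le/(_ _ (mulr_gt0 e0 eta0)) he := cX.
apply: filterS2 iX he => n iXn he.
have mX := itg_meas iXn.
exists (~` [set w | e <= X n w]%R); split.
- apply: measurableC; rewrite -[Y in measurable Y]setTI.
  by apply: measurable_fun_le.
- rewrite setCK; apply: (le_trans (markov_ge e0 iXn (X0 n))).
  rewrite lee_fin ler_pdivrMr// mulrC; move: he; rewrite sub0r normrN.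
  exact: ler_normlW.
- move=> w /= /negP; rewrite -ltNge => Xe.
  by rewrite sub0r normrN ger0_norm ?X0// ltW.
Qed.

Lemma whp_squeeze (X Y : {n & T n} -> R) : (\forall x \near whp, `|X x| <= Y x) ->
  Y x @[x --> whp] --> (0 : R) -> X x @[x --> whp] --> (0 : R).
Proof.
move=> h cY; apply/cvgrPdist_le => e e0; have /cvgrPdist_le/(_ _ e0) hY := cY.
apply: filterS2 h hY => x h1; rewrite !sub0r !normrN => h2.
by apply: (le_trans h1); exact: ler_normlW.
Qed.

(* A random affine normalization of [Z] is absorbed in the random threshold [tau]. *)
Lemma whp_slutsky (S Z : forall n, T n -> R) (tau : {n & T n} -> R) (t : R) :
  (\forall n \near \oo, measurable_fun setT (S n)) -> 
  (\forall n \near \oo, measurable_fun setT (Z n)) ->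
  (forall u : R, fine (P n [set w | S n w <= u]) @[n --> \oo] --> Phi u) ->
  tau x @[x --> whp] --> t ->
  (\forall x \near whp, (Z (projT1 x) (projT2 x) <= t) = (S (projT1 x) (projT2 x) <= tau x)) ->
  fine (P n [set w | Z n w <= t]) @[n --> \oo] --> Phi t.
Proof.
move=> mS mZ hS ctau hZ; apply/cvgrPdist_le => e e0.
have e3 : 0 < e / 3 by rewrite divr_gt0.
have [r r0 hr] : exists2 r : R, 0 < r & forall u, `|u - t| <= r -> `|Phi u - Phi t| <= e / 3.
  have /cvgrPdist_le/(_ _ e3) := @Phi_continuous R t.
  move=> /nbhs_ballP[r /= r0 h]; exists (r / 2); first by rewrite divr_gt0.
  move=> u ur; rewrite distrC; apply: h; rewrite /ball /= distrC.
  by apply: (le_lt_trans ur); rewrite ltr_pdivrMr// mulr_natr mulr2n ltrDl.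
have /cvgrPdist_le/(_ _ r0) ct := ctau.
have e6 : 0 < e / 3 / 2 by rewrite divr_gt0.
have both : whp (fun x => (`|t - tau x| <= r) /\
  (Z (projT1 x) (projT2 x) <= t) = (S (projT1 x) (projT2 x) <= tau x)) by exact: (filterI ct hZ).
have ev := both _ e6.
have /cvgrPdist_le/(_ _ e6) h1 := hS (t + r).
have /cvgrPdist_le/(_ _ e6) h2 := hS (t - r).
near=> n.
have [A [mA PA hA]] : exists A : set (T n), [/\ measurable A, (P n (~` A) <= (e / 3 / 2)%:E)%E
  & forall w, A w -> (`|t - tau (existT _ n w)| <= r) /\
     (Z n w <= t) = (S n w <= tau (existT _ n w))].
  by near: n; exact: ev.
have mSn : measurable_fun setT (S n) by near: n; assumption.
have mZn : measurable_fun setT (Z n) by near: n; assumption.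
have k1 : `|Phi (t + r) - fine (P n [set w | S n w <= t + r])| <= e / 3 / 2 by near: n; assumption.
have k2 : `|Phi (t - r) - fine (P n [set w | S n w <= t - r])| <= e / 3 / 2 by near: n; assumption.
have q1 : `|Phi (t + r) - Phi t| <= e / 3 by apply: hr; rewrite addrC addKr ger0_norm// ltW.
have q2 : `|Phi (t - r) - Phi t| <= e / 3 by apply: hr; rewrite addrC addKr normrN ger0_norm// ltW.
have mle (f : T n -> R) u : measurable_fun setT f -> measurable [set w | f w <= u].
  by move=> mf; rewrite -[Y in measurable Y]setTI; apply: measurable_fun_le.
have fP B : measurable B -> P n B \is a fin_num by move=> mB; exact: fin_num_measure.
have fle B1 B2 : measurable B1 -> measurable B2 -> B1 `<=` B2 `|` ~` A ->
    fine (P n B1) <= fine (P n B2) + e / 3 / 2.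
  move=> m1 m2 sub; rewrite -lee_fin EFinD !fineK ?fP//.
  apply: (@le_trans _ _ (P n (B2 `|` ~` A))).
    by apply: le_measure; rewrite ?inE//; apply: measurableU => //; exact: measurableC.
  apply: (le_trans (measureU2 _ _ _)) => //; first exact: measurableC.
  by apply: leeD.
have up := fle [set w | Z n w <= t] [set w | S n w <= t + r] (mle _ _ mZn) (mle _ _ mSn).
have lo := fle [set w | S n w <= t - r] [set w | Z n w <= t] (mle _ _ mSn) (mle _ _ mZn).
have {}up : fine (P n [set w | Z n w <= t]) <= fine (P n [set w | S n w <= t + r]) + e / 3 / 2.
  apply: up => w /= Zw; have [Aw|] := pselect (A w); last by right.
  have [tr zz] := hA w Aw; left; move: Zw; rewrite zz => h; apply: (le_trans h).
  by move: tr; rewrite ler_norml => /andP[]; lra.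
have {}lo : fine (P n [set w | S n w <= t - r]) <= fine (P n [set w | Z n w <= t]) + e / 3 / 2.
  apply: lo => w /= Sw; have [Aw|] := pselect (A w); last by right.
  have [tr zz] := hA w Aw; left; rewrite /= zz; apply: (le_trans Sw).
  by move: tr; rewrite ler_norml => /andP[]; lra.
move: k1 k2 q1 q2 up lo; rewrite !ler_norml.
move=> /andP[a1 a2] /andP[b1 b2] /andP[c1 c2] /andP[d1 d2] up lo.
by apply/andP; split; lra.
Unshelve. all: by end_near. Qed.

End WithHighProbability.

(** * Averages of expectations over one row *)

Section Averages.
Context {dT : measure_display} {T : measurableType dT} {R : realType}.
Variable P : probability T R.
Variable n : nat.
Hypothesis n0 : (0 < n)%N.
Implicit Type f : 'I_n -> T -> R.

Definition Eavg f : R := avg (fun i => Ex P (f i)).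

Lemma Ebar_itgE f : (forall i, itg P (f i)) -> Ebar P f = (Eavg f)%:E.
Proof.
move=> h; rewrite /Ebar /Eavg /avg EFinM; congr (_ * _)%E.
by rewrite -sumEFin; apply: eq_bigr => i _; exact: Ex_E.
Qed.

Let expectation_ge0' (X : T -> R) : (forall w, 0 <= X w) -> (0 <= 'E_P[X])%E.
Proof. by move=> X0; rewrite unlock; apply: integral_ge0 => w _; rewrite lee_fin. Qed.

Lemma Ebar_ge0 f : (forall i w, 0 <= f i w) -> (0 <= Ebar P f)%E.
Proof.
move=> f0; apply: mule_ge0; first by rewrite lee_fin invr_ge0.
by apply: sume_ge0 => i _; exact: expectation_ge0'.
Qed.

(** Every summand is at most [n] times the average, so a finite bound on [Ebar] of nonnegative
    functions also yields integrability. This is how the extended-real conditions become statements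
    on [Eavg]. *)
Lemma Ebar_bound f (C : R) : (forall i, measurable_fun setT (f i)) -> (forall i w, 0 <= f i w) ->
  (Ebar P f <= C%:E)%E -> (forall i, itg P (f i)) /\ Eavg f <= C.
Proof.
move=> mf f0 h.
have np : 0 < (n%:R : R) by rewrite ltr0n.
have i_ i : itg P (f i).
  apply: (@itg_of_bound _ _ _ P (f i) (n%:R * C)) => //.
  apply: (@le_trans _ _ (\sum_(i < n) 'E_P[f i])%E).
    rewrite (bigD1 i)//= leeDl//; apply: sume_ge0 => j _; exact: expectation_ge0'.
  have -> : (\sum_(i < n) 'E_P[f i])%E = ((n%:R)%:E * Ebar P f)%E.
    by rewrite /Ebar muleA -EFinM divff ?gt_eqF// mul1e.
  by rewrite EFinM; apply: lee_wpmul2l => //; rewrite lee_fin.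
by split=> //; rewrite -lee_fin -Ebar_itgE.
Qed.

Lemma Eavg_avg f : (forall i, itg P (f i)) ->
  itg P (fun w => avg (fun i => f i w)) /\ Ex P (fun w => avg (fun i => f i w)) = Eavg f.
Proof.
move=> h; have hs : itg P (fun w => \sum_(i < n) f i w).
  rewrite /itg (_ : _ \o _ = fun w => (\sum_(i < n) (f i w)%:E)%E).
    by apply: integrable_sum => // i _; exact: h.
  by apply/funext => w /=; rewrite sumEFin.
split; first exact: itgZ.
rewrite /avg ExZ// /Eavg /avg; congr (_ * _).
apply: EFin_inj; rewrite -Ex_E// -sumEFin unlock.
transitivity (\int[P]_w (\sum_(i < n) (f i w)%:E))%E.
  by apply: eq_integral => w _; rewrite sumEFin.
rewrite integral_sum//; apply: eq_bigr => i _.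
by rewrite -Ex_E// unlock.
Qed.

Lemma Eavg_le f g : (forall i, itg P (f i)) -> (forall i, itg P (g i)) ->
  (forall i w, f i w <= g i w) -> Eavg f <= Eavg g.
Proof. by move=> hf hg h; apply: avg_le => i; apply: Ex_le. Qed.

Lemma EavgD f g : (forall i, itg P (f i)) -> (forall i, itg P (g i)) ->
  Eavg (fun i w => f i w + g i w) = Eavg f + Eavg g.
Proof.
by move=> hf hg; rewrite /Eavg -avgD; congr avg; apply/funext => i; rewrite ExD.
Qed.

Lemma EavgZ (k : R) f : (forall i, itg P (f i)) -> Eavg (fun i w => k * f i w) = k * Eavg f.
Proof. by move=> hf; rewrite /Eavg -avgZ; congr avg; apply/funext => i; rewrite ExZ. Qed.

Lemma Eavg_cst (k : R) : Eavg (fun _ _ => k) = k.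
Proof.
rewrite /Eavg /avg (eq_bigr (fun=> k)) => [|i _]; last by rewrite Ex_cst.
rewrite sumr_const card_ord -[X in _ * X]mulr_natl mulrA mulVf ?mul1r//.
by rewrite pnatr_eq0 -lt0n.
Qed.

Lemma Eavg_ge0 f : (forall i w, 0 <= f i w) -> 0 <= Eavg f.
Proof. by move=> h; apply: avg_ge0 => i; exact: Ex_ge0. Qed.

End Averages.

Section Rows.
Context {dT : measure_display} {T : measurableType dT} {R : realType}.
Variable P : probability T R.
Variable n : nat.
Implicit Type X : 'I_n -> T -> R.

(* The lemmas on independent sequences are stated for [nat]-indexed sequences. *)
Definition ext X (i : nat) : T -> R := if insub i is Some j then X j else fun=> 0.

Lemma extE X (i : 'I_n) : ext X i = X i.
Proof. by rewrite /ext valK. Qed.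

Lemma ext_sum X (F : (T -> R) -> R) : \sum_(i < n) F (ext X i) = \sum_(i < n) F (X i).
Proof. by apply: eq_bigr => i _; rewrite extE. Qed.

Lemma ext_ind (Q : (T -> R) -> Prop) X : Q (fun=> 0) -> (forall i, Q (X i)) -> forall i, Q (ext X i).
Proof. by move=> h0 h i; rewrite /ext; case: insubP. Qed.

Lemma ext_lt (Q : (T -> R) -> Prop) X : (forall i, Q (X i)) -> forall i, (i < n)%N -> Q (ext X i).
Proof. by move=> h i ni; rewrite /ext insubT. Qed.

Lemma iRV_ext (H : 'I_n -> set (set T)) X : (forall i, H i `<=` measurable) ->
  mutually_independent P (fun i => <<s H i>>) ->
  (forall i, measurable_fun (setT : set (g_sigma_algebraType (H i))) (X i)) -> iRV P n (ext X).
Proof.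
move=> Hm ind mX; have sub i : <<s H i>> `<=` measurable.
  by apply: smallest_sub => //; exact: sigma_algebra_measurable.
split.
  apply: ext_ind => // i _ B mB; rewrite setTI; apply: (sub i).
  by have := mX i measurableT B mB; rewrite setTI.
move=> B mB; have := ind (fun i => X i @^-1` B i).
have -> : (\prod_(i < n) P (ext X i @^-1` B i) = \prod_(i < n) P (X i @^-1` B i))%E.
  by apply: eq_bigr => i _; rewrite extE.
move=> <-; last by move=> i; have := mX i measurableT _ (mB i); rewrite setTI.
congr (P _); apply/seteqP; split => w h i /= => [_|ni].
  by have := h i (ltn_ord i); rewrite extE.
by have := h (Ordinal ni) Logic.I; rewrite /ext insubT.
Qed.

End Rows.

(** * Measurability of the selection events *)

Section RationalDensity.
Context {R : realType}.

(** Rounding down to a multiple of [1 / (k + 1)] sends 0 to 0, so rational approximations of a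
    vector keep its zero coordinates, hence its sparsity and its support. *)
Definition rat_approx (k : nat) (x : R) : rat := (Num.floor (x * k.+1%:R))%:~R / k.+1%:~R.

Lemma rat_approxE k x : ratr (rat_approx k x) = (Num.floor (x * k.+1%:R))%:~R / k.+1%:R :> R.
Proof. by rewrite /rat_approx fmorph_div /= !ratr_int -pmulrn. Qed.

Lemma rat_approx0 k : rat_approx k 0 = 0.
Proof. by rewrite /rat_approx mul0r floor0 mul0r. Qed.

Lemma rat_approx_cvg x : ratr (rat_approx k x) @[k --> \oo] --> x.
Proof.
apply/cvgrPdist_le => e e0.
have /cvgrPdist_le/(_ _ e0) := @cvg_harmonic R.
apply: filterS => k; rewrite sub0r normrN /harmonic /= ger0_norm ?invr_ge0// => ke.
rewrite rat_approxE; have k0 : 0 < (k.+1%:R : R) by rewrite ltr0n.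
have /andP[f1 f2] := floor_itv (x * k.+1%:R).
have -> : x - (Num.floor (x * k.+1%:R))%:~R / k.+1%:R = (x * k.+1%:R - (Num.floor (x * k.+1%:R))%:~R) / k.+1%:R.
  by field; rewrite gt_eqF// addrC.
rewrite normrM normfV (gtr0_norm k0) ger0_norm ?subr_ge0//.
apply: le_trans ke; rewrite ler_pdivrMr// mulVf ?gt_eqF//.
by move: f2; rewrite intrD; lra.
Qed.

(* Continuity along coordinatewise limits; enough to pass from rational to real vectors. *)
Definition seq_cont p (F : ('I_p -> R) -> R) : Prop :=
  forall (r : nat -> 'I_p -> R) b, (forall j, r k j @[k --> \oo] --> b j) -> F (r k) @[k --> \oo] --> F b.

Lemma cvg_sumr n (f : 'I_n -> nat -> R) (l : 'I_n -> R) : (forall i, f i k @[k --> \oo] --> l i) ->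
  \sum_(i < n) f i k @[k --> \oo] --> \sum_(i < n) l i.
Proof.
move=> h; elim: n f l h => [|n IH] f l h.
  by rewrite big_ord0; under eq_fun do rewrite big_ord0; exact: cvg_cst.
rewrite big_ord_recr /=; under eq_fun do rewrite big_ord_recr /=.
by apply: cvgD => //; apply: IH => i.
Qed.

Lemma seq_cont_quad n p (a : 'I_n -> R) (x : 'I_n -> 'I_p -> R) :
  seq_cont (fun b => avg (fun i => (a i - Xb x b i) ^+ 2)).
Proof.
move=> r b h; apply: cvgMr; apply: cvg_sumr => i.
have c : a i - Xb x (r k) i @[k --> \oo] --> a i - Xb x b i.
  apply: cvgB; first exact: cvg_cst.
  by apply: cvg_sumr => j; apply: cvgMr; exact: h.
rewrite expr2; under eq_fun do rewrite expr2.
exact: cvgM.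
Qed.

Lemma seq_cont_sumsq p : @seq_cont p (fun b => \sum_(j < p) b j ^+ 2).
Proof.
move=> r b h; apply: cvg_sumr => j.
rewrite expr2; under eq_fun do rewrite expr2.
by apply: cvgM; exact: h.
Qed.

Definition ratv p (q : {ffun 'I_p -> rat}) : 'I_p -> R := fun j => ratr (q j).

Definition approxv p (b : 'I_p -> R) (k : nat) : {ffun 'I_p -> rat} := [ffun j => rat_approx k (b j)].

Lemma approxv_cvg p (b : 'I_p -> R) j : ratv (approxv b k) j @[k --> \oo] --> b j.
Proof. by rewrite /ratv; under eq_fun do rewrite ffunE; exact: rat_approx_cvg. Qed.

Lemma approxv0 p (b : 'I_p -> R) k j : b j = 0 -> ratv (approxv b k) j = 0.
Proof. by rewrite /ratv ffunE => ->; rewrite rat_approx0 rmorph0. Qed.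

End RationalDensity.

(** * Measurable events extracted from Conditions SE and HLMS *)

Section Events.
Context {R : realType} {dT : measure_display} {T : measurableType dT}
        {dZ : measure_display} {Zt : measurableType dZ}.
Variables (P : probability T R) (n p : nat) (z : 'I_n -> T -> Zt) (Pd : Zt -> 'I_p -> R).
Hypothesis mz : forall i, measurable_fun setT (z i).
Hypothesis mPd : forall j, measurable_fun setT (fun u => Pd u j).

Lemma countable_bigcap_measurable (I : countType) (F : I -> set T) :
  (forall i, measurable (F i)) -> measurable (\bigcap_i F i).
Proof.
move=> mF; rewrite (_ : \bigcap_i F i = \bigcap_k (if unpickle k is Some i then F i else setT)).
  by apply: bigcap_measurableType => k _; case: unpickle.
apply/seteqP; split => w h k _; first by case: unpickle => // i; exact: h.
by have := h (pickle k) Logic.I; rewrite pickleK.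
Qed.

Lemma countable_bigcup_measurable (I : countType) (F : I -> set T) :
  (forall i, measurable (F i)) -> measurable (\bigcup_i F i).
Proof.
move=> mF; rewrite -[X in measurable X]setCK setC_bigcup; apply: measurableC.
by apply: countable_bigcap_measurable => i; exact: measurableC.
Qed.

Lemma measurable_x i j : measurable_fun setT (fun w => Pd (z i w) j).
Proof. exact: (measurableT_comp (mPd j) (mz i)). Qed.

Lemma measurable_Xb i (b : T -> 'I_p -> R) : (forall j, measurable_fun setT (fun w => b w j)) ->
  measurable_fun setT (fun w => xdot (Pd (z i w)) (b w)).
Proof.
move=> mb; apply: measurable_sum => j; apply: measurable_funM; first exact: measurable_x.
exact: mb.
Qed.

Lemma measurable_Xcst i (b : 'I_p -> R) :
  measurable_fun setT (fun w => Xb (fun i => Pd (z i w)) b i).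
Proof. by apply: measurable_sum => j; apply: measurable_funM => //; exact: measurable_x. Qed.

Lemma measurable_avg (f : 'I_n -> T -> R) : (forall i, measurable_fun setT (f i)) ->
  measurable_fun setT (fun w => avg (fun i => f i w)).
Proof. by move=> mf; apply: measurable_funM => //; exact: measurable_sum. Qed.

Lemma measurable_set_le (f : T -> R) (c : R) : measurable_fun setT f -> measurable [set w | f w <= c].
Proof. by move=> mf; rewrite -[X in measurable X]setTI; apply: measurable_fun_le. Qed.

Lemma measurable_set_lt (f : T -> R) (c : R) : measurable_fun setT f -> measurable [set w | f w < c].
Proof.
move=> mf; rewrite (_ : [set w | _] = ~` [set w | c <= f w]).
  by apply: measurableC; rewrite -[X in measurable X]setTI; apply: measurable_fun_le.
by apply/seteqP; split => w /=; [rewrite ltNge => /negP|move=> /negP; rewrite -ltNge].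
Qed.

Lemma measurable_maxx2 : measurable_fun setT (maxx2 Pd z : T -> R).
Proof.
have bm (I : Type) (s : seq I) (f : I -> T -> R) : (forall i, measurable_fun setT (f i)) ->
    measurable_fun setT (fun w => \big[Num.max/0]_(i <- s) f i w).
  move=> mf; elim: s => [|i s IH].
    by rewrite (_ : (fun w => _) = fun=> 0)//; apply/funext => w; rewrite big_nil.
  rewrite (_ : (fun w => _) = fun w => Num.max (f i w) (\big[Num.max/0]_(i <- s) f i w)).
    exact: measurable_maxr.
  by apply/funext => w; rewrite big_cons.
apply: (bm _) => i; apply: measurable_funX; apply: (bm _) => j.
by apply: measurableT_comp => //; exact: measurable_x.
Qed.

Lemma maxx2_ge w i j : `|Pd (z i w) j| ^+ 2 <= maxx2 Pd z w.
Proof.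
apply: (@le_trans _ _ (supnorm (Pd (z i w)) ^+ 2)).
  rewrite lerXn2r ?nnegrE//; last by rewrite /supnorm (bigD1 j)//= le_max lexx.
  by rewrite /supnorm (bigD1 j)//= le_max normr_ge0.
by rewrite /maxx2 (bigD1 i)//= le_max lexx.
Qed.

Let Q w dl := ip (Xb (fun i => Pd (z i w)) dl) (Xb (fun i => Pd (z i w)) dl).

Let gram_quad w (dl : 'I_p -> R) :
  \sum_(j < p) \sum_(k < p) dl j * avg (fun i => Pd (z i w) j * Pd (z i w) k) * dl k = Q w dl.
Proof.
rewrite /Q /ip /avg.
transitivity ((n%:R)^-1 * \sum_(j < p) \sum_(k < p) \sum_(i < n) (Pd (z i w) j * dl j) * (Pd (z i w) k * dl k)).
  rewrite mulr_sumr; apply: eq_bigr => j _; rewrite mulr_sumr; apply: eq_bigr => k _.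
  rewrite mulrCA -!mulrA; congr (_ * _); rewrite mulr_suml mulr_sumr; apply: eq_bigr => i _; ring.
congr (_ * _); rewrite (eq_bigr (fun j => \sum_(i < n) \sum_(k < p) (Pd (z i w) j * dl j) * (Pd (z i w) k * dl k))).
  rewrite exchange_big /=; apply: eq_bigr => i _.
  by rewrite /Xb /xdot mulr_suml; apply: eq_bigr => j _; rewrite mulr_sumr.
by move=> j _; rewrite exchange_big.
Qed.

Let Q_ge0 w dl : 0 <= Q w dl.
Proof. by rewrite /Q -nrm_sq sqr_ge0. Qed.

Let sumsq_gt0 (dl : 'I_p -> R) : (1 <= l0 dl)%N -> 0 < \sum_(j < p) dl j ^+ 2.
Proof.
rewrite l0E => /card_gt0P[j]; rewrite inE => dj.
rewrite (bigD1 j)//= ltr_wpDr ?sumr_ge0//; first by move=> i _; exact: sqr_ge0.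
by rewrite exprn_even_gt0.
Qed.

Let sumsq0 (dl : 'I_p -> R) : (l0 dl < 1)%N -> forall j, dl j = 0.
Proof.
rewrite ltnS leqn0 l0E => /eqP/card0_eq h j.
by have := h j; rewrite !inE => /negbFE/eqP.
Qed.

(* The event of Condition SE is an uncountable intersection; rational sparse vectors
   suffice, which makes it measurable. *)
Lemma SE_event (s kap1 kap2 ell Delta : R) : 0 < kap1 -> 1 <= ell * s -> Delta < 1 ->
  SE P z Pd s kap1 kap2 ell Delta ->
  exists A : set T, [/\ measurable A, (P A >= (1 - Delta)%:E)%E &
    forall w, A w -> forall dl : 'I_p -> R, (l0 dl)%:R <= ell * s ->
      kap1 * (\sum_(j < p) dl j ^+ 2) <= Q w dl].
Proof.
move=> kap0 es D1; rewrite /SE; set E := [set w | _] => PE; exists E; split => //.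
(* The eigenvalue bounds in one rational direction, cleared of denominators: in this form they pass
   to limits and hold trivially for the zero vector. *)
- pose G (q : {ffun 'I_p -> rat}) : set T := [set w | (l0 (@ratv R p q))%:R <= ell * s ->
    kap1 * (\sum_(j < p) ratv q j ^+ 2) <= Q w (ratv q) /\ Q w (ratv q) <= kap2 * (\sum_(j < p) ratv q j ^+ 2)].
  have mQ dl : measurable_fun setT (fun w => Q w dl).
    by apply: measurable_avg => i; apply: measurable_funM; exact: measurable_Xcst.
  have mG q : measurable (G q).
    rewrite /G; case: (boolP ((l0 (@ratv R p q))%:R <= ell * s)) => [_|h].
      rewrite (_ : [set w | _] = [set w | - Q w (ratv q) <= - (kap1 * (\sum_(j < p) ratv q j ^+ 2))] `&`
        [set w | Q w (ratv q) <= kap2 * (\sum_(j < p) ratv q j ^+ 2)]).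
        apply: measurableI; apply: measurable_set_le => //.
        by apply: measurableT_comp => //.
      apply/seteqP; split => w /=; rewrite lerN2; first exact.
      by move=> h _.
    by rewrite (_ : [set w | _] = setT)//; apply/seteqP; split.
  (* Without regressors there are no ratios, the infimum of the empty set is 0 by default, and the
     event is empty because [0 < kap1]. *)
  case: (posnP p) => [p0|pp].
    rewrite (_ : E = set0)//; apply/seteqP; split => // w [h _]; exfalso; move: h.
    rewrite /phi_min (_ : sparse_ratios _ _ = set0) ?inf0 ?leNgt ?kap0//.
    apply/seteqP; split => // r [dl [/= l1 _] _]; move: l1.
    rewrite l0E => /card_gt0P[j _]; by have := leq_trans (ltn_ord j) (eq_leq p0).
  rewrite (_ : E = \bigcap_q G q); first exact: countable_bigcap_measurable.
  apply/seteqP; split => w.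
    move=> [h1 [_ h2]] q _ /= lq.
    have [q0|q1] := ltnP (l0 (@ratv R p q)) 1.
      have z0 := sumsq0 q0.
      have -> : \sum_(j < p) (@ratv R p q) j ^+ 2 = 0.
        by apply: big1 => j _; rewrite z0 expr0n.
      have -> : Q w (ratv q) = 0.
        rewrite /Q /ip /avg big1 ?mulr0// => i _.
        by rewrite /Xb /xdot big1 ?mulr0// => j _; rewrite z0 mulr0.
      by rewrite !mulr0.
    have sp := sumsq_gt0 q1.
    have inS : sparse_ratios (ell * s) (fun j k => avg (fun i => Pd (z i w) j * Pd (z i w) k))
       (Q w (ratv q) / \sum_(j < p) (@ratv R p q) j ^+ 2).
      by exists (ratv q) => //; rewrite gram_quad.
    split.
      rewrite -ler_pdivlMr//; apply: (le_trans h1); apply: ge_inf => //.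
      exists 0 => r [dl [/= l1 _] <-]; rewrite gram_quad divr_ge0 ?Q_ge0//.
      exact: ltW (sumsq_gt0 l1).
    rewrite -ler_pdivrMr//; apply: le_trans h2; apply: ub_le_sup => //.
    (* The trace of the Gram matrix bounds all ratios by Cauchy-Schwarz, so the supremum is a
       genuine one. *)
    exists (avg (fun i => \sum_(j < p) Pd (z i w) j ^+ 2)) => r [dl [/= l1 _] <-].
    rewrite gram_quad ler_pdivrMr ?sumsq_gt0// mulrC /Q /ip -avgZ.
    by apply: avg_le => i; rewrite -expr2 mulrC; exact: cauchy_schwarz_sum.
  move=> h.
  have real dl : (l0 dl)%:R <= ell * s -> kap1 * (\sum_(j < p) dl j ^+ 2) <= Q w dl /\
      Q w dl <= kap2 * (\sum_(j < p) dl j ^+ 2).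
    move=> ldl.
    have hq k := h (approxv dl k) Logic.I.
    have {}hq k : kap1 * (\sum_(j < p) ratv (approxv dl k) j ^+ 2) <= Q w (ratv (approxv dl k)) /\
        Q w (ratv (approxv dl k)) <= kap2 * (\sum_(j < p) ratv (approxv dl k) j ^+ 2).
      apply: hq; apply: le_trans ldl; rewrite ler_nat !l0E.
      apply: subset_leq_card; apply/fintype.subsetP => j; rewrite !inE.
      by apply: contraNN => /eqP dj; rewrite approxv0.
    have c1 : \sum_(j < p) (ratv (approxv dl k) j) ^+ 2 @[k --> \oo] --> \sum_(j < p) dl j ^+ 2.
      by apply: seq_cont_sumsq => j; exact: approxv_cvg.
    have c2 : Q w (ratv (approxv dl k)) @[k --> \oo] --> Q w dl.
      have := @seq_cont_quad R n p (fun=> 0) (fun i => Pd (z i w)) (fun k => ratv (approxv dl k)) dl (@approxv_cvg R p dl).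
      have eQ b : avg (fun i => (0 - Xb (fun i => Pd (z i w)) b i) ^+ 2) = Q w b.
        by rewrite /Q ipff; congr avg; apply/funext => i; rewrite sub0r sqrrN.
      by rewrite eQ; under eq_fun do rewrite eQ.
    have c3 (a : R) : a * \sum_(j < p) (ratv (approxv dl k) j) ^+ 2 @[k --> \oo] --> a * \sum_(j < p) dl j ^+ 2.
      by apply: cvgM => //; exact: cvg_cst.
    split.
      by apply: (ler_cvg_to (c3 kap1) c2); apply: nearW => k; have [] := hq k.
    by apply: (ler_cvg_to c2 (c3 kap2)); apply: nearW => k; have [] := hq k.
  have rb r : sparse_ratios (ell * s) (fun j k => avg (fun i => Pd (z i w) j * Pd (z i w) k)) r -> kap1 <= r <= kap2.
    move=> [dl [/= l1 l2] <-]; rewrite gram_quad; have [r1 r2] := real dl l2.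
    by rewrite ler_pdivlMr ?sumsq_gt0// r1 ler_pdivrMr ?sumsq_gt0.
  have ne : sparse_ratios (ell * s) (fun j k => avg (fun i => Pd (z i w) j * Pd (z i w) k)) !=set0.
    (* A coordinate vector, admissible because [1 <= ell * s]; it keeps the infimum and the supremum
       from taking their default value. *)
    pose dl (j : 'I_p) : R := (j == Ordinal pp)%:R.
    have ldl : l0 dl = 1%N.
      rewrite l0E -(card1 (Ordinal pp)); apply: eq_card => j.
      by rewrite !inE /dl pnatr_eq0 eqb0 negbK.
    by eexists; exists dl => //=; rewrite ldl.
  split; first by apply: lb_le_inf => // r /rb/andP[].
  split; last by apply: ge_sup => // r /rb/andP[].
  have [r hr] := ne; apply: (@le_trans _ _ r).
    by apply: ge_inf => //; exists kap1 => r' /rb/andP[].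
  by apply: ub_le_sup => //; exists kap2 => r' /rb/andP[].
- move=> w [h1 _] dl ldl.
  have [q0|q1] := ltnP (l0 dl) 1.
    have z0 := sumsq0 q0; rewrite (_ : \sum_(j < p) dl j ^+ 2 = 0) ?mulr0//.
    by apply: big1 => j _; rewrite z0 expr0n.
  rewrite -ler_pdivlMr ?sumsq_gt0//; apply: (le_trans h1); apply: ge_inf => //.
    exists 0 => r [dl' [/= l1 _] <-]; rewrite gram_quad divr_ge0 ?Q_ge0//.
    exact: ltW (sumsq_gt0 l1).
  by exists dl => //; rewrite gram_quad.
Qed.

(** The infimum is at most [t] exactly when, for each [k], some rational vector supported in [S] has
    a value below [t + 1 / (k + 1)]: this is a countable intersection of countable unions. *)
Lemma measurable_approx_min (h : Zt -> R) (S : {set 'I_p}) (t : R) : measurable_fun setT h ->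
  measurable [set w | approx_min Pd z h S w <= t].
Proof.
move=> mh; pose f w b := Num.sqrt (avg (fun i => (h (z i w) - Xb (fun i => Pd (z i w)) b i) ^+ 2)).
have mf b : measurable_fun setT (fun w => f w b).
  apply: measurableT_comp; first exact: (continuous_measurable_fun (@sqrt_continuous R)).
  apply: measurable_avg => i; apply: measurable_funX; apply: measurable_funB.
    exact: (measurableT_comp mh (mz i)).
  exact: measurable_Xcst.
have ok (q : {ffun 'I_p -> rat}) := [forall j, (j \notin S) ==> (q j == 0)].
pose F (k : nat) (q : {ffun 'I_p -> rat}) : set T :=
  [set w | [forall j, (j \notin S) ==> (q j == 0)] /\ f w (ratv q) < t + k.+1%:R^-1].
have mF k q : measurable (F k q).
  rewrite /F; case: ([forall j, _]); last by rewrite (_ : [set w | _] = set0)//; apply/seteqP; split => w [].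
  rewrite (_ : [set w | _] = [set w | f w (ratv q) < t + k.+1%:R^-1]); first exact: measurable_set_lt.
  by apply/seteqP; split => w; [case|split].
rewrite (_ : [set w | _] = \bigcap_k \bigcup_q F k q); last first.
  apply/seteqP; split => w /=.
    move=> le k _; have : approx_min Pd z h S w < t + k.+1%:R^-1.
      by apply: (le_lt_trans le); rewrite ltrDl invr_gt0.
    move=> /inf_lt[|y [b /= sb <-] lb].
      by eexists; exists (fun=> 0) => //.
    have c : f w (ratv (approxv b l)) @[l --> \oo] --> f w b.
      have c0 := @seq_cont_quad R n p (fun i => h (z i w)) (fun i => Pd (z i w)) _ _ (@approxv_cvg R p b).
      exact: (continuous_cvg _ (@sqrt_continuous R _) c0).
    have : \forall l \near \oo, f w (ratv (approxv b l)) < t + k.+1%:R^-1.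
      by apply: (cvgr_lt _ c).
    move=> [N _ /(_ N (leqnn N)) hN]; exists (approxv b N) => //; split => //.
    apply/forallP => j; apply/implyP => jS; rewrite ffunE (sb j jS).
    by rewrite rat_approx0.
  move=> hk; apply/ler_addgt0Pr => e e0.
  have [k ke] : exists k, k.+1%:R^-1 <= e.
    have /cvgrPdist_le/(_ _ e0) := @cvg_harmonic R.
    move=> [N _ /(_ N (leqnn N)) hN]; exists N; move: hN.
    by rewrite /= sub0r normrN ger0_norm ?invr_ge0.
  have [q _ [/forallP qS fq]] := hk k Logic.I.
  apply: (@le_trans _ _ (f w (ratv q))); last first.
    by apply: (le_trans (ltW fq)); rewrite lerD2l.
  apply: ge_inf; first by exists 0 => r [b _ <-]; exact: sqrtr_ge0.
  by exists (ratv q) => // j jS; have := qS j; rewrite jS /= => /eqP; rewrite /ratv => ->; rewrite rmorph0.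
apply: bigcap_measurableType => k _; exact: countable_bigcup_measurable.
Qed.

Variables I1 I2 I3 : T -> {set 'I_p}.
Hypothesis mI1 : forall S, measurable [set w | I1 w = S].
Hypothesis mI2 : forall S, measurable [set w | I2 w = S].
Hypothesis mI3 : forall S, measurable [set w | I3 w = S].

(** The selectors take finitely many values, so an event that depends on the selected sets is a
    countable union over these values. *)
Lemma measurable_selected (A : {set 'I_p} -> {set 'I_p} -> {set 'I_p} -> set T) :
  (forall S1 S2 S3, measurable (A S1 S2 S3)) -> measurable [set w | A (I1 w) (I2 w) (I3 w) w].
Proof.
move=> mA; pose F (S : {set 'I_p} * {set 'I_p} * {set 'I_p}) : set T :=
  [set w | I1 w = S.1.1] `&` [set w | I2 w = S.1.2] `&` [set w | I3 w = S.2] `&` A S.1.1 S.1.2 S.2.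
rewrite (_ : [set w | _] = \bigcup_S F S).
  apply: countable_bigcup_measurable => S.
  by apply: measurableI => //; apply: measurableI => //; exact: measurableI.
apply/seteqP; split => w /=.
  by move=> Aw; exists (I1 w, I2 w, I3 w).
by move=> [S _ [[[/= -> ->] ->] ?]].
Qed.

Lemma HLMS_event (g m : Zt -> R) (s C delta Delta : R) : 
  measurable_fun setT g -> measurable_fun setT m -> 0 < delta -> (0 < n)%N ->
  HLMS P z Pd g m s I1 I2 I3 C delta Delta ->
  exists A : set T, [/\ measurable A, (P A >= (1 - Delta)%:E)%E &
    forall w, A w -> (#|I1 w :|: I2 w :|: I3 w|%:R <= C * s) /\
      exists bm bg : 'I_p -> R, [/\ supported (I1 w :|: I2 w :|: I3 w) bm, supported (I1 w :|: I2 w :|: I3 w) bg,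
         nrm (fun i => m (z i w) - Xb (fun i => Pd (z i w)) bm i) <= 2 * delta * n%:R `^ (- 4^-1) &
         nrm (fun i => g (z i w) - Xb (fun i => Pd (z i w)) bg i) <= 2 * delta * n%:R `^ (- 4^-1)]].
Proof.
move=> mg mm d0 n0; rewrite /HLMS; set E := [set w | _] => PE; exists E; split => //.
- pose A (S1 S2 S3 : {set 'I_p}) : set T := [set w | #|S1 :|: S2 :|: S3|%:R <= C * s /\
    approx_min Pd z m S1 w <= delta * n%:R `^ (- 4^-1) /\ approx_min Pd z g S2 w <= delta * n%:R `^ (- 4^-1)].
  rewrite (_ : E = [set w | A (I1 w) (I2 w) (I3 w) w])//; apply: measurable_selected => S1 S2 S3.
  rewrite /A; case: (boolP (_ <= C * s)) => h; last first.
    by rewrite (_ : [set w | _] = set0)//; apply/seteqP; split => w [].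
  rewrite (_ : [set w | _] = [set w | approx_min Pd z m S1 w <= delta * n%:R `^ (- 4^-1)] `&`
     [set w | approx_min Pd z g S2 w <= delta * n%:R `^ (- 4^-1)]).
    by apply: measurableI; exact: measurable_approx_min.
  by apply/seteqP; split => w; [case|move=> [? ?]; split].
move=> w [hc [h1 h2]]; split => //.
(* The doubled threshold lies strictly above the infimum, which provides a coefficient vector
   without discussing whether the infimum is attained. *)
have tp : delta * n%:R `^ (- 4^-1) < 2 * delta * n%:R `^ (- 4^-1).
  by rewrite -mulrA ltr_pMl ?ltr1n// mulr_gt0// powR_gt0// ltr0n.
have ex (h : Zt -> R) (S : {set 'I_p}) : approx_min Pd z h S w <= delta * n%:R `^ (- 4^-1) ->
    exists2 b, supported S b & nrm (fun i => h (z i w) - Xb (fun i => Pd (z i w)) b i) <= 2 * delta * n%:R `^ (- 4^-1).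
  move=> le; have : approx_min Pd z h S w < 2 * delta * n%:R `^ (- 4^-1) by apply: (le_lt_trans le).
  move=> /inf_lt[|y [b /= sb <-] lb]; first by eexists; exists (fun=> 0).
  by exists b => //; exact: ltW.
have [bm sm hm] := ex m (I1 w) h1; have [bg sg hg] := ex g (I2 w) h2.
exists bm, bg; split => // j; rewrite !inE !negb_or => /andP[/andP[? ?] _].
  exact: sm.
exact: sg.
Qed.

End Events.

(** * Moment bounds for one row *)

Section RowBounds.
Context {dT : measure_display} {T : measurableType dT} {R : realType}.
Variable P : probability T R.
Variable n : nat.
Hypothesis n0 : (0 < n)%N.
Implicit Type a b e : 'I_n -> T -> R.

Let np : 0 < (n%:R : R). Proof. by rewrite ltr0n. Qed.

Lemma sq_mul_ge0 (u v : R) : 0 <= u ^+ 2 * v ^+ 2.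
Proof. by rewrite mulr_ge0// sqr_ge0. Qed.

Lemma powR_ge_sq (u q : R) : 0 <= u -> 4 <= q -> u ^+ 2 <= 1 + u `^ q.
Proof.
move=> u0 q4; have [u1|u1] := leP u 1.
  by apply: (@le_trans _ _ 1); [rewrite exprn_ile1|rewrite lerDl powR_ge0].
apply: (@le_trans _ _ (u `^ q)); last by rewrite lerDr.
rewrite -powR_mulrn//; apply: ler_powR; [exact: ltW|].
by apply: le_trans q4; rewrite ler_nat.
Qed.

Lemma powR_mono (u q q' : R) : 0 <= u -> 0 <= q -> q <= q' -> u `^ q <= 1 + u `^ q'.
Proof.
move=> u0 q0 qq; have [u1|u1] := leP u 1.
  apply: (@le_trans _ _ 1); last by rewrite lerDl powR_ge0.
  have e1 : (1 : R) `^ q = 1 by rewrite powR1.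
  by rewrite -[leRHS]e1 ge0_ler_powR// nnegrE.
apply: (@le_trans _ _ (u `^ q')); last by rewrite lerDr.
by apply: ler_powR => //; exact: ltW.
Qed.

Lemma powR_add (u w q : R) : 0 <= q -> `|u + w| `^ q <= 2 `^ q * (`|u| `^ q + `|w| `^ q).
Proof.
move=> q0; wlog uw : u w / `|u| <= `|w|.
  move=> wl; have [/wl //|/ltW/wl] := leP `|u| `|w|.
  by rewrite addrC [X in _ * X]addrC.
apply: (@le_trans _ _ ((2 * `|w|) `^ q)).
  rewrite ge0_ler_powR ?nnegrE ?mulr_ge0//.
  by apply: (le_trans (ler_normD _ _)); rewrite mulr_natl mulr2n lerD2r.
by rewrite powRM// ler_wpM2l ?powR_ge0// lerDr powR_ge0.
Qed.

Lemma measurable_absR (f : T -> R) (q : R) : measurable_fun setT f ->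
  measurable_fun setT (fun w => `|f w| `^ q).
Proof.
move=> mf; apply: (measurableT_comp (measurable_powR q)).
exact: measurableT_comp.
Qed.

Section Pair.
Variables (a b : 'I_n -> T -> R) (q M : R).
Hypothesis q4 : 4 < q.
Hypothesis ma : forall i, measurable_fun setT (a i).
Hypothesis mb : forall i, measurable_fun setT (b i).
Hypothesis ia : forall i, itg P (fun w => `|a i w| `^ q).
Hypothesis ib : forall i, itg P (fun w => `|b i w| `^ q).
Hypothesis Ma : Eavg P (fun i w => `|a i w| `^ q) <= M.
Hypothesis Mb : Eavg P (fun i w => `|b i w| `^ q) <= M.

Let q4' : 4 <= q := ltW q4.

Lemma row_itg_sq i : itg P (fun w => b i w ^+ 2).
Proof.
apply: (@itg_le _ _ _ _ (fun w => 1 + `|b i w| `^ q)).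
- exact: measurable_funX.
- by move=> w; rewrite normrX powR_ge_sq.
- by apply: itgD => //; exact: itg_cst.
Qed.

Lemma row_itg i : itg P (fun w => a i w ^+ 2 * b i w ^+ 2).
Proof.
have i1 := itgD (row_itg_sq i) (itgD (ia i) (ib i)).
apply: (itg_le _ _ i1).
- by apply: measurable_funM; exact: measurable_funX.
- move=> w; rewrite ger0_norm ?sq_mul_ge0//.
  have := @mul_sq_le R `|a i w| `|b i w| 1 q (normr_ge0 _) (normr_ge0 _) ltr01 q4'.
  by rewrite !real_normK ?num_real// expr1n mul1r powR1 mul1r.
Qed.

(** Meant for [b] an approximation error, whose second moment is so small that the weight [K ^ 2]
    does no harm; the moments of order [q] take care of the values beyond [K]. *)
Lemma row_cross (K : R) : 0 < K ->
  Eavg P (fun i w => a i w ^+ 2 * b i w ^+ 2) <=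
  K ^+ 2 * Eavg P (fun i w => b i w ^+ 2) + K `^ (4 - q) * (2 * M).
Proof.
move=> K0; have i2 i := itgZ (K ^+ 2) (row_itg_sq i).
have i3 i := itgZ (K `^ (4 - q)) (itgD (ia i) (ib i)).
apply: (@le_trans _ _ (Eavg P (fun i w => K ^+ 2 * b i w ^+ 2 + K `^ (4 - q) * (`|a i w| `^ q + `|b i w| `^ q)))).
  apply: Eavg_le => [i|i|i w]; [exact: row_itg|exact: itgD|].
  have := @mul_sq_le R `|a i w| `|b i w| K q (normr_ge0 _) (normr_ge0 _) K0 q4'.
  by rewrite !real_normK ?num_real.
rewrite EavgD//; rewrite EavgZ; last exact: row_itg_sq.
rewrite EavgZ; last by move=> i; exact: itgD.
rewrite lerD2l ler_wpM2l ?powR_ge0// EavgD//; move: Ma Mb; lra.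
Qed.

Lemma row_sq_bound : Eavg P (fun i w => a i w ^+ 2 * b i w ^+ 2) <= 1 + 3 * M.
Proof.
have := @row_cross 1 ltr01; rewrite expr1n mul1r powR1 mul1r.
have : Eavg P (fun i w => b i w ^+ 2) <= 1 + M.
  apply: (@le_trans _ _ (Eavg P (fun i w => 1 + `|b i w| `^ q))).
    apply: Eavg_le => [i|i|i w]; [exact: row_itg_sq|by apply: itgD => //; exact: itg_cst|].
    by rewrite -(real_normK (num_real (b i w))) powR_ge_sq.
  by rewrite EavgD//; [rewrite Eavg_cst// lerD2l|move=> i; exact: itg_cst].
lra.
Qed.

Lemma row_tail (K : R) : 0 < K ->
  (forall i, itg P (fun w => a i w ^+ 2 * b i w ^+ 2 * (K ^+ 4 < a i w ^+ 2 * b i w ^+ 2)%R%:R)) /\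
  Eavg P (fun i w => a i w ^+ 2 * b i w ^+ 2 * (K ^+ 4 < a i w ^+ 2 * b i w ^+ 2)%R%:R) <=
  K `^ (4 - q) * (2 * M).
Proof.
move=> K0; have i3 i := itgZ (K `^ (4 - q)) (itgD (ia i) (ib i)).
have mab i : measurable_fun setT (fun w => a i w ^+ 2 * b i w ^+ 2).
  by apply: measurable_funM; exact: measurable_funX.
have it i : itg P (fun w => a i w ^+ 2 * b i w ^+ 2 * (K ^+ 4 < a i w ^+ 2 * b i w ^+ 2)%R%:R).
  apply: (itg_le _ _ (row_itg i)).
    apply: measurable_funM => //.
    apply: (measurableT_comp (f := fun x : bool => x%:R : R)) => //.
    exact: measurable_fun_ltr.
  move=> w; rewrite normrM ger0_norm ?sq_mul_ge0// ler_piMr ?sq_mul_ge0//.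
  by rewrite ger0_norm// lern1 leq_b1.
split => //.
apply: (@le_trans _ _ (Eavg P (fun i w => K `^ (4 - q) * (`|a i w| `^ q + `|b i w| `^ q)))).
  apply: Eavg_le => // i w.
  have := @mul_sq_tail R `|a i w| `|b i w| K q (normr_ge0 _) (normr_ge0 _) K0 q4'.
  by rewrite !real_normK ?num_real.
rewrite EavgZ; last by move=> i; exact: itgD.
rewrite ler_wpM2l ?powR_ge0// EavgD//; move: Ma Mb; lra.
Qed.

Lemma row_lln (K : R) : 0 < K -> iRV P n (ext (fun i w => a i w ^+ 2 * b i w ^+ 2)) ->
  let D w := `|avg (fun i => a i w ^+ 2 * b i w ^+ 2) - Eavg P (fun i w => a i w ^+ 2 * b i w ^+ 2)| in
  itg P D /\ Ex P D <= K ^+ 2 / Num.sqrt n%:R * (2 + 3 * M) + K `^ (4 - q) * (4 * M).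
Proof.
move=> K0 ind D; set W := fun i w => a i w ^+ 2 * b i w ^+ 2.
have rt := row_tail K0; have [itt Et] := rt.
have sn : 0 < Num.sqrt (n%:R : R) by rewrite sqrtr_gt0.
have snn : Num.sqrt (n%:R : R) ^+ 2 = n%:R by rewrite sqr_sqrtr// ltW.
(* With truncation level [K ^ 4] this choice balances [lln_bound]: both [c / n] and [K ^ 4 / c]
   equal [K ^ 2 / sqrt n]. *)
pose c := K ^+ 2 * Num.sqrt n%:R.
have c0 : 0 < c by rewrite mulr_gt0// exprn_gt0.
have K4 : 0 <= K ^+ 4 by rewrite exprn_ge0// ltW.
have [] := @lln_bound _ _ _ P n (ext W) (K ^+ 4) c K4 c0 ind.
- apply: (ext_ind (Q := fun X : T -> R => forall w, 0 <= X w)) => // i w.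
  exact: sq_mul_ge0.
- by apply: (ext_lt (Q := fun X : T -> R => itg P X)) => i; exact: row_itg.
have eS w : \sum_(i < n) (ext W i w - Ex P (ext W i)) = n%:R * (avg (fun i => W i w) - Eavg P W).
  rewrite sumrB (ext_sum W (fun X => X w)) (ext_sum W (fun X => Ex P X)).
  by rewrite mulrBr /Eavg /avg !mulrA divff ?mul1r// gt_eqF.
have -> : (fun w => `|\sum_(i < n) (ext W i w - Ex P (ext W i))|) = (fun w => n%:R * D w).
  by apply/funext => w; rewrite eS normrM ger0_norm// ltW.
move=> iD bD.
have iD' : itg P D.
  have := itgZ (n%:R)^-1 iD; congr (itg P _); apply/funext => w.
  by rewrite mulrA mulVf ?mul1r// gt_eqF.
split=> //; move: bD; rewrite ExZ// (ext_sum W (fun X => Ex P X)).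
rewrite (ext_sum W (fun X => Ex P (fun w => X w * (K ^+ 4 < X w)%R%:R))).
have -> : \sum_(i < n) Ex P (W i) = n%:R * Eavg P W.
  by rewrite /Eavg /avg mulrA divff ?mul1r// gt_eqF.
have -> : \sum_(i < n) Ex P (fun w => W i w * (K ^+ 4 < W i w)%R%:R) =
   n%:R * Eavg P (fun i w => W i w * (K ^+ 4 < W i w)%R%:R).
  by rewrite /Eavg /avg mulrA divff ?mul1r// gt_eqF.
have r1 := row_sq_bound.
move: Et r1; rewrite -/W; set E1 := Eavg P W; set E2 := Eavg P _; set KK := K `^ _ => Et r1 h.
have {}h : n%:R * Ex P D <= n%:R * (K ^+ 2 / Num.sqrt n%:R * (1 + E1) + 2 * E2).
  apply: (le_trans h).
  have -> : c = n%:R * (K ^+ 2 / Num.sqrt n%:R).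
    by rewrite /c; move: sn snn; move: (Num.sqrt _) => sq sq0 <-; field; rewrite gt_eqF.
  rewrite le_eqVlt; apply/orP; left; apply/eqP.
  by move: sn snn; move: (Num.sqrt _) => sq sq0 <-; field; rewrite !gt_eqF.
rewrite ler_pM2l// in h; apply: (le_trans h); apply: lerD; last by lra.
rewrite ler_wpM2l ?divr_ge0 ?sqr_ge0 ?(ltW sn)//; lra.
Qed.

End Pair.

Lemma row_var a b : iRV P n (ext (fun i w => a i w * b i w)) ->
  (forall i, itg P (fun w => a i w ^+ 2 * b i w ^+ 2)) -> (forall i, Ex P (fun w => a i w * b i w) = 0) ->
  itg P (fun w => (Num.sqrt n%:R * ip (fun i => a i w) (fun i => b i w)) ^+ 2) /\
  Ex P (fun w => (Num.sqrt n%:R * ip (fun i => a i w) (fun i => b i w)) ^+ 2) =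
    Eavg P (fun i w => a i w ^+ 2 * b i w ^+ 2).
Proof.
move=> ind i2 e0; set W := fun i w => a i w * b i w.
have [||j e] := iRV_Ex_sum2 ind.
- apply: (ext_lt (Q := fun X : T -> R => itg P (fun w => X w ^+ 2))) => i.
  by under eq_fun do rewrite exprMn.
- exact: (ext_lt (Q := fun X : T -> R => Ex P X = 0)).
have eF : (fun w => (Num.sqrt n%:R * ip (fun i => a i w) (fun i => b i w)) ^+ 2) =
    (fun w => n%:R^-1 * (\sum_(i < n) ext W i w) ^+ 2).
  apply/funext => w; rewrite (ext_sum W (fun X => X w)) /ip /avg exprMn sqr_sqrtr ?ltW// exprMn mulrA.
  by congr (_ * _); rewrite expr2 mulrA divff ?mul1r// gt_eqF.
rewrite eF; split; first exact: itgZ.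
rewrite ExZ// e (ext_sum W (fun X => Ex P (fun w => X w ^+ 2))) /Eavg /avg; congr (_ * _).
by apply: eq_bigr => i _; congr Ex; apply/funext => w; rewrite exprMn.
Qed.

(** At truncation level [B = sqrt (n / L)], third moments bound the bias over [B] by [B ^ -2] times
    the third absolute moment, and the second moment by 1 plus it. As [B ^ -2 = L / n], the sum
    costs at most [L (1 + 2 C)] in the exponent, and [K = 2 C + 3] leaves [- 2 L]. *)
Lemma row_chernoff e (C L K : R) : 0 <= C -> 0 < L -> L <= n%:R -> K = 2 * C + 3 ->
  (forall i, measurable_fun setT (e i)) ->
  iRV P n (ext (fun i w => e i w * (`|e i w| <= Num.sqrt (n%:R / L))%R%:R)) ->
  (forall i, itg P (fun w => `|e i w| ^+ 3)) -> Eavg P (fun i w => `|e i w| ^+ 3) <= C ->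
  (forall i, Ex P (e i) = 0) ->
  (P [set w | K * Num.sqrt (n%:R * L) <= \sum_(i < n) (e i w * (`|e i w| <= Num.sqrt (n%:R / L))%R%:R)]%R
   <= (expR (- (2 * L)))%:E)%E.
Proof.
move=> C0 L0 Ln KE me ind i3 E3 e0.
set B := Num.sqrt (n%:R / L); set Y := fun i w => e i w * (`|e i w| <= B)%R%:R.
have B2 : B ^+ 2 = n%:R / L by rewrite sqr_sqrtr// divr_ge0// ltW.
have B0 : 0 < B by rewrite sqrtr_gt0 divr_gt0.
have B1 : 1 <= B.
  by rewrite -[leLHS]sqrtr1 /B ler_wsqrtr// ler_pdivlMr// mul1r.
have bY i w : `|Y i w| <= B.
  by rewrite /Y; have [h|h] := leP `|e i w| B; rewrite /= ?mulr1 ?mulr0 ?normr0// ltW.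
have mY i : measurable_fun setT (Y i).
  apply: measurable_funM => //; apply: (measurableT_comp (f := fun x : bool => x%:R : R)) => //.
  by apply: measurable_fun_ler => //; exact: measurableT_comp.
have i1 i : itg P (e i).
  apply: (@itg_le _ _ _ _ (fun w => 1 + `|e i w| ^+ 3)) => //.
    move=> w; have [h|h] := leP `|e i w| 1; first by rewrite (le_trans h)// lerDl exprn_ge0.
    apply: (@le_trans _ _ (`|e i w| ^+ 3)); last by rewrite lerDr.
    by rewrite -[leLHS]expr1 ler_weXn2l// ltW.
  by apply: itgD => //; exact: itg_cst.
have iY i : itg P (Y i) by exact: (itg_bounded P (mY i) (bY i)).
(* As [e i] is centred, the mean of its truncation is minus the mean of the part cut off, where
   [|e| <= B ^ -2 |e| ^ 3]. *)
have EY i : `|Ex P (Y i)| <= B ^- 2 * Ex P (fun w => `|e i w| ^+ 3).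
  have -> : Ex P (Y i) = - Ex P (fun w => e i w - Y i w) by rewrite ExB// e0 sub0r opprK.
  rewrite normrN -ExZ//; apply: Ex_le_bound; last exact: itgZ.
    exact: measurable_funB.
  move=> w; rewrite /Y; have [h|h] := leP `|e i w| B; rewrite /= ?mulr1 ?mulr0 ?subrr ?normr0 ?subr0.
    by rewrite mulr_ge0 ?exprn_ge0// invr_ge0 exprn_ge0// ltW.
  by rewrite ler_pdivlMl ?exprn_gt0// [`|_| ^+ 3]exprSr ler_wpM2r// lerXn2r ?nnegrE ?(ltW B0) ?(ltW h).
have EY2 i : Ex P (fun w => Y i w ^+ 2) <= 1 + Ex P (fun w => `|e i w| ^+ 3).
  rewrite -[X in X + _](Ex_cst P) -ExD//; last exact: itg_cst.
  apply: Ex_le => [||w].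
  - apply: (@itg_bounded _ _ _ _ (B ^+ 2)); first exact: measurable_funX.
    by move=> w; rewrite normrX lerXn2r ?nnegrE// ltW.
  - by apply: itgD => //; exact: itg_cst.
  apply: (@le_trans _ _ (`|e i w| ^+ 2)).
    rewrite -(real_normK (num_real (Y i w))) lerXn2r ?nnegrE// /Y normrM ler_piMr//.
    by rewrite ger0_norm// lern1 leq_b1.
  have [h|h] := leP `|e i w| 1.
    by apply: (@le_trans _ _ 1); rewrite ?exprn_ile1// lerDl exprn_ge0.
  apply: (@le_trans _ _ (`|e i w| ^+ 3)); last by rewrite lerDr.
  by rewrite ler_weXn2l// ltW.
have := @chernoff _ _ _ P n (ext Y) B (K * Num.sqrt (n%:R * L)) B0 ind.
have -> : [set w | K * Num.sqrt (n%:R * L) <= \sum_(i < n) ext Y i w] =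
    [set w | K * Num.sqrt (n%:R * L) <= \sum_(i < n) Y i w].
  by apply/seteqP; split => w /=; rewrite (ext_sum Y (fun X => X w)).
have hb : forall i w, `|ext Y i w| <= B.
  by apply: (ext_ind (Q := fun X : T -> R => forall w, `|X w| <= B)) => // w; rewrite normr0 ltW.
move=> /(_ hb) h; apply: (le_trans h); rewrite lee_fin ler_expR {h}.
rewrite (ext_sum Y (fun X => `|Ex P X| / B + Ex P (fun w => X w ^+ 2) / B ^+ 2)).
have sB : Num.sqrt (n%:R * L) / B = L.
  rewrite /B -sqrtrV ?divr_ge0 ?(ltW L0)// -sqrtrM ?mulr_ge0 ?(ltW L0)//.
  rewrite (_ : n%:R * L * (n%:R / L)^-1 = L ^+ 2); last by field; rewrite !gt_eqF.
  by rewrite sqrtr_sqr gtr0_norm.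
rewrite -mulrA sB.
have nE : \sum_(i < n) Ex P (fun w => `|e i w| ^+ 3) <= n%:R * C.
  by move: E3; rewrite /Eavg /avg ler_pdivrMl.
have BL : B ^- 2 = L / n%:R by rewrite B2 invf_div.
apply: (@le_trans _ _ (- (K * L) + \sum_(i < n) (B ^- 2 * (1 + 2 * Ex P (fun w => `|e i w| ^+ 3))))).
  rewrite lerD2l; apply: ler_sum => i _.
  have t1 : `|Ex P (Y i)| / B <= B ^- 2 * Ex P (fun w => `|e i w| ^+ 3).
    apply: (le_trans _ (EY i)); rewrite ler_pdivrMr// ler_peMr//.
  have t2 : Ex P (fun w => Y i w ^+ 2) / B ^+ 2 <= B ^- 2 * (1 + Ex P (fun w => `|e i w| ^+ 3)).
    by rewrite mulrC ler_wpM2l// invr_ge0 exprn_ge0// ltW.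
  by move: t1 t2; rewrite !mulrDr; lra.
rewrite -mulr_sumr big_split /= sumr_const card_ord -mulr_sumr BL.
have : L / n%:R * (1 *+ n + 2 * \sum_(i < n) Ex P (fun w => `|e i w| ^+ 3)) <= L * (1 + 2 * C).
  rewrite -mulrA ler_pM2l// ler_pdivrMl// mulrDr mulr1.
  by rewrite lerD2l; move: nE; lra.
by rewrite KE; lra.
Qed.

(** The cubic bound is used where [|X|] is small and the quadratic one elsewhere, where the tail
    estimate applies. No single summand carries more than [M / (n c2)] of the total variance 1,
    which bounds the sum of squared variances. *)
Lemma row_clt_sum (X : 'I_n -> T -> R) (a b : 'I_n -> T -> R) (q M K sigma2 c2 : R) :
  4 < q -> 0 < K -> 0 < c2 -> c2 <= sigma2 ->
  (forall i, measurable_fun setT (a i)) -> (forall i, measurable_fun setT (b i)) ->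
  (forall i, itg P (fun w => `|a i w| `^ q)) -> (forall i, itg P (fun w => `|b i w| `^ q)) ->
  Eavg P (fun i w => `|a i w| `^ q) <= M -> Eavg P (fun i w => `|b i w| `^ q) <= M ->
  (forall i, Ex P (fun w => a i w ^+ 2 * b i w ^+ 2) <= M) ->
  sigma2 = Eavg P (fun i w => a i w ^+ 2 * b i w ^+ 2) ->
  (forall i w, X i w = a i w * b i w / Num.sqrt (n%:R * sigma2)) ->
  \sum_(i < n) (Ex P (fun w => Num.min (X i w ^+ 2) (`|X i w| ^+ 3)) + Ex P (fun w => X i w ^+ 2) ^+ 2)
  <= K ^+ 2 / Num.sqrt (n%:R * c2) + c2^-1 * (K `^ (4 - q) * (2 * M)) + M ^+ 2 / (c2 ^+ 2 * n%:R).
Proof.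
move=> q4 K0 c20 cs ma mb ia ib Ma Mb Mab s2E XE.
have s0 : 0 < sigma2 by apply: lt_le_trans cs.
set W := fun i w => a i w ^+ 2 * b i w ^+ 2 in Mab s2E *.
have iW i : itg P (W i) by exact: row_itg q4 ma mb ia ib i.
have [iT ET] := row_tail q4 ma mb ia ib Ma Mb K0.
have ns0 : 0 < n%:R * sigma2 by rewrite mulr_gt0.
have X2 i w : X i w ^+ 2 = (n%:R * sigma2)^-1 * W i w.
  by rewrite XE exprMn exprVn sqr_sqrtr ?(ltW ns0)// exprMn mulrC.
have mX i : measurable_fun setT (X i).
  by rewrite (_ : X i = fun w => a i w * b i w / Num.sqrt (n%:R * sigma2));
    [apply: measurable_funM => //; exact: measurable_funM|apply/funext => w; exact: XE].
(* Chosen so that [|X| > eta] forces [W > K ^ 4], the range covered by [row_tail]. *)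
pose eta := K ^+ 2 / Num.sqrt (n%:R * c2).
have nc0 : 0 < n%:R * c2 by rewrite mulr_gt0.
have eta0 : 0 < eta by rewrite divr_gt0 ?exprn_gt0// sqrtr_gt0.
have iX2 i : itg P (fun w => X i w ^+ 2).
  by rewrite (_ : (fun w => _) = fun w => (n%:R * sigma2)^-1 * W i w);
    [exact: itgZ|apply/funext => w; exact: X2].
pose Tl i w := W i w * (K ^+ 4 < W i w)%R%:R.
have Ww i w : 0 <= W i w by exact: sq_mul_ge0.
have Tl0 i w : 0 <= Tl i w by rewrite /Tl mulr_ge0.
have is0 : 0 <= (n%:R * sigma2)^-1 by rewrite invr_ge0 ltW.
have pw i w : Num.min (X i w ^+ 2) (`|X i w| ^+ 3) <= eta * X i w ^+ 2 + (n%:R * sigma2)^-1 * Tl i w.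
  have [h|h] := leP `|X i w| eta.
    apply: (@le_trans _ _ (`|X i w| ^+ 3)); first by rewrite ge_min lexx orbT.
    apply: (@le_trans _ _ (eta * X i w ^+ 2)).
      by rewrite exprS real_normK ?num_real// ler_wpM2r ?sqr_ge0.
    by rewrite lerDl mulr_ge0.
  apply: (@le_trans _ _ (X i w ^+ 2)); first by rewrite ge_min lexx.
  rewrite X2 /Tl.
  have -> : (K ^+ 4 < W i w)%R.
    have : eta ^+ 2 < X i w ^+ 2.
      by rewrite -(real_normK (num_real (X i w))) ltrXn2r ?nnegrE ?(ltW eta0)//.
    rewrite X2 /eta exprMn exprVn sqr_sqrtr ?(ltW nc0)// -exprM.
    rewrite ltr_pdivlMl// => hh; apply: le_lt_trans hh.
    rewrite mulrCA ler_peMr ?exprn_ge0 ?(ltW K0)// ler_pdivlMr// mul1r ler_pM2l//.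
  by rewrite mulr1 lerDr mulr_ge0 ?(ltW eta0)// mulr_ge0.
have EX2 i : Ex P (fun w => X i w ^+ 2) = (n%:R * sigma2)^-1 * Ex P (W i).
  by rewrite -ExZ//; congr Ex; apply/funext => w; exact: X2.
have sW : \sum_(i < n) Ex P (W i) = n%:R * sigma2.
  by rewrite s2E /Eavg /avg mulrA divff ?mul1r// gt_eqF.
have sX2 : \sum_(i < n) Ex P (fun w => X i w ^+ 2) = 1.
  rewrite (eq_bigr (fun i => (n%:R * sigma2)^-1 * Ex P (W i))) => [|i _]; last exact: EX2.
  by rewrite -mulr_sumr sW mulVf// gt_eqF.
rewrite big_split /=; apply: lerD.
  apply: (@le_trans _ _ (\sum_(i < n) (eta * Ex P (fun w => X i w ^+ 2) + (n%:R * sigma2)^-1 * Ex P (Tl i)))).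
    apply: ler_sum => i _.
    have iXe := itgZ eta (iX2 i); have iTs := itgZ (n%:R * sigma2)^-1 (iT i).
    rewrite -(ExZ eta (iX2 i)) -(ExZ (n%:R * sigma2)^-1 (iT i)) -(ExD iXe iTs).
    apply: Ex_le => //; last exact: itgD.
    apply: (itg_le _ _ (iX2 i)).
      by apply: measurable_minr; apply: measurable_funX => //; exact: measurableT_comp.
    move=> w; rewrite ger0_norm; first by rewrite ge_min lexx.
    by rewrite le_min sqr_ge0 exprn_ge0.
  rewrite big_split /= -!mulr_sumr sX2 mulr1 lerD2l.
  have -> : \sum_(i < n) Ex P (Tl i) = n%:R * Eavg P Tl.
    by rewrite /Eavg /avg mulrA divff ?mul1r// gt_eqF.
  rewrite invfM mulrACA mulVf ?gt_eqF// mul1r.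
  apply: ler_pM => //; first by rewrite invr_ge0 ltW.
    exact: Eavg_ge0.
  by rewrite lef_pV2 ?posrE.
have W0 i : 0 <= Ex P (W i) by apply: Ex_ge0.
have M0 : 0 <= M by exact: le_trans (W0 (Ordinal n0)) (Mab (Ordinal n0)).
apply: (@le_trans _ _ (\sum_(i < n) (M / (n%:R * c2)) ^+ 2)).
  apply: ler_sum => i _; rewrite lerXn2r ?nnegrE ?divr_ge0 ?(ltW nc0) ?Ex_ge0//.
    by move=> w; exact: sqr_ge0.
  rewrite EX2 mulrC; apply: ler_pM; [exact: W0|exact: is0|exact: Mab|].
  by rewrite lef_pV2 ?posrE// ler_pM2l.
rewrite sumr_const card_ord -[leLHS]mulr_natl le_eqVlt; apply/orP; left; apply/eqP.
by field; rewrite !gt_eqF.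
Qed.

End RowBounds.

(** * Consequences of the conditions at a fixed sample size *)

Section ModelFacts.
Context {R : realType} {dT : measure_display} {T : measurableType dT}
        {dZ : measure_display} {Zt : measurableType dZ}.
Variables (P : probability T R) (n p : nat) (y d : 'I_n -> T -> R) (z : 'I_n -> T -> Zt)
  (Pd : Zt -> 'I_p -> R) (alpha0 : R) (g m : Zt -> R) (s : R) (bm0 bg0 : 'I_p -> R)
  (I1 I2 I3 : T -> {set 'I_p}) (c C q1 q2 delta Delta : R).
Hypothesis n0 : (0 < n)%N.
Hypothesis c0 : 0 < c.
Hypothesis C0 : 0 < C.
Hypothesis my : forall i, measurable_fun setT (y i).
Hypothesis md : forall i, measurable_fun setT (d i).
Hypothesis mz : forall i, measurable_fun setT (z i).
Hypothesis mPd : forall j, measurable_fun setT (fun u => Pd u j).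
Hypothesis mg : measurable_fun setT g.
Hypothesis mm : measurable_fun setT m.
Hypothesis ind : mutually_independent P (sig_omega y d z).
Hypothesis aste : ASTE P y d z Pd alpha0 g m s bm0 bg0 I1 I2 I3 C q1 delta Delta.
Hypothesis sm : SM P y d z Pd alpha0 g m s c C q2 delta Delta.

Let ze := zeta y d z alpha0 g.
Let v := vres d z m.
Let rm := rerr Pd z m bm0.
Let rg := rerr Pd z g bg0.
Let vt i w := v i w + rm i w.
Let zt i w := ze i w + rg i w.
Let x i j w := Pd (z i w) j.

Let H (i : 'I_n) : set (set T) := preims (y i) `|` preims (d i) `|` preims (z i).

Lemma gen_meas (G0 : set (set T)) dU (U : measurableType dU) (f : T -> U) : preims f `<=` G0 ->
  measurable_fun (setT : set (g_sigma_algebraType G0)) f.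
Proof. by move=> h _ B mB; rewrite setTI; apply: sub_sigma_algebra; apply: h; exists B. Qed.

Lemma gen_sub (G0 : set (set T)) (f : T -> R) : 
  measurable_fun (setT : set (g_sigma_algebraType G0)) f -> forall B : set R, measurable B -> <<s G0 >> (f @^-1` B).
Proof. by move=> h B mB; have := h measurableT B mB; rewrite setTI. Qed.

Lemma gen_le (G0 : set (set T)) : G0 `<=` measurable -> <<s G0 >> `<=` measurable.
Proof. by move=> h; apply: smallest_sub => //; exact: sigma_algebra_measurable. Qed.

Lemma preims_le dU (U : measurableType dU) (f : T -> U) : measurable_fun setT f -> preims f `<=` measurable.
Proof. by move=> mf _ [B mB <-]; exact: measurable_preimage. Qed.

Let Hm i : H i `<=` measurable.
Proof. by move=> A [[]|]; apply: preims_le. Qed.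

(** Measurability for the sigma-algebra of the i-th observation, written as measurability out of
    [g_sigma_algebraType] so that the usual closure lemmas apply. Any adapted family inherits
    independence across [i]. *)
Definition adapted (i : 'I_n) (f : T -> R) : Prop :=
  measurable_fun (setT : set (g_sigma_algebraType (H i))) f.

Lemma adapted_meas i f : adapted i f -> measurable_fun setT f.
Proof.
by move=> h _ B mB; rewrite setTI; apply: (gen_le (@Hm i)); exact: gen_sub.
Qed.

Lemma adapted_iRV (X : 'I_n -> T -> R) : (forall i, adapted i (X i)) -> iRV P n (ext X).
Proof. by move=> h; apply: (iRV_ext Hm ind). Qed.

Lemma ad_zfun i (h : Zt -> R) : measurable_fun setT h -> adapted i (fun w => h (z i w)).
Proof.
move=> mh; apply: (measurableT_comp mh); apply: gen_meas => A; by right.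
Qed.

Lemma ad_d i : adapted i (d i).
Proof. by apply: gen_meas => A; left; right. Qed.

Lemma ad_y i : adapted i (y i).
Proof. by apply: gen_meas => A; left; left. Qed.

Lemma ad_x i j : adapted i (x i j).
Proof. exact: (ad_zfun (mPd j)). Qed.

Lemma ad_v i : adapted i (v i).
Proof. by apply: measurable_funB; [exact: ad_d|exact: ad_zfun]. Qed.

Lemma ad_ze i : adapted i (ze i).
Proof.
apply: measurable_funB; last exact: ad_zfun.
by apply: measurable_funB; [exact: ad_y|apply: measurable_funM => //; exact: ad_d].
Qed.

Let mxdot (b : 'I_p -> R) : measurable_fun setT (fun u => xdot (Pd u) b).
Proof. by apply: measurable_sum => j; apply: measurable_funM. Qed.

Let mrerr (h : Zt -> R) b : measurable_fun setT h -> measurable_fun setT (fun u => h u - xdot (Pd u) b).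
Proof. by move=> mh; apply: measurable_funB. Qed.

Lemma ad_rm i : adapted i (rm i).
Proof. exact: (ad_zfun (mrerr bm0 mm)). Qed.

Lemma ad_rg i : adapted i (rg i).
Proof. exact: (ad_zfun (mrerr bg0 mg)). Qed.

Lemma ad_vt i : adapted i (vt i).
Proof. by apply: measurable_funD; [exact: ad_v|exact: ad_rm]. Qed.

Lemma ad_zt i : adapted i (zt i).
Proof. by apply: measurable_funD; [exact: ad_ze|exact: ad_rg]. Qed.

(** Conditions ASTE and SM come with exponents of their own; the smaller one serves wherever both
    kinds of residuals meet. *)
Definition qmin : R := Num.min q1 q2.
(** One constant above three bounds: [1 + C] for the residuals, [2 ^ qmin * (2 + 2 * C)] for their
    differences, and [C ^ 2] for the mean of [v ^ 2 * ze ^ 2] in the central limit theorem. *)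
Definition momM : R := 2 `^ qmin * (2 + 2 * C) + (1 + C) + C ^+ 2.

Lemma q1_gt4 : 4 < q1. Proof. by case: aste => _ _ _ _ []. Qed.
Lemma q2_gt4 : 4 < q2. Proof. by case: sm. Qed.
Lemma qmin_gt4 : 4 < qmin. Proof. by rewrite /qmin lt_min q1_gt4 q2_gt4. Qed.

Let qmin0 : 0 <= qmin. Proof. by apply: ltW; apply: lt_trans qmin_gt4. Qed.

Lemma momM_bounds : 1 + C <= momM /\ C ^+ 2 <= momM /\ 2 `^ qmin * (2 + 2 * C) <= momM.
Proof.
have h1 : 0 <= 2 `^ qmin * (2 + 2 * C) by rewrite mulr_ge0 ?powR_ge0// addr_ge0// mulr_ge0// ltW.
have h2 : 0 <= C ^+ 2 by exact: sqr_ge0.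
by rewrite /momM; move: h1 h2 C0; move: (2 `^ _ * _) (C ^+ 2) => a b; split; [lra|split; lra].
Qed.

Let sum3_le (a b e : \bar R) : (0 <= a -> 0 <= b -> 0 <= e -> a + b + e <= C%:E ->
  [/\ a <= C%:E, b <= C%:E & e <= C%:E])%E.
Proof.
move=> a0 b0 e0 h; split; apply: le_trans h.
- by apply: (@le_trans _ _ (a + b)%E); [rewrite leeDl|rewrite leeDl].
- by apply: (@le_trans _ _ (a + b)%E); [rewrite leeDr|rewrite leeDl].
- by rewrite leeDr// adde_ge0.
Qed.

Let mono_q (f : 'I_n -> T -> R) (q : R) : qmin <= q -> (forall i, measurable_fun setT (f i)) ->
  (forall i, itg P (fun w => `|f i w| `^ q)) ->
  Eavg P (fun i w => `|f i w| `^ q) <= C ->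
  (forall i, itg P (fun w => `|f i w| `^ qmin)) /\ Eavg P (fun i w => `|f i w| `^ qmin) <= 1 + C.
Proof.
move=> qq mf iq Eq; have i1 i : itg P (fun w => 1 + `|f i w| `^ q).
  by apply: itgD => //; exact: itg_cst.
have it i : itg P (fun w => `|f i w| `^ qmin).
  apply: (itg_le _ _ (i1 i)); first exact: measurable_absR.
  by move=> w; rewrite ger0_norm ?powR_ge0// powR_mono.
split=> //; apply: (@le_trans _ _ (Eavg P (fun i w => 1 + `|f i w| `^ q))).
  by apply: Eavg_le => // i w; rewrite powR_mono.
by rewrite EavgD//; [rewrite Eavg_cst// lerD2l|move=> i; exact: itg_cst].
Qed.

Let pair_facts (yt eps : 'I_n -> T -> R) : (forall i, measurable_fun setT (yt i)) ->
  (forall i, measurable_fun setT (eps i)) -> SM_pair P z Pd s yt eps C q2 delta Delta ->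
  [/\ (forall i, itg P (fun w => `|eps i w| `^ q2)) /\ Eavg P (fun i w => `|eps i w| `^ q2) <= C,
      (forall i, itg P (fun w => yt i w ^+ 2)) /\ Eavg P (fun i w => yt i w ^+ 2) <= C &
      forall j, (forall i, itg P (fun w => `|x i j w * eps i w| ^+ 3)) /\
         Eavg P (fun i w => `|x i j w * eps i w| ^+ 3) <= C].
Proof.
move=> myt meps [h _].
have mx i j : measurable_fun setT (x i j) by apply: adapted_meas; exact: ad_x.
pose t j := (Ebar P (fun i w => x i j w ^+ 2 * yt i w ^+ 2)%R
       + Ebar P (fun i w => `|x i j w ^+ 3 * eps i w ^+ 3|)%R
       + (Ebar P (fun i w => x i j w ^+ 2)%R)^-1)%E.
have t0 j : [/\ (0 <= Ebar P (fun i w => x i j w ^+ 2 * yt i w ^+ 2)%R)%E,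
   (0 <= Ebar P (fun i w => `|x i j w ^+ 3 * eps i w ^+ 3|)%R)%E &
   (0 <= (Ebar P (fun i w => x i j w ^+ 2)%R)^-1)%E].
  split; [apply: Ebar_ge0 => i w|apply: Ebar_ge0 => i w|].
  - exact: sq_mul_ge0.
  - exact: normr_ge0.
  - by rewrite inve_ge0; apply: Ebar_ge0 => i w; exact: sqr_ge0.
have big0 : (0 <= \big[maxe/0]_(j < p) t j)%E by exact: bigmax_ge_id.
have [|||h1 h2 h3] := sum3_le _ _ _ h.
- by apply: Ebar_ge0 => i w; exact: powR_ge0.
- by apply: Ebar_ge0 => i w; exact: sqr_ge0.
- exact: big0.
split.
- exact: (Ebar_bound n0 (fun i => measurable_absR q2 (meps i)) (fun i w => powR_ge0 _ _) h1).
- exact: (Ebar_bound n0 (fun i => measurable_funX 2 (myt i)) (fun i w => sqr_ge0 _) h2).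
move=> j; have [a0 b0 e0] := t0 j.
have tj : (t j <= C%:E)%E by apply: le_trans h3; exact: le_bigmax.
have [_ tb _] := sum3_le a0 b0 e0 tj.
have := @Ebar_bound _ _ _ P n n0 (fun i w => `|x i j w * eps i w| ^+ 3) C.
apply.
- by move=> i; apply: measurable_funX; apply: measurableT_comp => //; exact: measurable_funM.
- by move=> i w; rewrite exprn_ge0.
- move: tb; congr (_ <= _)%E; congr (Ebar P _); apply/funext => i; apply/funext => w.
  by rewrite -normrX exprMn.
Qed.

Let mv i : measurable_fun setT (v i). Proof. exact: adapted_meas (@ad_v i). Qed.
Let mze i : measurable_fun setT (ze i). Proof. exact: adapted_meas (@ad_ze i). Qed.
Let mvt i : measurable_fun setT (vt i). Proof. exact: adapted_meas (@ad_vt i). Qed.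
Let mzt i : measurable_fun setT (zt i). Proof. exact: adapted_meas (@ad_zt i). Qed.
Let mrm i : measurable_fun setT (rm i). Proof. exact: adapted_meas (@ad_rm i). Qed.
Let mrg i : measurable_fun setT (rg i). Proof. exact: adapted_meas (@ad_rg i). Qed.

Let pair1 := pair_facts my mze (let: And5 _ _ h _ _ := sm in h).
Let pair2 := pair_facts md mv (let: And5 _ _ _ h _ := sm in h).

Let qle1 : qmin <= q1. Proof. by rewrite /qmin ge_min lexx. Qed.
Let qle2 : qmin <= q2. Proof. by rewrite /qmin ge_min lexx orbT. Qed.

Let lift (f : 'I_n -> T -> R) :
  (forall i, itg P (fun w => `|f i w| `^ qmin)) /\ Eavg P (fun i w => `|f i w| `^ qmin) <= 1 + C ->
  (forall i, itg P (fun w => `|f i w| `^ qmin)) /\ Eavg P (fun i w => `|f i w| `^ qmin) <= momM.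
Proof. by move=> [h1 h2]; split=> //; apply: (le_trans h2); case: momM_bounds. Qed.

Let v_q1C : (forall i, itg P (fun w => `|v i w| `^ qmin)) /\ Eavg P (fun i w => `|v i w| `^ qmin) <= 1 + C.
Proof. by case: pair2 => [[h1 h2] _ _]; exact: (mono_q qle2). Qed.

Let ze_q1C : (forall i, itg P (fun w => `|ze i w| `^ qmin)) /\ Eavg P (fun i w => `|ze i w| `^ qmin) <= 1 + C.
Proof. by case: pair1 => [[h1 h2] _ _]; exact: (mono_q qle2). Qed.

Lemma v_q : (forall i, itg P (fun w => `|v i w| `^ qmin)) /\ Eavg P (fun i w => `|v i w| `^ qmin) <= momM.
Proof. exact: lift v_q1C. Qed.

Lemma ze_q : (forall i, itg P (fun w => `|ze i w| `^ qmin)) /\ Eavg P (fun i w => `|ze i w| `^ qmin) <= momM.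
Proof. exact: lift ze_q1C. Qed.

Lemma d_sq : (forall i, itg P (fun w => d i w ^+ 2)) /\ Eavg P (fun i w => d i w ^+ 2) <= C.
Proof. by case: pair2. Qed.

Lemma xv_cube j : (forall i, itg P (fun w => `|x i j w * v i w| ^+ 3)) /\
  Eavg P (fun i w => `|x i j w * v i w| ^+ 3) <= C.
Proof. by case: pair2. Qed.

Lemma xze_cube j : (forall i, itg P (fun w => `|x i j w * ze i w| ^+ 3)) /\
  Eavg P (fun i w => `|x i j w * ze i w| ^+ 3) <= C.
Proof. by case: pair1. Qed.

Let tilde_q1 : (forall i, itg P (fun w => `|vt i w| `^ q1 + `|zt i w| `^ q1)) /\
  Eavg P (fun i w => `|vt i w| `^ q1 + `|zt i w| `^ q1) <= C.
Proof.
case: aste => _ _ _ _ [_ _ h _]; apply: (Ebar_bound n0 _ _ h) => [i|i w].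
  exact: (measurable_funD (measurable_absR q1 (mvt i)) (measurable_absR q1 (mzt i))).
by rewrite addr_ge0 ?powR_ge0.
Qed.

Let part_q1 (f : 'I_n -> T -> R) : (forall i, measurable_fun setT (f i)) ->
  (forall i w, `|f i w| `^ q1 <= `|vt i w| `^ q1 + `|zt i w| `^ q1) ->
  (forall i, itg P (fun w => `|f i w| `^ q1)) /\ Eavg P (fun i w => `|f i w| `^ q1) <= C.
Proof.
move=> mf le; have [i1 e1] := tilde_q1.
have it i : itg P (fun w => `|f i w| `^ q1).
  by apply: (itg_le _ _ (i1 i)); [exact: measurable_absR|move=> w; rewrite ger0_norm ?powR_ge0].
by split=> //; apply: (le_trans _ e1); exact: Eavg_le.
Qed.

Lemma vt_q1 : (forall i, itg P (fun w => `|vt i w| `^ q1)) /\ Eavg P (fun i w => `|vt i w| `^ q1) <= C.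
Proof. by apply: (part_q1 mvt) => i w; rewrite lerDl powR_ge0. Qed.

Lemma zt_q1 : (forall i, itg P (fun w => `|zt i w| `^ q1)) /\ Eavg P (fun i w => `|zt i w| `^ q1) <= C.
Proof. by apply: (part_q1 mzt) => i w; rewrite lerDr powR_ge0. Qed.

Let vt_q1C : (forall i, itg P (fun w => `|vt i w| `^ qmin)) /\ Eavg P (fun i w => `|vt i w| `^ qmin) <= 1 + C.
Proof. by case: vt_q1 => h1 h2; exact: (mono_q qle1). Qed.

Let zt_q1C : (forall i, itg P (fun w => `|zt i w| `^ qmin)) /\ Eavg P (fun i w => `|zt i w| `^ qmin) <= 1 + C.
Proof. by case: zt_q1 => h1 h2; exact: (mono_q qle1). Qed.

Lemma vt_q : (forall i, itg P (fun w => `|vt i w| `^ qmin)) /\ Eavg P (fun i w => `|vt i w| `^ qmin) <= momM.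
Proof. exact: lift vt_q1C. Qed.

Lemma zt_q : (forall i, itg P (fun w => `|zt i w| `^ qmin)) /\ Eavg P (fun i w => `|zt i w| `^ qmin) <= momM.
Proof. exact: lift zt_q1C. Qed.

(** The conditions bound only second moments of the approximation errors directly. Each error is the
    difference of two residuals with higher moments, and inherits those at the cost of a factor
    [2 ^ qmin]. *)
Let diff_q (f a b : 'I_n -> T -> R) : (forall i, measurable_fun setT (f i)) ->
  (forall i w, f i w = a i w - b i w) ->
  (forall i, itg P (fun w => `|a i w| `^ qmin)) /\ Eavg P (fun i w => `|a i w| `^ qmin) <= 1 + C ->
  (forall i, itg P (fun w => `|b i w| `^ qmin)) /\ Eavg P (fun i w => `|b i w| `^ qmin) <= 1 + C ->
  (forall i, itg P (fun w => `|f i w| `^ qmin)) /\ Eavg P (fun i w => `|f i w| `^ qmin) <= momM.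
Proof.
move=> mf fE [ia Ea] [ib Eb].
have i1 i := itgZ (2 `^ qmin) (itgD (ia i) (ib i)).
have le i w : `|f i w| `^ qmin <= 2 `^ qmin * (`|a i w| `^ qmin + `|b i w| `^ qmin).
  by rewrite fE -(normrN (b i w)) powR_add.
have it i : itg P (fun w => `|f i w| `^ qmin).
  by apply: (itg_le _ _ (i1 i)); [exact: measurable_absR|move=> w; rewrite ger0_norm ?powR_ge0].
split=> //; apply: (le_trans (Eavg_le it i1 le)).
rewrite EavgZ; last by move=> i; exact: itgD.
rewrite EavgD//; apply: (@le_trans _ _ (2 `^ qmin * (2 + 2 * C))); last by case: momM_bounds => _ [].
by rewrite ler_wpM2l ?powR_ge0//; move: Ea Eb; lra.
Qed.

Lemma rm_q : (forall i, itg P (fun w => `|rm i w| `^ qmin)) /\ Eavg P (fun i w => `|rm i w| `^ qmin) <= momM.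
Proof. by apply: (diff_q mrm _ vt_q1C v_q1C) => i w; rewrite /vt addrC addKr. Qed.

Lemma rg_q : (forall i, itg P (fun w => `|rg i w| `^ qmin)) /\ Eavg P (fun i w => `|rg i w| `^ qmin) <= momM.
Proof. by apply: (diff_q mrg _ zt_q1C ze_q1C) => i w; rewrite /zt addrC addKr. Qed.

Lemma rm_sq : (forall i, itg P (fun w => rm i w ^+ 2)) /\
  Eavg P (fun i w => rm i w ^+ 2) <= (C * Num.sqrt (s / n%:R)) ^+ 2.
Proof.
case: aste => _ _ [_ _ _ h _] _ _; exact: (Ebar_bound n0 (fun i => measurable_funX 2 (mrm i)) (fun i w => sqr_ge0 _) h).
Qed.

Lemma rg_sq : (forall i, itg P (fun w => rg i w ^+ 2)) /\
  Eavg P (fun i w => rg i w ^+ 2) <= (C * Num.sqrt (s / n%:R)) ^+ 2.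
Proof.
case: aste => _ _ [_ _ _ _ h] _ _; exact: (Ebar_bound n0 (fun i => measurable_funX 2 (mrg i)) (fun i w => sqr_ge0 _) h).
Qed.

Lemma ze_orth i (f : T -> R) : itg P (fun w => f w * ze i w) ->
  measurable_fun (setT : set (g_sigma_algebraType (preims (z i) `|` preims (d i)))) f ->
  Ex P (fun w => f w * ze i w) = 0.
Proof.
move=> it mf; case: aste => [[h _] _ _ _ _].
apply: (cond_exp_zero_mul (G := sig_zd z d i)) => //; last exact: gen_sub.
by apply: gen_le => A [|]; apply: preims_le.
Qed.

Lemma v_orth i (h : Zt -> R) : measurable_fun setT h -> itg P (fun w => h (z i w) * v i w) ->
  Ex P (fun w => h (z i w) * v i w) = 0.
Proof.
move=> mh it; case: aste => [[_ hv] _ _ _ _].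
apply: (cond_exp_zero_mul (G := sig_z z i)) => //.
  by apply: gen_le; apply: preims_le.
by apply: gen_sub; apply: (measurableT_comp mh); exact: gen_meas.
Qed.

Lemma zd_zfun i (h : Zt -> R) : measurable_fun setT h ->
  measurable_fun (setT : set (g_sigma_algebraType (preims (z i) `|` preims (d i)))) (fun w => h (z i w)).
Proof. by move=> mh; apply: (measurableT_comp mh); apply: gen_meas => A; left. Qed.

Lemma zd_v i : measurable_fun (setT : set (g_sigma_algebraType (preims (z i) `|` preims (d i)))) (v i).
Proof.
apply: measurable_funB; last exact: zd_zfun.
by apply: gen_meas => A; right.
Qed.

Let itg_of_sq (f : T -> R) : measurable_fun setT f -> itg P (fun w => f w ^+ 2) -> itg P f.
Proof.
move=> mf i2; apply: (@itg_le _ _ _ _ (fun w => 1 + f w ^+ 2)) => //.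
  move=> w; rewrite -(real_normK (num_real (f w))).
  by have := sqr_ge0 (`|f w| - 1); nra.
by apply: itgD => //; exact: itg_cst.
Qed.

Let q4 := qmin_gt4.

Lemma vz_itg i : itg P (fun w => v i w ^+ 2 * ze i w ^+ 2).
Proof. by case: v_q => a1 _; case: ze_q => b1 _; exact: (row_itg q4 mv mze a1 b1). Qed.

Lemma vz_orth i : Ex P (fun w => v i w * ze i w) = 0.
Proof.
apply: ze_orth; last exact: zd_v.
apply: itg_of_sq; first exact: measurable_funM.
by under eq_fun do rewrite exprMn; exact: vz_itg.
Qed.

Lemma rmz_itg i : itg P (fun w => rm i w ^+ 2 * ze i w ^+ 2).
Proof. by case: rm_q => a1 _; case: ze_q => b1 _; exact: (row_itg q4 mrm mze a1 b1). Qed.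

Lemma rmz_orth i : Ex P (fun w => rm i w * ze i w) = 0.
Proof.
apply: ze_orth; last exact: (zd_zfun (mrerr bm0 mm)).
apply: itg_of_sq; first exact: measurable_funM.
by under eq_fun do rewrite exprMn; exact: rmz_itg.
Qed.

Lemma vrg_itg i : itg P (fun w => v i w ^+ 2 * rg i w ^+ 2).
Proof. by case: rg_q => a1 _; case: v_q => b1 _; exact: (row_itg q4 mv mrg b1 a1). Qed.

Lemma vrg_orth i : Ex P (fun w => v i w * rg i w) = 0.
Proof.
under eq_fun do rewrite mulrC.
apply: (v_orth (mrerr bg0 mg)).
apply: itg_of_sq; first by apply: measurable_funM => //; exact: mrg.
have := vrg_itg i; congr (itg P _); apply/funext => w.
by rewrite -exprMn; congr (_ ^+ 2); exact: mulrC.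
Qed.

Let itg_of_cube (f : T -> R) : measurable_fun setT f -> itg P (fun w => `|f w| ^+ 3) -> itg P f.
Proof.
move=> mf i3; apply: (@itg_le _ _ _ _ (fun w => 1 + `|f w| ^+ 3)) => //.
  move=> w; have [h|h] := leP `|f w| 1; first by rewrite (le_trans h)// lerDl exprn_ge0.
  apply: (@le_trans _ _ (`|f w| ^+ 3)); last by rewrite lerDr.
  by rewrite -[leLHS]expr1 ler_weXn2l// ltW.
by apply: itgD => //; exact: itg_cst.
Qed.

Let mx i j : measurable_fun setT (x i j). Proof. exact: adapted_meas (@ad_x i j). Qed.

Lemma xv_orth i j : Ex P (fun w => x i j w * v i w) = 0.
Proof.
apply: (v_orth (mPd j)); apply: itg_of_cube; first by apply: measurable_funM => //; exact: mx.
by case: (xv_cube j) => h _; exact: h.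
Qed.

Lemma xze_orth i j : Ex P (fun w => x i j w * ze i w) = 0.
Proof.
apply: ze_orth; last exact: (zd_zfun (mPd j)).
apply: itg_of_cube; first by apply: measurable_funM => //; exact: mx.
by case: (xze_cube j) => h _; exact: h.
Qed.

Lemma v_sq i : itg P (fun w => v i w ^+ 2) /\ c <= Ex P (fun w => v i w ^+ 2) <= C.
Proof.
case: sm => _ [_ _ /(_ i) h] _ _ _; have [W [[iv _ _ _] _]] := h.
split; first exact: iv.
have := @cond_exp_between_mul _ _ _ P (sig_x Pd z i) (fun w => v i w ^+ 2) (fun=> 1) c C.
have gm : sig_x Pd z i `<=` measurable.
  by apply: gen_le => A [j _]; apply: preims_le; exact: mx.
have gf (B : set R) : measurable B -> sig_x Pd z i ((fun=> 1) @^-1` B).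
  by move=> mB; apply: gen_sub => //; exact: measurable_cst.
move=> /(_ gm gf h (fun _ => ler01) (itg_cst P 1)).
have -> : (fun w => 1 * v i w ^+ 2) = (fun w => v i w ^+ 2) by apply/funext => w; rewrite mul1r.
by rewrite Ex_cst !mulr1; apply.
Qed.

(** The weight [v ^ 2] is known given [x] and [v], so the conditional variance bounds on [ze] can be
    integrated against it. *)
Lemma vz_bounds i : c * Ex P (fun w => v i w ^+ 2) <= Ex P (fun w => v i w ^+ 2 * ze i w ^+ 2) <=
  C * Ex P (fun w => v i w ^+ 2).
Proof.
case: sm => _ [_ /(_ i) h _] _ _ _; have [iv _] := v_sq i.
apply: (cond_exp_between_mul (G := sig_xv Pd z v i)) => //.
- by apply: gen_le => A [[j _]|]; apply: preims_le => //; exact: mx.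
- move=> B mB; apply: gen_sub => //; apply: measurable_funX.
  by apply: gen_meas => A; right.
- by move=> w; exact: sqr_ge0.
- exact: vz_itg.
Qed.

Lemma tilde_diff : `|Eavg P (fun i w => vt i w ^+ 2 * zt i w ^+ 2) - Eavg P (fun i w => v i w ^+ 2 * ze i w ^+ 2)| <= delta.
Proof.
case: aste => _ _ _ _ [h _ _ _]; rewrite -lee_fin.
have [a1 _] := vt_q; have [b1 _] := zt_q.
have e1 := Ebar_itgE (fun i => row_itg q4 mvt mzt a1 b1 i).
have e2 := Ebar_itgE vz_itg.
by move: h; rewrite e1 e2.
Qed.

End ModelFacts.

(** * Rates *)

Section Rates.
Context {R : realType}.

(* The truncation level [K = root8 n] serves in every moment bound below: with
   [4 < q], both [K ^+ 2 / sqrt n] and [K `^ (4 - q)] tend to 0. *)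
Definition root8 (n : nat) : R := Num.sqrt (Num.sqrt (Num.sqrt n%:R)).

Lemma root8_ge0 n : 0 <= root8 n. Proof. exact: sqrtr_ge0. Qed.

Lemma root8_gt0 n : (0 < n)%N -> 0 < root8 n.
Proof. by move=> n0; rewrite !sqrtr_gt0 ltr0n. Qed.

Lemma root8_sq n : root8 n ^+ 2 = Num.sqrt (Num.sqrt n%:R).
Proof. by rewrite sqr_sqrtr ?sqrtr_ge0. Qed.

Lemma root8_pow4 n : root8 n ^+ 4 = Num.sqrt n%:R.
Proof. by rewrite (exprM _ 2 2) root8_sq sqr_sqrtr ?sqrtr_ge0. Qed.

Lemma root8_pow8 n : root8 n ^+ 8 = n%:R.
Proof. by rewrite (exprM _ 4 2) root8_pow4 sqr_sqrtr. Qed.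

Lemma powR_root8 n : (n%:R : R) `^ (- 4^-1) = (root8 n ^+ 2)^-1.
Proof.
rewrite powRN; congr (_^-1); rewrite root8_sq -!powR12_sqrt ?powR_ge0// -powRrM.
by congr (_ `^ _); field.
Qed.

Lemma cvgy_sqrt (u : nat -> R) : u n @[n --> \oo] --> +oo -> Num.sqrt (u n) @[n --> \oo] --> +oo.
Proof.
move=> h; apply/cvgryPge => A; have /cvgryPge/(_ (A ^+ 2)) := h.
apply: filterS => n hn; apply: (le_trans (ler_norm A)); rewrite -sqrtr_sqr.
exact: ler_wsqrtr.
Qed.

Lemma root8_cvgy : root8 n @[n --> \oo] --> +oo.
Proof. by do 3!apply: cvgy_sqrt; exact: cvgr_idn. Qed.

Lemma cvgyV (u : nat -> R) : u n @[n --> \oo] --> +oo -> (u n)^-1 @[n --> \oo] --> 0.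
Proof.
move=> h; have h0 : \forall n \near \oo, 0 < u n by have /cvgryPgt/(_ 0) := h.
by have /(gtr0_cvgV0 h0) := h.
Qed.

Lemma root8V_cvg : (root8 n)^-1 @[n --> \oo] --> 0.
Proof. by apply: cvgyV; exact: root8_cvgy. Qed.

Lemma powR_cvg0 (u : nat -> R) (a : R) : a < 0 -> u n @[n --> \oo] --> +oo ->
  u n `^ a @[n --> \oo] --> 0.
Proof.
move=> a0 h; have na : 0 < - a by rewrite oppr_gt0.
have -> : (fun n => u n `^ a) = (fun n => (u n `^ (- a))^-1).
  by apply/funext => n; rewrite powRN invrK.
apply: cvgyV; apply/cvgryPge => A.
have /cvgryPge/(_ (`|A| `^ (- a)^-1)) := h; apply: filterS => n hn.
apply: (le_trans (ler_norm A)).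
have -> : `|A| = (`|A| `^ (- a)^-1) `^ (- a) by rewrite -powRrM mulVf ?gt_eqF// powRr1.
by apply: ge0_ler_powR; rewrite ?nnegrE ?powR_ge0 ?(ltW na)// (le_trans _ hn)// powR_ge0.
Qed.

End Rates.

(** * Calculus of vanishing quantities along a filter *)

Section Limits.
Context {R : realType} {T0 : Type} {F : set_system T0} {FF : Filter F}.
Implicit Types X Y : T0 -> R.

Lemma cvg0_sqrt X : X x @[x --> F] --> 0 -> Num.sqrt (X x) @[x --> F] --> 0.
Proof.
move=> h; rewrite -[X in _ --> X]sqrtr0.
by apply: (cvg_comp X (@Num.sqrt R) h); exact: sqrt_continuous.
Qed.

Lemma cvg0_le X Y : (\forall x \near F, `|X x| <= Y x) -> Y x @[x --> F] --> 0 -> X x @[x --> F] --> 0.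
Proof.
move=> h cY; apply/cvgrPdist_le => e e0; have /cvgrPdist_le/(_ _ e0) hY := cY.
apply: filterS2 h hY => x h1; rewrite !sub0r !normrN => h2.
by apply: (le_trans h1); exact: ler_normlW.
Qed.

Lemma cvg0_of_sq X : X x ^+ 2 @[x --> F] --> 0 -> X x @[x --> F] --> 0.
Proof.
move=> h; apply: (cvg0_le _ (cvg0_sqrt h)).
by apply: nearW => x; rewrite sqrtr_sqr.
Qed.

Lemma cvg0M X Y : X x @[x --> F] --> 0 -> Y x @[x --> F] --> 0 -> X x * Y x @[x --> F] --> 0.
Proof. by move=> hX hY; rewrite -[X in _ --> X](mulr0 0); exact: cvgM. Qed.

Lemma cvg0Z X (k : R) : X x @[x --> F] --> 0 -> k * X x @[x --> F] --> 0.
Proof. by move=> hX; rewrite -[X in _ --> X](mulr0 k); apply: cvgM => //; exact: cvg_cst. Qed.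

Lemma cvg0D X Y : X x @[x --> F] --> 0 -> Y x @[x --> F] --> 0 -> X x + Y x @[x --> F] --> 0.
Proof. by move=> hX hY; rewrite -[X in _ --> X](addr0 0); exact: cvgD. Qed.

Lemma cvg0_near_le X (e : R) : 0 < e -> X x @[x --> F] --> 0 -> \forall x \near F, `|X x| <= e.
Proof.
by move=> e0 /cvgrPdist_le/(_ _ e0); apply: filterS => x; rewrite sub0r normrN.
Qed.

Lemma cvg0_bounded X Y (B : R) : X x @[x --> F] --> 0 -> (\forall x \near F, `|Y x| <= B) ->
  X x * Y x @[x --> F] --> 0.
Proof.
move=> hX hY; apply: (@cvg0_le _ (fun x => B * `|X x|)).
  by apply: filterS hY => x h; rewrite normrM mulrC ler_wpM2r.
by apply: cvg0Z; rewrite -[X in _ --> X](normr0 R); exact: cvg_norm.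
Qed.

(** The identity [f ^ 2 = g ^ 2 + 2 (f - g) g + (f - g) ^ 2]. The target [u] may vary without
    converging, as the average variances do; an upper bound keeps [g] bounded. *)
Lemma cvg0_sq_transfer (f g u : T0 -> R) (B : R) : f x - g x @[x --> F] --> 0 ->
  g x ^+ 2 - u x @[x --> F] --> 0 -> (\forall x \near F, u x <= B) -> f x ^+ 2 - u x @[x --> F] --> 0.
Proof.
move=> hfg hg hu.
have e x : f x ^+ 2 - u x = ((f x - g x) * (f x - g x) + 2 * ((f x - g x) * g x)) + (g x ^+ 2 - u x) by ring.
under eq_fun do rewrite e.
apply: cvg0D => //; apply: cvg0D; first exact: cvg0M.
apply: cvg0Z; apply: (cvg0_bounded (B := 1 + (1 + B))) => //.
apply: filterS2 (cvg0_near_le ltr01 hg) hu => x h1 h2.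
have : g x ^+ 2 <= 1 + B by move: h1; rewrite ler_norml => /andP[_]; lra.
rewrite -(real_normK (num_real (g x))) => h3; apply: le_trans (_ : 1 + `|g x| ^+ 2 <= _); last by lra.
have := sqr_ge0 (`|g x| - 1); nra.
Qed.

Lemma cvg_ratio (u w : T0 -> R) (c : R) : 0 < c -> (\forall x \near F, c <= u x) ->
  w x - u x @[x --> F] --> 0 -> u x / w x @[x --> F] --> (1 : R).
Proof.
move=> c0 hu hw; have c2 : 0 < c / 2 by rewrite divr_gt0.
suff h : 1 - u x / w x @[x --> F] --> 0.
  have -> : (fun x => u x / w x) = (fun x => 1 - (1 - u x / w x)) by apply/funext => x; rewrite subKr.
  by rewrite -[X in _ --> X](subr0 1); apply: cvgB => //; exact: cvg_cst.
apply: (@cvg0_le _ (fun x => 2 / c * `|w x - u x|)); last first.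
  by apply: cvg0Z; rewrite -[X in _ --> X](normr0 R); exact: cvg_norm.
apply: filterS2 (cvg0_near_le c2 hw) hu => x h1 h2.
have wc : c / 2 <= w x by move: h1; rewrite ler_norml => /andP[]; lra.
have w0 : 0 < w x by apply: lt_le_trans wc.
have -> : 1 - u x / w x = (w x - u x) / w x by rewrite mulrBl divff// gt_eqF.
rewrite normrM mulrC ler_wpM2r// normfV ger0_norm ?(ltW w0)//.
by rewrite -[leRHS]invf_div lef_pV2 ?posrE.
Qed.

End Limits.

(** * Maximal inequality over all regressors *)

Section Bernstein.
Context {dT : measure_display} {T : measurableType dT} {R : realType}.
Variable P : probability T R.
Variable n p : nat.
Hypothesis n0 : (0 < n)%N.
Variables (e : 'I_p -> 'I_n -> T -> R) (C : R).
Hypothesis C0 : 0 <= C.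
Let L : R := ln (maxn p n)%:R.
Let K : R := 2 * C + 3.
Hypothesis L0 : 0 < L.
Hypothesis Ln : L <= n%:R.
Hypothesis me : forall j i, measurable_fun setT (e j i).
Hypothesis ind : forall j (f : R -> R), measurable_fun setT f -> iRV P n (ext (fun i w => f (e j i w))).
Hypothesis i3 : forall j i, itg P (fun w => `|e j i w| ^+ 3).
Hypothesis E3 : forall j, Eavg P (fun i w => `|e j i w| ^+ 3) <= C.
Hypothesis e0 : forall j i, Ex P (e j i) = 0.

Let tr (x : R) : R := x * (`|x| <= Num.sqrt (n%:R / L))%R%:R.

Let mtr : measurable_fun setT tr.
Proof.
apply: measurable_funM => //; apply: (measurableT_comp (f := fun x : bool => x%:R : R)) => //.
by apply: measurable_fun_ler => //; exact: measurableT_comp.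
Qed.

Let trN x : tr (- x) = - tr x. Proof. by rewrite /tr normrN mulNr. Qed.

Let bad (s : R) (j : 'I_p) : set T := [set w | K * Num.sqrt (n%:R * L) <= \sum_(i < n) s * tr (e j i w)].

Let mbad s j : measurable (bad s j).
Proof.
rewrite /bad -[Y in measurable Y]setTI; apply: measurable_fun_le => //.
by apply: measurable_sum => i; apply: measurable_funM => //; apply: measurableT_comp mtr _; exact: me.
Qed.

Let Pbad j : (P (bad 1 j) <= (expR (- (2 * L)))%:E)%E /\ (P (bad (-1) j) <= (expR (- (2 * L)))%:E)%E.
Proof.
split.
- have := @row_chernoff _ _ _ P n n0 (fun i w => e j i w) C L K C0 L0 Ln erefl (me j).
  move=> /(_ (ind j mtr) (i3 j) (E3 j) (e0 j)); congr (P _ <= _)%E.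
  by apply/seteqP; split=> w /=; congr (_ <= _); apply: eq_bigr => i _; rewrite mul1r.
- have := @row_chernoff _ _ _ P n n0 (fun i w => - e j i w) C L K C0 L0 Ln erefl.
  have mN i : measurable_fun setT (fun w => - e j i w) by exact: measurableT_comp.
  have nN i : (fun w => `|- e j i w| ^+ 3) = (fun w => `|e j i w| ^+ 3).
    by apply/funext => w; rewrite normrN.
  have mf : measurable_fun setT (fun x : R => tr (- x)) by exact: measurableT_comp mtr _.
  have iN i : itg P (fun w => `|- e j i w| ^+ 3) by rewrite nN.
  have EN : Eavg P (fun i w => `|- e j i w| ^+ 3) <= C.
    by move: (E3 j); congr (Eavg P _ <= _); apply/funext => i; rewrite nN.
  have e0N i : Ex P (fun w => - e j i w) = 0.
    have ii : itg P (e j i).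
      apply: (@itg_le _ _ _ _ (fun w => 1 + `|e j i w| ^+ 3)) => //; last first.
        by apply: itgD => //; exact: itg_cst.
      move=> w; have [h|h] := leP `|e j i w| 1; first by rewrite (le_trans h)// lerDl exprn_ge0.
      apply: (@le_trans _ _ (`|e j i w| ^+ 3)); last by rewrite lerDr.
      by rewrite -[leLHS]expr1 ler_weXn2l// ltW.
    by rewrite ExN// e0 oppr0.
  move=> /(_ mN (ind j mf) iN EN e0N).
  congr (P _ <= _)%E; apply/seteqP; split=> w /=; congr (_ <= _);
    by apply: eq_bigr => i _; rewrite mulN1r -trN.
Qed.

(* On the event, nothing is truncated, so the exponential bound for the truncated
   sums applies to the sums themselves; [2 * p * exp (- 2 L) <= 2 / n]. *)
Lemma bernstein_union : exists A : set T, [/\ measurable A, (P A >= (1 - 2 / n%:R)%:E)%E &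
  forall w, A w -> forall j, (forall i, `|e j i w| <= Num.sqrt (n%:R / L)) ->
    `|avg (fun i => e j i w)| <= K * Num.sqrt (L / n%:R)].
Proof.
pose B : set T := \big[setU/set0]_(j < p) (bad 1 j `|` bad (-1) j).
have np : 0 < (n%:R : R) by rewrite ltr0n.
have [mB PB] : measurable B /\ (P B <= (2 / n%:R)%:E)%E.
  suff [mB PB] : measurable B /\ (P B <= \sum_(j < p) (2 * expR (- (2 * L)))%:E)%E.
    split=> //; apply: (le_trans PB).
    rewrite sumEFin sumr_const card_ord lee_fin -[leLHS]mulr_natl mulrCA ler_wpM2l//.
    have M0 : 0 < ((maxn p n)%:R : R) by rewrite ltr0n leq_max n0 orbT.
    rewrite expRN expRM_natl /L lnK ?posrE// ler_pdivrMr ?exprn_gt0// ler_pdivlMl//.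
    by rewrite expr2 -natrM -natrM ler_nat mulnC leq_mul// ?leq_maxl ?leq_maxr.
  apply: (big_ind2 (fun B (x : \bar R) => measurable B /\ (P B <= x)%E)).
  - by rewrite measure0.
  - move=> B1 x1 B2 x2 [m1 h1] [m2 h2]; split; first exact: measurableU.
    by apply: (le_trans (measureU2 P m1 m2)); exact: leeD.
  - move=> j _; split; first exact: measurableU.
    apply: (le_trans (measureU2 P (mbad 1 j) (mbad (-1) j))).
    by rewrite mulr_natl mulr2n EFinD; have [h1 h2] := Pbad j; exact: leeD.
exists (~` B); split; first exact: measurableC.
  rewrite probability_setC// -(@fineK _ (P B)) ?fin_num_measure// -EFinB lee_fin lerB//.
  by rewrite -lee_fin fineK ?fin_num_measure.
move=> w Bw j h.
have nb s : s = 1 \/ s = -1 -> \sum_(i < n) s * e j i w < K * Num.sqrt (n%:R * L).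
  move=> hs; rewrite ltNge; apply/negP => h'; apply: Bw; rewrite /B (bigD1 j)//=; left.
  have b : bad s j w.
    rewrite /bad /= (eq_bigr (fun i => s * e j i w)) // => i _.
    by rewrite /tr h mulr1.
  by case: hs b => ->; [left|right].
have h1 := nb 1 (or_introl erefl); have h2 := nb (-1) (or_intror erefl).
rewrite -mulr_sumr mul1r in h1; rewrite -mulr_sumr mulN1r in h2.
have -> : K * Num.sqrt (L / n%:R) = n%:R^-1 * (K * Num.sqrt (n%:R * L)).
  rewrite mulrCA; congr (_ * _).
  rewrite (_ : L / n%:R = n%:R ^- 2 * (n%:R * L)); last by field; rewrite gt_eqF.
  by rewrite sqrtrM ?invr_ge0 ?exprn_ge0// -exprVn sqrtr_sqr ger0_norm// invr_ge0.
rewrite /avg normrM ger0_norm ?invr_ge0 ?ler0n// ler_wpM2l ?invr_ge0 ?ler0n//.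
by rewrite ler_norml; move: h1 h2; lra.
Qed.

End Bernstein.

(** * Limit theorems for arrays *)

Section Arrays.
Context {R : realType} (dT : nat -> measure_display) (T : forall n, measurableType (dT n)).
Variable P : forall n, probability (T n) R.
Variables q M : R.
Hypothesis q4 : 4 < q.
Implicit Types a b : forall n, 'I_n -> T n -> R.

Definition moments a : Prop := forall n, (0 < n)%N ->
  [/\ forall i, measurable_fun setT (a n i), forall i, itg (P n) (fun w => `|a n i w| `^ q) &
      Eavg (P n) (fun i w => `|a n i w| `^ q) <= M].

(** The quantifier over [f] covers the squares of the law of large numbers and the normalization of
    the central limit theorem without a separate argument. *)
Definition independent_rows a : Prop := forall n (f : R -> R), (0 < n)%N -> measurable_fun setT f ->
  iRV (P n) n (ext (fun i w => f (a n i w))).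

Definition orthogonal_rows a b : Prop := forall n i, (0 < n)%N -> Ex (P n) (fun w => a n i w * b n i w) = 0.

Let pos : \forall n \near \oo, (0 < n)%N. Proof. exact: nbhs_infty_gt. Qed.

Let root8_decay : (root8 n : R) `^ (4 - q) @[n --> \oo] --> 0.
Proof. by apply: powR_cvg0; [rewrite subr_lt0|exact: root8_cvgy]. Qed.

Let fE a b n i : (fun w => a n i w ^+ 2 * b n i w ^+ 2) = (fun w => (a n i w * b n i w) ^+ 2).
Proof. by apply/funext => w; rewrite exprMn. Qed.

Lemma array_lln a b : moments a -> moments b -> independent_rows (fun n i w => a n i w * b n i w) ->
  avg (fun i => a _ i (projT2 x) ^+ 2 * b _ i (projT2 x) ^+ 2) -
    Eavg (P (projT1 x)) (fun i w => a _ i w ^+ 2 * b _ i w ^+ 2) @[x --> whp P] --> 0.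
Proof.
move=> ha hb hi.
pose D n w := `|avg (fun i => a n i w ^+ 2 * b n i w ^+ 2) - Eavg (P n) (fun i w => a n i w ^+ 2 * b n i w ^+ 2)|.
have key n : (0 < n)%N -> itg (P n) (D n) /\ Ex (P n) (D n) <=
    (root8 n)^-1 * (root8 n)^-1 * (2 + 3 * M) + root8 n `^ (4 - q) * (4 * M).
  move=> n0; have [ma ia Ea] := ha n n0; have [mb ib Eb] := hb n n0.
  have ind : iRV (P n) n (ext (fun i w => a n i w ^+ 2 * b n i w ^+ 2)).
    have := hi n (fun x => x ^+ 2) n0 (measurable_funX 2 (@measurable_id _ _ setT)).
    by congr (iRV _ _ (ext _)); apply/funext => i; rewrite fE.
  have [h1 h2] := row_lln n0 q4 ma mb ia ib Ea Eb (root8_gt0 n0) ind.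
  split=> //; apply: (le_trans h2); rewrite le_eqVlt; apply/orP; left; apply/eqP.
  (* At [K = root8 n] the ratio [K ^ 2 / sqrt n] is [root8 n ^ -2]. *)
  congr (_ * _ + _); rewrite -root8_pow4.
  by have := @root8_gt0 R n n0; move: (root8 n) => r r0; field; rewrite gt_eqF.
apply: (whp_squeeze (Y := fun x => D (projT1 x) (projT2 x))).
  by apply: nearW => x.
apply: whp_markov => [n w||]; first exact: normr_ge0.
  by apply: filterS pos => n n0; case: (key n n0).
apply: (@cvg0_le _ _ _ _ _ (fun n => (root8 n)^-1 * (root8 n)^-1 * (2 + 3 * M) + root8 n `^ (4 - q) * (4 * M))).
  apply: filterS pos => n n0; have [_ h] := key n n0; rewrite ger0_norm//.
  by apply: Ex_ge0 => w; exact: normr_ge0.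
apply: cvg0D.
  rewrite (_ : (fun _ => _) = (fun n => (2 + 3 * M) * ((root8 n)^-1 * (root8 n)^-1))).
    by apply: cvg0Z; apply: cvg0M; exact: root8V_cvg.
  by apply/funext => n; rewrite mulrC.
rewrite (_ : (fun _ => _) = (fun n => (4 * M) * root8 n `^ (4 - q))).
  exact: cvg0Z.
by apply/funext => n; rewrite mulrC.
Qed.

Let var_key a b : moments a -> moments b -> independent_rows (fun n i w => a n i w * b n i w) ->
  orthogonal_rows a b -> forall n, (0 < n)%N ->
  itg (P n) (fun w => (Num.sqrt n%:R * ip (fun i => a n i w) (fun i => b n i w)) ^+ 2) /\
  Ex (P n) (fun w => (Num.sqrt n%:R * ip (fun i => a n i w) (fun i => b n i w)) ^+ 2) =
  Eavg (P n) (fun i w => a n i w ^+ 2 * b n i w ^+ 2).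
Proof.
move=> ha hb hi ho n n0; have [ma ia Ea] := ha n n0; have [mb ib Eb] := hb n n0.
apply: (row_var n0) => [|i|i]; [|exact: (row_itg q4 ma mb ia ib)|exact: ho].
exact: (hi n id n0 (@measurable_id _ _ setT)).
Qed.

(** Centred independent terms make the second moment an average, which [row_cross] bounds at level
    [root8 n]; it is enough that the mean square of [b] is [o(n ^ (- 1/4))]. *)
Lemma array_ip0 a b : moments a -> moments b -> independent_rows (fun n i w => a n i w * b n i w) ->
  orthogonal_rows a b ->
  root8 n ^+ 2 * Eavg (P n) (fun i w => b n i w ^+ 2) @[n --> \oo] --> 0 ->
  Num.sqrt (projT1 x)%:R * ip (fun i => a _ i (projT2 x)) (fun i => b _ i (projT2 x)) @[x --> whp P] --> 0.
Proof.
move=> ha hb hi ho hE; apply: cvg0_of_sq.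
apply: (whp_markov (X := fun n w => (Num.sqrt n%:R * ip (fun i => a n i w) (fun i => b n i w)) ^+ 2)).
- by move=> n w; exact: sqr_ge0.
- by apply: filterS pos => n n0; case: (var_key ha hb hi ho n0).
apply: (@cvg0_le _ _ _ _ _ (fun n => root8 n ^+ 2 * Eavg (P n) (fun i w => b n i w ^+ 2) +
    (2 * M) * root8 n `^ (4 - q))); last by apply: cvg0D => //; exact: cvg0Z.
apply: filterS pos => n n0; have [ma ia Ea] := ha n n0; have [mb ib Eb] := hb n n0.
have [_ ->] := var_key ha hb hi ho n0.
rewrite ger0_norm; last by apply: Eavg_ge0 => i w; exact: sq_mul_ge0.
by rewrite [2 * M * _]mulrC; exact: (row_cross q4 ma mb ia ib Ea Eb (root8_gt0 n0)).
Qed.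

(** The variance is merely bounded. Dividing by [root8 n] turns boundedness in probability into a
    limit, at a loss that later steps can afford. *)
Lemma array_ip_root8 a b : moments a -> moments b -> independent_rows (fun n i w => a n i w * b n i w) ->
  orthogonal_rows a b ->
  (root8 (projT1 x))^-1 * (Num.sqrt (projT1 x)%:R * ip (fun i => a _ i (projT2 x)) (fun i => b _ i (projT2 x)))
    @[x --> whp P] --> 0.
Proof.
move=> ha hb hi ho; apply: cvg0_of_sq.
pose S n w := (Num.sqrt n%:R * ip (fun i => a n i w) (fun i => b n i w)) ^+ 2.
pose X n w := ((root8 n)^-1 * (Num.sqrt n%:R * ip (fun i => a n i w) (fun i => b n i w))) ^+ 2.
have XE n : X n = (fun w => (root8 n)^-1 ^+ 2 * S n w) by apply/funext => w; rewrite /X exprMn.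
apply: (whp_markov (X := X)).
- by move=> n w; exact: sqr_ge0.
- by apply: filterS pos => n n0; rewrite XE; apply: itgZ; case: (var_key ha hb hi ho n0).
apply: (@cvg0_le _ _ _ _ _ (fun n => (1 + 3 * M) * ((root8 n)^-1 * (root8 n)^-1))).
  apply: filterS pos => n n0; have [ma ia Ea] := ha n n0; have [mb ib Eb] := hb n n0.
  have [iS ES] := var_key ha hb hi ho n0.
  rewrite XE ExZ// ES ger0_norm.
    rewrite mulrC -expr2 ler_wpM2r ?sqr_ge0//; exact: (row_sq_bound n0 q4 ma mb ia ib Ea Eb).
  by rewrite mulr_ge0 ?sqr_ge0//; apply: Eavg_ge0 => i w; exact: sq_mul_ge0.
by apply: cvg0Z; apply: cvg0M; exact: root8V_cvg.
Qed.

Lemma array_clt a b (c2 : R) : 0 < c2 -> moments a -> moments b ->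
  independent_rows (fun n i w => a n i w * b n i w) -> orthogonal_rows a b ->
  (forall n i, (0 < n)%N -> Ex (P n) (fun w => a n i w ^+ 2 * b n i w ^+ 2) <= M) ->
  (forall n, (0 < n)%N -> c2 <= Eavg (P n) (fun i w => a n i w ^+ 2 * b n i w ^+ 2)) ->
  forall u : R, fine (P n [set w | Num.sqrt n%:R * ip (fun i => a n i w) (fun i => b n i w) /
     Num.sqrt (Eavg (P n) (fun i w => a n i w ^+ 2 * b n i w ^+ 2)) <= u]) @[n --> \oo] --> Phi u.
Proof.
move=> c20 ha hb hi ho hM hc u; apply/cvgrPdist_le => eta eta0.
have [e0 e00 clt] := clt_uniform u eta0.
pose lind n := (root8 n)^-1 * (root8 n)^-1 * (Num.sqrt c2)^-1 +
  (c2^-1 * (2 * M)) * root8 n `^ (4 - q) + (M ^+ 2 / c2 ^+ 2) * ((root8 n)^-1 * (root8 n)^-1).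
have cl : lind n @[n --> \oo] --> 0.
  have rr : (root8 n)^-1 * (root8 n)^-1 @[n --> \oo] --> (0 : R) by apply: cvg0M; exact: root8V_cvg.
  apply: cvg0D; last exact: cvg0Z.
  apply: cvg0D; last exact: cvg0Z.
  rewrite (_ : (fun _ => _) = (fun n => (Num.sqrt c2)^-1 * ((root8 n)^-1 * (root8 n)^-1))).
    exact: cvg0Z.
  by apply/funext => n; rewrite mulrC.
have r1 : \forall n \near \oo, 1 <= (root8 n : R) by have /cvgryPge/(_ 1) := @root8_cvgy R.
apply: filterS3 pos r1 (cvg0_near_le e00 cl) => n n0 r1 ln.
have [ma ia Ea] := ha n n0; have [mb ib Eb] := hb n n0.
set sg := Eavg (P n) _; have sg0 : 0 < sg by apply: lt_le_trans (hc n n0).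
have np : 0 < (n%:R : R) by rewrite ltr0n.
have ns0 : 0 < Num.sqrt (n%:R * sg) by rewrite sqrtr_gt0 mulr_gt0.
pose X i w := a n i w * b n i w / Num.sqrt (n%:R * sg).
have iab i := row_itg q4 ma mb ia ib i.
have X2 i : (fun w => X i w ^+ 2) = (fun w => (n%:R * sg)^-1 * (a n i w ^+ 2 * b n i w ^+ 2)).
  by apply/funext => w; rewrite /X !exprMn exprVn sqr_sqrtr ?(ltW (mulr_gt0 _ _))// mulrC.
have iX2 i : itg (P n) (fun w => X i w ^+ 2) by rewrite X2; exact: itgZ.
have EX0 i : Ex (P n) (X i) = 0.
  have iab1 : itg (P n) (fun w => a n i w * b n i w).
    apply: (@itg_le _ _ _ _ (fun w => 1 + a n i w ^+ 2 * b n i w ^+ 2)).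
    - exact: measurable_funM.
    - move=> w; rewrite -exprMn -(real_normK (num_real (a n i w * b n i w))).
      by have := sqr_ge0 (`|a n i w * b n i w| - 1); nra.
    - by apply: itgD => //; exact: itg_cst.
  rewrite (_ : X i = (fun w => (Num.sqrt (n%:R * sg))^-1 * (a n i w * b n i w))).
    by rewrite ExZ// ho// mulr0.
  by apply/funext => w; rewrite /X mulrC.
have s1 : \sum_(i < n) Ex (P n) (fun w => X i w ^+ 2) = 1.
  rewrite (eq_bigr (fun i => (n%:R * sg)^-1 * Ex (P n) (fun w => a n i w ^+ 2 * b n i w ^+ 2))).
    rewrite -mulr_sumr [X in _ * X](_ : _ = n%:R * sg); last first.
      by rewrite /sg /Eavg /avg mulrA divff ?mul1r// gt_eqF.
    by rewrite mulVf// gt_eqF// mulr_gt0.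
  by move=> i _; rewrite X2 ExZ.
have := clt _ _ (P n) n (ext X) _ _ _ _ _; rewrite distrC.
rewrite (_ : [set w | \sum_(i < n) ext X i w <= u] = [set w | Num.sqrt n%:R * ip (fun i => a n i w)
  (fun i => b n i w) / Num.sqrt sg <= u]); last first.
  have r0 : 0 < Num.sqrt (n%:R : R) by rewrite sqrtr_gt0.
  have s0 : 0 < Num.sqrt sg by rewrite sqrtr_gt0.
  have e w : \sum_(i < n) ext X i w = Num.sqrt n%:R * ip (fun i => a n i w) (fun i => b n i w) / Num.sqrt sg.
    rewrite (ext_sum X (fun Y => Y w)) /X -mulr_suml /ip /avg sqrtrM ?ler0n//.
    have -> : (n%:R : R)^-1 = (Num.sqrt n%:R)^-1 ^+ 2 by rewrite exprVn sqr_sqrtr// ltW.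
    move: (\sum_(i < n) _) (Num.sqrt n%:R) (Num.sqrt sg) r0 s0 => A r s r0 s0.
    by field; rewrite !gt_eqF.
  by apply/seteqP; split=> w /=; rewrite e.
apply.
- have := hi n (fun x => x / Num.sqrt (n%:R * sg)) n0; apply.
  by apply: measurable_funM => //; exact: measurable_id.
- exact: (ext_lt (Q := fun Y : T n -> R => itg (P n) (fun w => Y w ^+ 2))).
- exact: (ext_lt (Q := fun Y : T n -> R => Ex (P n) Y = 0)).
- by rewrite (ext_sum X (fun Y => Ex (P n) (fun w => Y w ^+ 2))).
rewrite (ext_sum X (fun Y => Ex (P n) (fun w => Num.min (Y w ^+ 2) (`|Y w| ^+ 3)) + Ex (P n) (fun w => Y w ^+ 2) ^+ 2)).
have := row_clt_sum n0 q4 (root8_gt0 n0) c20 (hc n n0) ma mb ia ib Ea Eb (fun i => hM n i n0) erefl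
  (fun i w => erefl (X i w)).
move=> h; apply: (le_trans h); apply: le_trans (le_trans (ler_norm _) ln); rewrite /lind.
rewrite -(@root8_pow8 R n) sqrtrM ?exprn_ge0 ?root8_ge0//.
have -> : Num.sqrt (root8 n ^+ 8 : R) = root8 n ^+ 4 by rewrite root8_pow8 -root8_pow4.
have sc0 : 0 < Num.sqrt c2 by rewrite sqrtr_gt0.
have rg0 := @root8_gt0 R n n0.
apply: lerD; last first.
  rewrite invfM mulrA ler_wpM2l//; first by rewrite divr_ge0 ?sqr_ge0.
  by rewrite -invfM lef_pV2 ?posrE ?mulr_gt0 ?exprn_gt0// -expr2 ler_weXn2l.
rewrite le_eqVlt; apply/orP; left; apply/eqP.
move: (root8 n `^ _) (Num.sqrt c2) sc0 => A sc sc0; move: rg0; move: (root8 n) => r r0.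
by field; rewrite !gt_eqF.
Qed.

End Arrays.

(** * Asymptotics of the post-double-selection estimator *)

(** One term of order [q] is at most the sum of all. Replacing [A ^ (2 / q)] by [1 + A] keeps the
    bound linear in the empirical moment, so that Markov's inequality applies to it. *)
Lemma sup_of_avg {R : realType} n (f : 'I_n -> R) (q : R) (i : 'I_n) : 2 <= q ->
  f i ^+ 2 <= n%:R `^ (2 / q) * (1 + avg (fun i => `|f i| `^ q)).
Proof.
move=> q2; have q0 : 0 < q by apply: lt_le_trans q2.
have n0 : (0 < n)%N by case: i => i /=; case: n f => // f.
have np : 0 < (n%:R : R) by rewrite ltr0n.
set A := avg _; have A0 : 0 <= A by apply: avg_ge0 => k; exact: powR_ge0.
have h1 : `|f i| `^ q <= n%:R * A.
  rewrite /A /avg mulrA divff ?gt_eqF// mul1r (bigD1 i)//= lerDl.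
  by apply: sumr_ge0 => k _; exact: powR_ge0.
have -> : f i ^+ 2 = (`|f i| `^ q) `^ (2 / q).
  by rewrite -powRrM mulrC divfK ?gt_eqF// powR_mulrn// real_normK ?num_real.
have e0 : 0 <= 2 / q by rewrite divr_ge0// ltW.
apply: (@le_trans _ _ ((n%:R * A) `^ (2 / q))).
  by apply: ge0_ler_powR; rewrite ?nnegrE ?powR_ge0// mulr_ge0// ltW.
rewrite powRM ?(ltW np)// ler_wpM2l ?powR_ge0//.
have := @powR_mono R A (2 / q) 1 A0 e0; rewrite powRr1//; apply.
by rewrite ler_pdivrMr// mul1r.
Qed.

Section Assembly.
Context {R : realType} {dZ : measure_display} {Zt : measurableType dZ}
  (dT : nat -> measure_display) (T : forall n, measurableType (dT n)).
Unset Implicit Arguments.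
Variables (P : forall n, probability (T n) R) (p : nat -> nat)
  (y d : forall n, 'I_n -> T n -> R) (z : forall n, 'I_n -> T n -> Zt)
  (Pd : forall n, Zt -> 'I_(p n) -> R) (alpha0 : nat -> R) (g m : nat -> Zt -> R)
  (s : nat -> R) (bm0 bg0 : forall n, 'I_(p n) -> R) (I1 I2 I3 : forall n, T n -> {set 'I_(p n)})
  (ac : forall n, T n -> R) (bc bh : forall n, T n -> 'I_(p n) -> R)
  (c C q1 q2 kap1 kap2 : R) (ell delta Delta : nat -> R).
Hypothesis hcC : 0 < c < C.
Hypothesis hkap : 0 < kap1 < kap2.
Hypothesis hell_lim : ell n @[n --> \oo] --> +oo.
Hypothesis hdelta_pos : forall n, 0 < delta n.
Hypothesis hdelta_lim : delta n @[n --> \oo] --> 0.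
Hypothesis hDelta_lim : Delta n @[n --> \oo] --> 0.
Hypothesis hy_meas : forall n i, measurable_fun setT (y n i).
Hypothesis hd_meas : forall n i, measurable_fun setT (d n i).
Hypothesis hz_meas : forall n i, measurable_fun setT (z n i).
Hypothesis hPd_meas : forall n j, measurable_fun setT (fun zz => Pd n zz j).
Hypothesis hg_meas : forall n, measurable_fun setT (g n).
Hypothesis hm_meas : forall n, measurable_fun setT (m n).
Hypothesis hI1_meas : forall n S, measurable [set w | I1 n w = S].
Hypothesis hI2_meas : forall n S, measurable [set w | I2 n w = S].
Hypothesis hI3_meas : forall n S, measurable [set w | I3 n w = S].
Hypothesis hac_meas : forall n, measurable_fun setT (ac n).
Hypothesis hbc_meas : forall n j, measurable_fun setT (fun w => bc n w j).
Hypothesis hbh_meas : forall n j, measurable_fun setT (fun w => bh n w j).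
Hypothesis hindep : forall n, mutually_independent (P n) (sig_omega (y n) (d n) (z n)).
Hypothesis hASTE : forall n, ASTE (P n) (y n) (d n) (z n) (Pd n) (alpha0 n) (g n) (m n)
  (s n) (bm0 n) (bg0 n) (I1 n) (I2 n) (I3 n) C q1 (delta n) (Delta n).
Hypothesis hSM : forall n, SM (P n) (y n) (d n) (z n) (Pd n) (alpha0 n) (g n) (m n)
  (s n) c C q2 (delta n) (Delta n).
Hypothesis hSE : forall n, SE (P n) (z n) (Pd n) (s n) kap1 kap2 (ell n) (Delta n).
Hypothesis hHLMS : forall n, HLMS (P n) (z n) (Pd n) (g n) (m n) (s n) (I1 n) (I2 n) (I3 n)
  C (delta n) (Delta n).
Hypothesis hcheck : forall n, is_pds_estimator (y n) (d n) (z n) (Pd n)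
  (fun w => I1 n w :|: I2 n w :|: I3 n w) (ac n) (bc n).
Hypothesis hhat : forall n, is_d_projection (d n) (z n) (Pd n)
  (fun w => I1 n w :|: I2 n w :|: I3 n w) (bh n).

Let ze n := zeta (y n) (d n) (z n) (alpha0 n) (g n).
Let v n := vres (d n) (z n) (m n).
Let rm n := rerr (Pd n) (z n) (m n) (bm0 n).
Let rg n := rerr (Pd n) (z n) (g n) (bg0 n).
Let vt n i w := v n i w + rm n i w.
Let zt n i w := ze n i w + rg n i w.
Let xx n i j w := Pd n (z n i w) j.
Let L n : R := ln (maxn (p n) n)%:R.
Let F : set_system {n & T n} := whp P.
Let FF : Filter F := whp_filter P.
#[local] Existing Instance FF.
Let q := qmin q1 q2.
Let M := momM C q1 q2.
Let rt (x : {n & T n}) : R := root8 (projT1 x).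
Let sx (x : {n & T n}) : R := s (projT1 x).

Definition row (a : forall n, 'I_n -> T n -> R) (x : {n & T n}) : 'I_(projT1 x) -> R :=
  fun i => a (projT1 x) i (projT2 x).

Set Implicit Arguments.

Let c0 : 0 < c. Proof. by case/andP: hcC. Qed.
Let C0 : 0 < C. Proof. by case/andP: hcC => ? ?; lra. Qed.
Let kap0 : 0 < kap1. Proof. by case/andP: hkap. Qed.
Let q4 : 4 < q. Proof. exact: (qmin_gt4 (hASTE 0) (hSM 0)). Qed.
Let q14 : 4 < q1. Proof. exact: (q1_gt4 (hASTE 0)). Qed.
Let pos : \forall n \near \oo, (0 < n)%N. Proof. exact: nbhs_infty_gt. Qed.
Let posx : \forall x \near F, (0 < projT1 x)%N. Proof. exact: whp_near pos. Qed.
Let rt0 n : (0 < n)%N -> 0 < (root8 n : R). Proof. exact: root8_gt0. Qed.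
Let s1 n : 1 <= s n. Proof. by case: (hASTE n) => _ _ []. Qed.
Let rtV : (rt x)^-1 @[x --> F] --> 0.
Proof. by apply: (whp_seq P (u := fun n => (root8 n)^-1)); exact: root8V_cvg. Qed.
Let dx : delta (projT1 x) @[x --> F] --> 0.
Proof. exact: (whp_seq P hdelta_lim). Qed.

Let adapted_rows (a : forall n, 'I_n -> T n -> R) := forall n i, adapted (y n) (d n) (z n) i (a n i).

Let ad_ind a b : adapted_rows a -> adapted_rows b -> independent_rows P (fun n i w => a n i w * b n i w).
Proof.
move=> ha hb n f n0 mf; apply: (adapted_iRV (@hy_meas n) (@hd_meas n) (@hz_meas n) (@hindep n)) => i.
exact: (measurableT_comp mf (measurable_funM (ha n i) (hb n i))).
Qed.

Let a_v : adapted_rows v. Proof. by move=> n i; exact: (@ad_v _ _ _ _ _ _ _ _ _ _ (hm_meas n)). Qed.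
Let a_ze : adapted_rows ze. Proof. by move=> n i; apply: ad_ze. Qed.
Let a_rm : adapted_rows rm. Proof. by move=> n i; apply: ad_rm. Qed.
Let a_rg : adapted_rows rg. Proof. by move=> n i; apply: ad_rg. Qed.
Let a_vt : adapted_rows vt. Proof. by move=> n i; apply: ad_vt. Qed.
Let a_zt : adapted_rows zt. Proof. by move=> n i; apply: ad_zt. Qed.
Let a_one : adapted_rows (fun n i w => 1). Proof. by move=> n i; exact: measurable_cst. Qed.

Let ad_m a : adapted_rows a -> forall n i, measurable_fun setT (a n i).
Proof. by move=> ha n i; exact: (adapted_meas (@hy_meas n) (@hd_meas n) (@hz_meas n) (ha n i)). Qed.

Let mom_v : moments P q M v.
Proof.
move=> n n0; have [] := v_q n0 C0 (@hy_meas n) (@hd_meas n) (@hz_meas n) (@hPd_meas n) (hm_meas n) (hASTE n) (hSM n).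
by split=> //; exact: (ad_m a_v).
Qed.
Let mom_ze : moments P q M ze.
Proof.
move=> n n0; have [] := ze_q n0 C0 (@hy_meas n) (@hd_meas n) (@hz_meas n) (@hPd_meas n) (hg_meas n) (hASTE n) (hSM n).
by split=> //; exact: (ad_m a_ze).
Qed.
Let mom_rm : moments P q M rm.
Proof.
move=> n n0; have [] := rm_q n0 C0 (@hy_meas n) (@hd_meas n) (@hz_meas n) (@hPd_meas n) (hg_meas n) (hm_meas n) (hASTE n) (hSM n).
by split=> //; exact: (ad_m a_rm).
Qed.
Let mom_rg : moments P q M rg.
Proof.
move=> n n0; have [] := rg_q n0 C0 (@hy_meas n) (@hd_meas n) (@hz_meas n) (@hPd_meas n) (hg_meas n) (hm_meas n) (hASTE n) (hSM n).
by split=> //; exact: (ad_m a_rg).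
Qed.
Let mom_vt : moments P q M vt.
Proof.
move=> n n0; have [] := vt_q n0 C0 (@hy_meas n) (@hd_meas n) (@hz_meas n) (@hPd_meas n) (hg_meas n) (hm_meas n) (hASTE n) (hSM n).
by split=> //; exact: (ad_m a_vt).
Qed.
Let mom_zt : moments P q M zt.
Proof.
move=> n n0; have [] := zt_q n0 C0 (@hy_meas n) (@hd_meas n) (@hz_meas n) (@hPd_meas n) (hg_meas n) (hm_meas n) (hASTE n) (hSM n).
by split=> //; exact: (ad_m a_zt).
Qed.
Let mom_one : moments P q M (fun n i w => 1).
Proof.
move=> n n0; have e : (fun w : T n => `|1 : R| `^ q) = fun=> 1 by apply/funext => w; rewrite normr1 powR1.
split=> [i|i|]; [exact: measurable_cst|by rewrite e; exact: itg_cst|].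
rewrite (_ : (fun (i : 'I_n) w => _) = fun _ _ => 1); last by apply/funext => i; rewrite e.
by rewrite Eavg_cst//; have [h _] := momM_bounds q1 q2 C0; move: h C0; rewrite /M; lra.
Qed.

(* [rho] is the rate s log(p \/ n) / sqrt n of Condition ASTE(iv). *)
Let rho n : R := s n * L n / Num.sqrt n%:R.

Let L1 : \forall n \near \oo, 1 <= L n.
Proof.
apply: filterS2 pos (@nbhs_infty_ger R (expR 1)) => n n0 hn.
have M0 : 0 < ((maxn (p n) n)%:R : R) by rewrite ltr0n leq_max n0 orbT.
rewrite /L -[leLHS](expRK 1) ler_ln ?posrE ?expR_gt0//.
by apply: (le_trans hn); rewrite ler_nat leq_maxr.
Qed.

Let rho_sq n : (0 < n)%N -> rho n ^+ 2 <= delta n.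
Proof.
move=> n0; case: (hASTE n) => _ _ _ [h _] _; apply: le_trans h.
by rewrite /rho !exprMn exprVn sqr_sqrtr.
Qed.

Let rho0 : rho n @[n --> \oo] --> 0.
Proof.
apply: cvg0_of_sq; apply: (cvg0_le _ hdelta_lim).
by apply: filterS pos => n n0; rewrite ger0_norm ?sqr_ge0// rho_sq.
Qed.

Let s_rho : \forall n \near \oo, s n <= rho n * Num.sqrt n%:R.
Proof.
apply: filterS2 pos L1 => n n0 l1.
have r0 : 0 < Num.sqrt (n%:R : R) by rewrite sqrtr_gt0 ltr0n.
by rewrite /rho divfK ?gt_eqF// ler_peMr// (le_trans _ (s1 n)).
Qed.

Let Ln : \forall n \near \oo, L n <= n%:R.
Proof.
apply: filterS3 pos L1 (cvg0_near_le ltr01 hdelta_lim) => n n0 l1 d1.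
have np : 0 < (n%:R : R) by rewrite ltr0n.
have : L n ^+ 2 <= n%:R.
  case: (hASTE n) => _ _ _ [h _] _; move: h; rewrite ler_pdivrMr// => h.
  have h2 : s n ^+ 2 * L n ^+ 2 <= n%:R.
    apply: (le_trans h); rewrite -[leRHS]mul1r ler_wpM2r ?(ltW np)//.
    exact: le_trans (ler_norm _) d1.
  apply: le_trans h2; rewrite ler_peMl ?sqr_ge0//.
  by rewrite -[leLHS](expr1n _ 2) lerXn2r ?nnegrE// (le_trans _ (s1 n)).
by apply: le_trans; rewrite expr2 ler_peMr// (le_trans _ l1).
Qed.

(** Converts the events of the conditions, whose probability is at least [1 - D n] with [D]
    vanishing, into statements along [whp]. *)
Let ev_exists (Q : {n & T n} -> Prop) (D : nat -> R) : D n @[n --> \oo] --> (0 : R) ->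
  (\forall n \near \oo, exists A : set (T n), [/\ measurable A, (P n A >= (1 - D n)%:E)%E &
     forall w, A w -> Q (existT _ n w)]) -> \forall x \near F, Q x.
Proof.
move=> D0 hA eta eta0; have /cvgrPdist_le/(_ _ eta0) De := D0.
apply: filterS2 hA De => n [A [mA PA hA]] De; exists A; split=> //.
rewrite probability_setC//; move: PA; rewrite -(@fineK _ (P n A)) ?fin_num_measure//.
rewrite !lee_fin => PA; move: De; rewrite sub0r normrN => /ler_normlW; lra.
Qed.

(** The weights [u] provide either the rate, when the moment bound [K] is small, or the vanishing
    factor, when it is only bounded. *)
Let markov_avg (f : forall n, 'I_n -> T n -> R) (u K : nat -> R) :
  (forall n i w, 0 <= f n i w) -> (forall n, 0 <= u n) ->
  (forall n, (0 < n)%N -> (forall i, itg (P n) (f n i)) /\ Eavg (P n) (f n) <= K n) ->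
  u n * K n @[n --> \oo] --> 0 -> u (projT1 x) * avg (row f x) @[x --> F] --> 0.
Proof.
move=> f0 u0 hf hu; apply: (whp_markov (X := fun n w => u n * avg (fun i => f n i w))).
- by move=> n w; apply: mulr_ge0 => //; exact: avg_ge0.
- by apply: filterS pos => n n0; have [i1 _] := hf n n0; apply: itgZ; case: (Eavg_avg i1).
apply: (cvg0_le _ hu); apply: filterS pos => n n0; have [i1 h] := hf n n0.
have [i2 e] := Eavg_avg i1; rewrite ExZ// e ger0_norm ?ler_wpM2l//.
by apply: mulr_ge0 => //; exact: Eavg_ge0.
Qed.

(** * Maxima of residuals and regressors, and uniform bounds for the scores *)

Let Aq (a : forall n, 'I_n -> T n -> R) (x : {n & T n}) : R := avg (fun i => `|row a x i| `^ q1).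

Let q1_moments (a : forall n, 'I_n -> T n -> R) := forall n, (0 < n)%N ->
  (forall i, itg (P n) (fun w => `|a n i w| `^ q1)) /\ Eavg (P n) (fun i w => `|a n i w| `^ q1) <= C.

Let small_moments (r : forall n, 'I_n -> T n -> R) := forall n, (0 < n)%N ->
  (forall i, itg (P n) (fun w => r n i w ^+ 2)) /\
  Eavg (P n) (fun i w => r n i w ^+ 2) <= (C * Num.sqrt (s n / n%:R)) ^+ 2.

Let smallE n : (0 < n)%N -> (C * Num.sqrt (s n / n%:R)) ^+ 2 = C ^+ 2 * (s n / n%:R).
Proof.
by move=> n0; rewrite exprMn sqr_sqrtr// divr_ge0// (le_trans _ (s1 n)).
Qed.

Let Aq_small a : q1_moments a -> forall u : nat -> R, (forall n, 0 <= u n) -> u n @[n --> \oo] --> 0 ->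
  u (projT1 x) * (1 + Aq a x) @[x --> F] --> 0.
Proof.
move=> ha u u0 hu.
have -> : (fun x => u (projT1 x) * (1 + Aq a x)) = (fun x => u (projT1 x) + u (projT1 x) * Aq a x).
  by apply/funext => x; rewrite mulrDr mulr1.
apply: cvg0D; first exact: (whp_seq P hu).
apply: (markov_avg (f := fun n i w => `|a n i w| `^ q1) (K := fun=> C)) => //.
apply: (cvg0_le _ (cvg0Z C hu)); apply: nearW => n.
by rewrite ger0_norm ?mulr_ge0 ?(ltW C0)// mulrC.
Qed.

(** A bound for the squared maximum of a row, measured in units of [sqrt n]. It vanishes since the
    exponent [2 / q1 - 1 / 2] is negative for [q1 > 4]. *)
Let U (a : forall n, 'I_n -> T n -> R) x : R :=
  (projT1 x)%:R `^ (2 / q1) / Num.sqrt (projT1 x)%:R * (1 + Aq a x).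

Let U0 a : q1_moments a -> U a x @[x --> F] --> 0.
Proof.
move=> ha; apply: (Aq_small ha (u := fun n => n%:R `^ (2 / q1) / Num.sqrt n%:R)).
  by move=> n; rewrite divr_ge0 ?powR_ge0 ?sqrtr_ge0.
have h : (n%:R : R) `^ (2 / q1 - 2^-1) @[n --> \oo] --> 0.
  apply: powR_cvg0; last exact: cvgr_idn.
  have q10 : 0 < q1 by apply: lt_trans q14.
  by rewrite subr_lt0 ltr_pdivrMr// ltr_pdivlMl//; move: q14; lra.
apply: (cvg0_le _ h); apply: filterS pos => n n0.
have np : (n%:R : R) != 0 by rewrite pnatr_eq0 -lt0n.
rewrite ger0_norm ?divr_ge0 ?powR_ge0 ?sqrtr_ge0//.
by rewrite powRD; [rewrite powRN powR12_sqrt|rewrite np implybT].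
Qed.

Let row_sup a x i : (0 < projT1 x)%N -> row a x i ^+ 2 <= rt x ^+ 4 * U a x.
Proof.
move=> n0; have qq : 2 <= q1 by move: q14; lra.
apply: (le_trans (sup_of_avg (row a x) i qq)).
have r0 : 0 < Num.sqrt ((projT1 x)%:R : R) by rewrite sqrtr_gt0 ltr0n.
by rewrite /U /rt root8_pow4 mulrA mulrCA divff ?gt_eqF// mulr1.
Qed.

(** The mean square is at most [C ^ 2 * s / n], and [s = o(sqrt n)] makes it [o(n ^ (- 1/2))]; the
    norm itself is thus [o(n ^ (- 1/4))]. *)
Let nrm_small r : small_moments r -> rt x ^+ 2 * nrm (row r x) @[x --> F] --> 0.
Proof.
move=> hr.
have h : Num.sqrt (projT1 x)%:R * avg (fun i => row r x i ^+ 2) @[x --> F] --> 0.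
  apply: (markov_avg (f := fun n i w => r n i w ^+ 2) (u := fun n => Num.sqrt n%:R)
    (K := fun n => (C * Num.sqrt (s n / n%:R)) ^+ 2)) => //.
    by move=> n i w; exact: sqr_ge0.
  apply: (cvg0_le _ (cvg0Z (C ^+ 2) rho0)); apply: filterS2 pos s_rho => n n0 sr.
  have np : 0 < Num.sqrt (n%:R : R) by rewrite sqrtr_gt0 ltr0n.
  rewrite /= ger0_norm ?mulr_ge0 ?sqr_ge0 ?(ltW np) ?(ltW C0)// smallE// mulrCA ler_wpM2l ?sqr_ge0//.
  rewrite -[X in _ / X](sqr_sqrtr (ler0n R n)) mulrA ler_pdivrMr ?exprn_gt0//.
  by rewrite expr2 mulrA [leLHS]mulrC ler_wpM2r ?(ltW np).
apply: (cvg0_le _ (cvg0_sqrt h)); apply: nearW => x.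
rewrite ger0_norm; last by rewrite mulr_ge0 ?sqr_ge0 ?nrm_ge0.
by rewrite sqrtrM ?sqrtr_ge0// /rt root8_sq.
Qed.

Let X2 (x : {n & T n}) : R := maxx2 (Pd (projT1 x)) (z (projT1 x)) (projT2 x).

Let ev_x : \forall x \near F, X2 x * sx x * (projT1 x)%:R `^ (2 / q1) <=
  delta (projT1 x) * Num.sqrt (projT1 x)%:R.
Proof.
apply: (ev_exists hDelta_lim); apply: filterS pos => n n0.
have [_ _ _ _ [_ _ _ h]] := hASTE n.
exists [set w | maxx2 (Pd n) (z n) w * s n * (n%:R `^ (- 2^-1 + 2 / q1)) <= delta n]; split => //.
  apply: measurable_set_le; apply: measurable_funM => //; apply: measurable_funM => //.
  exact: (measurable_maxx2 (hz_meas n) (hPd_meas n)).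
move=> w /=; have np : (n%:R : R) != 0 by rewrite pnatr_eq0 -lt0n.
have r0 : 0 < Num.sqrt (n%:R : R) by rewrite sqrtr_gt0 ltr0n.
rewrite powRD ?np ?implybT// powRN powR12_sqrt// [_^-1 * _]mulrC mulrA ler_pdivrMr//.
Qed.

Let x_small : \forall x \near F, X2 x * sx x <= delta (projT1 x) * rt x ^+ 4.
Proof.
apply: filterS2 ev_x posx => x h n0; rewrite /rt root8_pow4; apply: le_trans h.
have X0 : 0 <= X2 x * sx x.
  by rewrite mulr_ge0 ?(le_trans _ (s1 _))//; exact: bigmax_ge_id.
rewrite ler_peMr// -[leLHS](powRr0 (projT1 x)%:R) ler_powR ?ler1n//.
by rewrite divr_ge0//; move: q14; lra.
Qed.

(* The moments of order [q1] bound [max_i |e_i + r_i|], Condition ASTE(v) bounds [max_ij |x_ij|]. *)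
Let trunc e r : q1_moments (fun n i w => e n i w + r n i w) -> small_moments r ->
  \forall x \near F, forall j i, `|xx (projT1 x) i j (projT2 x) * row e x i| <=
    Num.sqrt ((projT1 x)%:R / L (projT1 x)).
Proof.
move=> he hr; set et := fun n i w => _ in he.
have h1 := Aq_small he (fun n => ltW (hdelta_pos n)) hdelta_lim.
(* For [r] the maximum is simply bounded by the sum of squares. The factor [n / s] is exactly
   compensated by the mean square [C ^ 2 * s / n], and [delta] makes the product vanish. *)
have h2 : (delta (projT1 x) * ((projT1 x)%:R / sx x)) * avg (fun i => row r x i ^+ 2) @[x --> F] --> 0.
  apply: (markov_avg (f := fun n i w => r n i w ^+ 2) (u := fun n => delta n * (n%:R / s n))
    (K := fun n => (C * Num.sqrt (s n / n%:R)) ^+ 2)) => //.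
  - by move=> n i w; exact: sqr_ge0.
  - by move=> n; rewrite mulr_ge0 ?divr_ge0 ?(ltW (hdelta_pos n))// (le_trans _ (s1 n)).
  apply: (cvg0_le _ (cvg0Z (C ^+ 2) hdelta_lim)); apply: filterS pos => n n0.
  have s0 : 0 < s n by apply: lt_le_trans (s1 n).
  have np : 0 < (n%:R : R) by rewrite ltr0n.
  rewrite /= ger0_norm; last by rewrite mulr_ge0 ?sqr_ge0// mulr_ge0 ?divr_ge0 ?(ltW (hdelta_pos n))// ltW.
  rewrite smallE// le_eqVlt; apply/orP; left; apply/eqP.
  by field; rewrite !gt_eqF.
(* The value 1/4 leaves room for two such terms and for the factor 2 in the splitting [b3]. *)
have q0 : 0 < 4^-1 :> R by [].
pose proof (filterI (filterI (cvg0_near_le q0 h1) (cvg0_near_le q0 h2)) (filterI posx x_small)) as near1.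
pose proof (filterI ev_x (whp_near P (filterI L1 (cvg0_near_le ltr01 rho0)))) as near2.
apply: filterS2 near1 near2 => x [[a1 a2] [n0 xs]] [ex [l1 r1]] j i.
move: a1 a2 n0 xs ex l1 r1; rewrite /X2 /sx /rt root8_pow4; case: x j i => n w /= j i.
set A := Aq _ _; set B := avg _; set Xm := maxx2 _ _ _ => a1 a2 n0 xs ex l1 r1.
have np : 0 < (n%:R : R) by rewrite ltr0n.
have sn : 0 < Num.sqrt (n%:R : R) by rewrite sqrtr_gt0.
have snn : Num.sqrt (n%:R : R) ^+ 2 = n%:R by rewrite sqr_sqrtr// ltW.
have L0 : 0 < L n by apply: lt_le_trans l1.
have s0 : 0 < s n by apply: lt_le_trans (s1 n).
have Xm0 : 0 <= Xm by exact: bigmax_ge_id.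
have A0 : 0 <= A by apply: avg_ge0 => k; exact: powR_ge0.
have B0 : 0 <= B by apply: avg_ge0 => k; exact: sqr_ge0.
rewrite -(@ler_pXn2r _ 2) ?nnegrE ?sqrtr_ge0// sqr_sqrtr ?divr_ge0 ?(ltW L0) ?(ltW np)//.
rewrite real_normK ?num_real// exprMn ler_pdivlMr//.
have xj : xx n i j w ^+ 2 <= Xm by rewrite -(real_normK (num_real (xx n i j w))); exact: maxx2_ge.
have b1 : (e n i w + r n i w) ^+ 2 <= n%:R `^ (2 / q1) * (1 + A).
  have qq : 2 <= q1 by move: q14; lra.
  exact: (sup_of_avg (row et (existT _ n w)) i qq).
have b2 : r n i w ^+ 2 <= n%:R * B.
  rewrite /B /avg mulrA divff ?gt_eqF// mul1r /row /= (bigD1 i)//= lerDl.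
  by apply: sumr_ge0 => k _; exact: sqr_ge0.
(* The moments of order [q1] are those of [e + r], so [e] is controlled through this sum and [r]
   separately. *)
have b3 : e n i w ^+ 2 <= 2 * ((e n i w + r n i w) ^+ 2 + r n i w ^+ 2).
  by have := sqr_ge0 (e n i w + 2 * r n i w); nra.
have k1 : Xm * (n%:R `^ (2 / q1) * (1 + A)) <= Num.sqrt n%:R * 4^-1.
  apply: (@le_trans _ _ (delta n * Num.sqrt n%:R * (1 + A))).
    rewrite mulrA ler_wpM2r ?addr_ge0//; apply: le_trans ex.
    by rewrite ler_wpM2r ?powR_ge0// ler_peMr.
  rewrite mulrAC mulrC ler_wpM2l ?(ltW sn)//; exact: le_trans (ler_norm _) a1.
have k2 : Xm * (n%:R * B) <= Num.sqrt n%:R * 4^-1.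
  apply: (@le_trans _ _ (Num.sqrt n%:R * (delta n * (n%:R / s n) * B))); last first.
    by rewrite ler_wpM2l ?(ltW sn)//; exact: le_trans (ler_norm _) a2.
  have -> : Xm * (n%:R * B) = (Xm * s n) * ((n%:R / s n) * B) by field; rewrite gt_eqF.
  have -> : Num.sqrt n%:R * (delta n * (n%:R / s n) * B) = delta n * Num.sqrt n%:R * (n%:R / s n * B).
    by ring.
  by rewrite ler_wpM2r// mulr_ge0 ?divr_ge0 ?(ltW s0) ?(ltW np).
(* The two products add up to at most [sqrt n]; as [L <= sqrt n] as well, this is below [n / L], the
   squared truncation level. *)
have k3 : L n <= Num.sqrt n%:R.
  have : s n * L n <= Num.sqrt n%:R.
    by move: r1; rewrite /rho => r1; have := le_trans (ler_norm _) r1; rewrite ler_pdivrMr// mul1r.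
  by apply: le_trans; rewrite ler_peMl// ltW.
apply: (@le_trans _ _ (Num.sqrt n%:R * L n)); last by rewrite -[leRHS]snn expr2 ler_wpM2l// ltW.
rewrite ler_wpM2r ?(ltW L0)//.
apply: (@le_trans _ _ (Xm * (2 * ((e n i w + r n i w) ^+ 2 + r n i w ^+ 2)))).
  by apply: ler_pM; rewrite ?sqr_ge0.
have : Xm * (e n i w + r n i w) ^+ 2 <= Xm * (n%:R `^ (2 / q1) * (1 + A)) by rewrite ler_wpM2l.
have : Xm * r n i w ^+ 2 <= Xm * (n%:R * B) by rewrite ler_wpM2l.
rewrite [leLHS]mulrCA mulrDr; move: k1 k2; lra.
Qed.

Let Kb : R := 2 * C + 3.

Let nV0 : 2 / n%:R @[n --> \oo] --> (0 : R).
Proof. by apply: cvg0Z; apply: cvgyV; exact: cvgr_idn. Qed.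

Let bern e r : adapted_rows e -> q1_moments (fun n i w => e n i w + r n i w) -> small_moments r ->
  (forall n j, (0 < n)%N -> (forall i, itg (P n) (fun w => `|xx n i j w * e n i w| ^+ 3)) /\
    Eavg (P n) (fun i w => `|xx n i j w * e n i w| ^+ 3) <= C) ->
  (forall n j i, (0 < n)%N -> Ex (P n) (fun w => xx n i j w * e n i w) = 0) ->
  \forall x \near F, forall j, `|ip (fun i => xx (projT1 x) i j (projT2 x)) (row e x)| <=
    Kb * Num.sqrt (L (projT1 x) / (projT1 x)%:R).
Proof.
move=> ae he hr hc ho.
pose Q (x : {n & T n}) := forall j, (forall i, `|xx (projT1 x) i j (projT2 x) * row e x i| <=
  Num.sqrt ((projT1 x)%:R / L (projT1 x))) ->
  `|ip (fun i => xx (projT1 x) i j (projT2 x)) (row e x)| <= Kb * Num.sqrt (L (projT1 x) / (projT1 x)%:R).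
have hQ : \forall x \near F, Q x.
  apply: (ev_exists nV0); apply: filterS3 pos L1 Ln => n n0 l1 ln.
  have L0 : 0 < L n by apply: lt_le_trans l1.
  have ad j i : adapted (y n) (d n) (z n) i (fun w => xx n i j w * e n i w).
    by apply: measurable_funM; [exact: (ad_x (hPd_meas n))|exact: ae].
  have := @bernstein_union _ _ _ (P n) n (p n) n0 (fun j i w => xx n i j w * e n i w) C (ltW C0) L0 ln.
  apply.
  - by move=> j i; exact: (adapted_meas (@hy_meas n) (@hd_meas n) (@hz_meas n) (ad j i)).
  - move=> j f mf; apply: (adapted_iRV (@hy_meas n) (@hd_meas n) (@hz_meas n) (@hindep n)) => i.
    exact: (measurableT_comp mf (ad j i)).
  - by move=> j; case: (hc n j n0).
  - by move=> j; case: (hc n j n0).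
  - by move=> j i; exact: ho.
by apply: filterS2 hQ (trunc he hr) => x hQ ht j; apply: hQ.
Qed.

Let sm_rm : small_moments rm.
Proof. by move=> n n0; exact: (rm_sq n0 (@hy_meas n) (@hd_meas n) (@hz_meas n) (@hPd_meas n) (hm_meas n) (hASTE n)). Qed.
Let sm_rg : small_moments rg.
Proof. by move=> n n0; exact: (rg_sq n0 (@hy_meas n) (@hd_meas n) (@hz_meas n) (@hPd_meas n) (hg_meas n) (hASTE n)). Qed.
Let q1_vt : q1_moments vt.
Proof. by move=> n n0; exact: (vt_q1 n0 (@hy_meas n) (@hd_meas n) (@hz_meas n) (@hPd_meas n) (hg_meas n) (hm_meas n) (hASTE n)). Qed.
Let q1_zt : q1_moments zt.
Proof. by move=> n n0; exact: (zt_q1 n0 (@hy_meas n) (@hd_meas n) (@hz_meas n) (@hPd_meas n) (hg_meas n) (hm_meas n) (hASTE n)). Qed.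

Let bern_v : \forall x \near F, forall j, `|ip (fun i => xx (projT1 x) i j (projT2 x)) (row v x)| <=
    Kb * Num.sqrt (L (projT1 x) / (projT1 x)%:R).
Proof.
apply: (bern a_v q1_vt sm_rm) => n j; last move=> i; move=> n0.
  exact: (xv_cube n0 (@hy_meas n) (@hd_meas n) (@hz_meas n) (@hPd_meas n) (hm_meas n) (hSM n) j).
exact: (xv_orth n0 (@hy_meas n) (@hd_meas n) (@hz_meas n) (@hPd_meas n) (hm_meas n) (hASTE n) (hSM n) i j).
Qed.

Let bern_ze : \forall x \near F, forall j, `|ip (fun i => xx (projT1 x) i j (projT2 x)) (row ze x)| <=
    Kb * Num.sqrt (L (projT1 x) / (projT1 x)%:R).
Proof.
apply: (bern a_ze q1_zt sm_rg) => n j; last move=> i; move=> n0.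
  exact: (xze_cube n0 (@hy_meas n) (@hd_meas n) (@hz_meas n) (@hPd_meas n) (hg_meas n) (hSM n) j).
exact: (xze_orth n0 (@hy_meas n) (@hd_meas n) (@hz_meas n) (@hPd_meas n) (hg_meas n) (hASTE n) (hSM n) i j).
Qed.

(* [kx] bounds the sparsity of every coefficient vector that occurs. *)
Let kx x : R := (1 + C) * sx x.
Let lam x : R := Kb * Num.sqrt (L (projT1 x) / (projT1 x)%:R) * Num.sqrt (kx x / kap1).
(** One level above four sources of error: the scores on sparse vectors, the quality of the
    selection, and the two approximation errors. *)
Let tau x : R := lam x + 2 * delta (projT1 x) * (rt x ^+ 2)^-1 + nrm (row rm x) + nrm (row rg x).

Let kx0 x : 0 <= kx x.
Proof. by rewrite mulr_ge0 ?addr_ge0 ?(ltW C0)// (le_trans _ (s1 _)). Qed.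

Let lam0 x : 0 <= lam x.
Proof. by rewrite mulr_ge0 ?sqrtr_ge0// mulr_ge0 ?sqrtr_ge0// /Kb; move: C0; lra. Qed.

Let del0 x : 0 <= 2 * delta (projT1 x) * (rt x ^+ 2)^-1.
Proof. by rewrite mulr_ge0 ?invr_ge0 ?sqr_ge0// mulr_ge0// ltW. Qed.

Let tau_parts x : [/\ 0 <= tau x, lam x <= tau x, 2 * delta (projT1 x) * (rt x ^+ 2)^-1 <= tau x,
  nrm (row rm x) <= tau x & nrm (row rg x) <= tau x].
Proof.
have := lam0 x; have := del0 x; have := nrm_ge0 (row rm x); have := nrm_ge0 (row rg x).
by rewrite /tau; move: (lam x) (2 * _ * _) (nrm _) (nrm _) => a b e f; split; lra.
Qed.

Let tau_small : rt x ^+ 2 * tau x @[x --> F] --> 0.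
Proof.
(* The product [rt x ^ 2 * lam x] is [Kb] times this root, because [sqrt n * (L / n) * s = rho]. *)
have h : Num.sqrt ((1 + C) / kap1 * rho (projT1 x)) @[x --> F] --> 0.
  by apply: cvg0_sqrt; apply: cvg0Z; exact: (whp_seq P rho0).
have h1 : rt x ^+ 2 * lam x @[x --> F] --> 0.
  apply: (cvg0_le _ (cvg0Z Kb h)); apply: filterS2 posx (whp_near P L1) => x n0 l1.
  have t0 : 0 <= rt x ^+ 2 * lam x by apply: mulr_ge0; [exact: sqr_ge0|exact: lam0].
  rewrite ger0_norm// /lam -mulrA mulrCA.
  have np : 0 < ((projT1 x)%:R : R) by rewrite ltr0n.
  have Lp : 0 <= L (projT1 x) by apply: le_trans l1.
  have Kp : 0 <= Kb by rewrite /Kb; move: C0; lra.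
  rewrite ler_wpM2l// /rt root8_sq -!sqrtrM ?sqrtr_ge0 ?divr_ge0 ?(ltW np)//.
  apply: ler_wsqrtr; rewrite le_eqVlt; apply/orP; left; apply/eqP; rewrite /rho /kx /sx.
  have sn : 0 < Num.sqrt ((projT1 x)%:R : R) by rewrite sqrtr_gt0.
  have -> : ((projT1 x)%:R : R)^-1 = (Num.sqrt (projT1 x)%:R)^-1 ^+ 2 by rewrite exprVn sqr_sqrtr// ltW.
  by move: (Num.sqrt _) sn => r r0; field; rewrite !gt_eqF.
have h2 : rt x ^+ 2 * (2 * delta (projT1 x) * (rt x ^+ 2)^-1) @[x --> F] --> 0.
  apply: (cvg0_le (Y := fun x => 2 * delta (projT1 x)) _ (cvg0Z 2 dx)).
  apply: (filterS _ posx) => x n0.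
  have t0 : 0 <= rt x ^+ 2 * (2 * delta (projT1 x) * (rt x ^+ 2)^-1).
    by apply: mulr_ge0; [exact: sqr_ge0|exact: del0].
  rewrite ger0_norm//.
  by rewrite mulrCA divff ?mulr1// gt_eqF// exprn_gt0// rt0.
have -> : (fun x => rt x ^+ 2 * tau x) = (fun x => rt x ^+ 2 * lam x +
   rt x ^+ 2 * (2 * delta (projT1 x) * (rt x ^+ 2)^-1) + rt x ^+ 2 * nrm (row rm x) + rt x ^+ 2 * nrm (row rg x)).
  by apply/funext => x; rewrite /tau !mulrDr.
apply: cvg0D; last exact: (nrm_small sm_rg).
apply: cvg0D; last exact: (nrm_small sm_rm).
exact: cvg0D.
Qed.

Unset Implicit Arguments.
Let Xr (x : {n & T n}) : 'I_(projT1 x) -> 'I_(p (projT1 x)) -> R :=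
  fun i => Pd (projT1 x) (z (projT1 x) i (projT2 x)).
Let Is (x : {n & T n}) : {set 'I_(p (projT1 x))} :=
  I1 (projT1 x) (projT2 x) :|: I2 (projT1 x) (projT2 x) :|: I3 (projT1 x) (projT2 x).
Let er (x : {n & T n}) : 'I_(projT1 x) -> R := fun i => row d x i - Xb (Xr x) (bh (projT1 x) (projT2 x)) i.
Let am (x : {n & T n}) : 'I_(projT1 x) -> R :=
  Xb (Xr x) (fun j => bm0 (projT1 x) j - bh (projT1 x) (projT2 x) j).
Let ag (x : {n & T n}) : 'I_(projT1 x) -> R :=
  Xb (Xr x) (fun j => bg0 (projT1 x) j - bc (projT1 x) (projT2 x) j).
Let Da (x : {n & T n}) : R := ac (projT1 x) (projT2 x) - alpha0 (projT1 x).

Set Implicit Arguments.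

Let ev_SE : \forall x \near F, forall dl : 'I_(p (projT1 x)) -> R, (l0 dl)%:R <= kx x ->
  kap1 * \sum_(j < p (projT1 x)) dl j ^+ 2 <= ip (Xb (Xr x) dl) (Xb (Xr x) dl).
Proof.
(* Since [ell] diverges, [ell * s] eventually exceeds [kx = (1 + C) * s], the sparsity of a
   reference vector plus that of the selected set. *)
have h1 : \forall n \near \oo, 1 + C <= ell n by have /cvgryPge/(_ (1 + C)) := hell_lim.
have h2 : \forall n \near \oo, Delta n < 1.
  have /cvgrPdist_lt/(_ _ ltr01) := hDelta_lim.
  by apply: filterS => n; rewrite sub0r normrN; apply: le_lt_trans; exact: ler_norm.
apply: (ev_exists (Q := fun x => forall dl : 'I_(p (projT1 x)) -> R, (l0 dl)%:R <= kx x ->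
  kap1 * \sum_(j < p (projT1 x)) dl j ^+ 2 <= ip (Xb (Xr x) dl) (Xb (Xr x) dl)) hDelta_lim).
apply: filterS2 h1 h2 => n e1 D1.
have es : (1 + C) * s n <= ell n * s n by rewrite ler_wpM2r// (le_trans _ (s1 n)).
have es1 : 1 <= ell n * s n.
  apply: le_trans es; rewrite -[leLHS]mulr1 ler_pM//.
  by rewrite lerDl ltW.
have [A [mA PA hA]] := SE_event (hz_meas n) (hPd_meas n) kap0 es1 D1 (hSE n).
by exists A; split=> // w Aw dl hdl; apply: (hA w Aw); apply: (le_trans hdl).
Qed.

Let ev_HLMS : \forall x \near F, #|Is x|%:R <= C * sx x /\
  exists bm bg : 'I_(p (projT1 x)) -> R, [/\ supported (Is x) bm, supported (Is x) bg,
    nrm (fun i => m (projT1 x) (z (projT1 x) i (projT2 x)) - Xb (Xr x) bm i) <= tau x &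
    nrm (fun i => g (projT1 x) (z (projT1 x) i (projT2 x)) - Xb (Xr x) bg i) <= tau x].
Proof.
refine (ev_exists hDelta_lim _); apply: filterS pos => n n0.
have [A [mA PA hA]] := HLMS_event (hz_meas n) (hPd_meas n) (hI1_meas n) (hI2_meas n) (hI3_meas n)
  (hg_meas n) (hm_meas n) (hdelta_pos n) n0 (hHLMS n).
exists A; split=> // w Aw; have [h1 [bm [bg [sm sg h2 h3]]]] := hA w Aw.
have [_ _ ht _ _] := tau_parts (existT _ n w).
split=> //; exists bm, bg; split=> //; apply: le_trans ht; rewrite /rt -powR_root8; assumption.
Qed.

(* Everything random is now reduced to [tau], which is [o(n^(-1/4))]. *)
Let master : \forall x \near F,
  [/\ nrm (fun i => er x i - row v x i) <= 3 * tau x, nrm (am x) <= 4 * tau x,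
    `|Da x * ip (er x) (er x) - ip (row v x) (row ze x)| <=
      `|ip (row rm x) (row ze x)| + `|ip (row v x) (row rg x)| + 9 * tau x ^+ 2 &
    nrm (ag x) <= 4 * tau x + `|Da x| * nrm (row d x)] /\
  [/\ forall i, `|am x i| <= Num.sqrt (X2 x) * Num.sqrt (kx x / kap1) * nrm (am x),
    forall i, `|ag x i| <= Num.sqrt (X2 x) * Num.sqrt (kx x / kap1) * nrm (ag x) &
    (#|Is x|%:R <= C * sx x)].
Proof.
pose proof (filterI (filterI bern_v bern_ze) (filterI ev_SE ev_HLMS)) as near1.
apply: (@filterS _ F FF _ _ _ near1) => x [[bv bz] [RE [cI [bm [bg [sm sg tm tg]]]]]].
have [t0 tl _ trm trg] := tau_parts x.
set n := projT1 x in bm bg sm sg tm tg bv bz RE *.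
have dE i : row d x i = m n (z n i (projT2 x)) + row v x i by rewrite /row /v /vres addrC subrK.
have yE i : row y x i = row d x i * alpha0 n + g n (z n i (projT2 x)) + row ze x i.
  by rewrite /row /ze /zeta; ring.
have mE i : m n (z n i (projT2 x)) = Xb (Xr x) (bm0 n) i + row rm x i by rewrite /row /rm /rerr addrC subrK.
have gE i : g n (z n i (projT2 x)) = Xb (Xr x) (bg0 n) i + row rg x i by rewrite /row /rg /rerr addrC subrK.
have [lm lg] : (l0 (bm0 n))%:R + #|Is x|%:R <= kx x /\ (l0 (bg0 n))%:R + #|Is x|%:R <= kx x.
  by case: (hASTE n) => _ _ [_ h1 h2 _ _] _ _; rewrite /kx mulrDl mul1r; split; exact: lerD.
have sp e : (forall j, `|ip (fun i => xx n i j (projT2 x)) e| <= Kb * Num.sqrt (L n / n%:R)) ->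
    forall b : 'I_(p n) -> R, (l0 b)%:R <= kx x -> `|ip e (Xb (Xr x) b)| <= tau x * nrm (Xb (Xr x) b).
  move=> he b lb; have K0 : 0 <= Kb * Num.sqrt (L n / n%:R).
    by rewrite mulr_ge0 ?sqrtr_ge0// /Kb; move: C0; lra.
  apply: (le_trans (sparse_ip (x := Xr x) kap0 (kx0 x) RE K0 he lb)).
  by rewrite ler_wpM2r ?nrm_ge0.
have hv := sp _ bv; have hz := sp _ bz.
have [sh mh] := hhat n (projT2 x); have [sc mc] := hcheck n (projT2 x).
have xj i j : `|Xr x i j| <= Num.sqrt (X2 x).
  by rewrite -[leLHS]ger0_norm// -sqrtr_sqr ler_wsqrtr//; exact: maxx2_ge.
split; split=> //.
- exact: (pds_residual (I := Is x) dE lm t0 hv sm tm sh mh).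
- exact: (pds_m_fit (I := Is x) dE mE lm t0 hv sm tm trm sh mh).
- exact: (pds_alpha (I := Is x) dE yE mE gE lm lg t0 hv hz sm sg tm tg trm trg sh sc mh mc).
- exact: (pds_g_fit (I := Is x) yE gE lm t0 hz sg tg trg sc mc).
- by move=> i; apply: (sparse_sup kap0 (kx0 x) RE (sqrtr_ge0 _) (xj i)); exact: (sparse_m (I := Is x) lm sh).
- by move=> i; apply: (sparse_sup kap0 (kx0 x) RE (sqrtr_ge0 _) (xj i)); exact: (sparse_g (I := Is x) lg sc).
Qed.

(** * Rate of the estimator and size of the fitting errors *)

Let rt1 : \forall x \near F, 1 <= rt x.
Proof. by apply: (whp_near P (Q := fun n => 1 <= root8 n)); have /cvgryPge/(_ 1) := @root8_cvgy R. Qed.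

Let Ev2 n : R := Eavg (P n) (fun i w => v n i w ^+ 2).
Let sg n : R := Eavg (P n) (fun i w => v n i w ^+ 2 * ze n i w ^+ 2).
Let Sx (x : {n & T n}) : R := Num.sqrt (projT1 x)%:R * ip (row v x) (row ze x).
Let ee x : R := ip (er x) (er x).

Let avg_between n (f : 'I_n -> R) (a b : R) : (0 < n)%N -> (forall i, a <= f i <= b) -> a <= avg f <= b.
Proof.
move=> n0 h; have np : 0 < (n%:R : R) by rewrite ltr0n.
have e (k : R) : k = avg (fun _ : 'I_n => k).
  by rewrite /avg sumr_const card_ord -[X in _ * X]mulr_natl mulrA mulVf ?mul1r// gt_eqF.
by apply/andP; split; [rewrite (e a)|rewrite (e b)]; apply: avg_le => i; case/andP: (h i).
Qed.

Let v_sq' n i := v_sq (@hy_meas n) (@hd_meas n) (@hz_meas n) (@hPd_meas n) (hSM n) i.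

Let vz_between n i : (0 < n)%N -> c ^+ 2 <= Ex (P n) (fun w => v n i w ^+ 2 * ze n i w ^+ 2) <= C ^+ 2.
Proof.
move=> n0; have [_ /andP[l1 l2]] := v_sq' i.
have /andP[b1 b2] := vz_bounds n0 C0 (@hy_meas n) (@hd_meas n) (@hz_meas n) (@hPd_meas n)
  (hg_meas n) (hm_meas n) (hASTE n) (hSM n) i.
apply/andP; split; [apply: le_trans b1|apply: (le_trans b2)]; rewrite expr2 ler_wpM2l// ltW//.
Qed.

Let Ev2_bounds n : (0 < n)%N -> c <= Ev2 n <= C.
Proof. by move=> n0; apply: avg_between => // i; case: (v_sq' i). Qed.

Let sg_bounds n : (0 < n)%N -> c ^+ 2 <= sg n <= C ^+ 2.
Proof. by move=> n0; apply: avg_between => // i; exact: vz_between. Qed.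

Let small_root8 r : small_moments r -> root8 n ^+ 2 * Eavg (P n) (fun i w => r n i w ^+ 2) @[n --> \oo] --> 0.
Proof.
move=> hr; have r1 : \forall n \near \oo, 1 <= (root8 n : R) by have /cvgryPge/(_ 1) := @root8_cvgy R.
apply: (cvg0_le _ (cvg0Z (C ^+ 2) rho0)); apply: filterS3 pos r1 s_rho => n n0 r1 sr.
have [_ h] := hr n n0; rewrite smallE// in h.
rewrite ger0_norm; last by apply: mulr_ge0; [exact: sqr_ge0|apply: Eavg_ge0 => i w; exact: sqr_ge0].
apply: (@le_trans _ _ (root8 n ^+ 2 * (C ^+ 2 * (s n / n%:R)))); first by rewrite ler_wpM2l ?sqr_ge0.
rewrite mulrCA ler_wpM2l ?sqr_ge0// mulrA ler_pdivrMr ?ltr0n//.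
have h2 : rho n * n%:R = Num.sqrt n%:R * (rho n * Num.sqrt n%:R).
  by rewrite -{1}[n%:R](sqr_sqrtr (ler0n R n)) expr2; ring.
rewrite h2; apply: ler_pM => //; [exact: sqr_ge0|exact: le_trans (s1 n)|].
by rewrite -root8_pow4 ler_weXn2l.
Qed.

Let orth_vz : orthogonal_rows P v ze.
Proof.
by move=> n i n0; exact: (vz_orth n0 C0 (@hy_meas n) (@hd_meas n) (@hz_meas n) (@hPd_meas n)
  (hg_meas n) (hm_meas n) (hASTE n) (hSM n)).
Qed.

Let cvg_ext (X Y : {n & T n} -> R) : (forall x, X x = Y x) -> Y x @[x --> F] --> 0 -> X x @[x --> F] --> 0.
Proof. by move=> /funext ->. Qed.

Let cross1 : Num.sqrt (projT1 x)%:R * ip (row rm x) (row ze x) @[x --> F] --> 0.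
Proof.
have o : orthogonal_rows P ze rm.
  move=> n i n0; under eq_fun do rewrite mulrC.
  exact: (rmz_orth n0 C0 (@hy_meas n) (@hd_meas n) (@hz_meas n) (@hPd_meas n)
    (hg_meas n) (hm_meas n) (hASTE n) (hSM n)).
apply: cvg_ext (array_ip0 q4 mom_ze mom_rm (ad_ind a_ze a_rm) o (small_root8 sm_rm)) => x.
by congr (_ * _); exact: ipC.
Qed.

Let cross2 : Num.sqrt (projT1 x)%:R * ip (row v x) (row rg x) @[x --> F] --> 0.
Proof.
have o : orthogonal_rows P v rg.
  move=> n i n0; exact: (vrg_orth n0 C0 (@hy_meas n) (@hd_meas n) (@hz_meas n) (@hPd_meas n)
    (hg_meas n) (hm_meas n) (hASTE n) (hSM n)).
exact: (array_ip0 q4 mom_v mom_rg (ad_ind a_v a_rg) o (small_root8 sm_rg)).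
Qed.

Let cvg0_norm (X : {n & T n} -> R) : X x @[x --> F] --> 0 -> `|X x| @[x --> F] --> 0.
Proof. by move=> h; rewrite -[X in _ --> X](normr0 R); exact: cvg_norm. Qed.

Let R1 x : R := Num.sqrt (projT1 x)%:R * (Da x * ee x) - Sx x.

Let R1_small : R1 x @[x --> F] --> 0.
Proof.
pose Y x := `|Num.sqrt (projT1 x)%:R * ip (row rm x) (row ze x)| +
  `|Num.sqrt (projT1 x)%:R * ip (row v x) (row rg x)| + 9 * ((rt x ^+ 2 * tau x) * (rt x ^+ 2 * tau x)).
apply: (cvg0_le (Y := Y)); last first.
  apply: cvg0D; last by apply: cvg0Z; exact: cvg0M.
  by apply: cvg0D; exact: cvg0_norm.
apply: (@filterS _ F FF _ _ _ master) => x [[_ _ h _] _].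
have nM u : `|Num.sqrt (projT1 x)%:R * u| = Num.sqrt (projT1 x)%:R * `|u|.
  by rewrite normrM ger0_norm ?sqrtr_ge0.
rewrite /R1 /Sx /Y -mulrBr !nM.
have -> : (rt x ^+ 2 * tau x) * (rt x ^+ 2 * tau x) = Num.sqrt (projT1 x)%:R * tau x ^+ 2.
  by rewrite -root8_pow4 /rt; ring.
rewrite [leRHS](_ : _ = Num.sqrt (projT1 x)%:R * (`|ip (row rm x) (row ze x)| +
  `|ip (row v x) (row rg x)| + 9 * tau x ^+ 2)); last by ring.
by rewrite ler_wpM2l ?sqrtr_ge0.
Qed.

Let tau_cvg : tau x @[x --> F] --> 0.
Proof.
apply: (cvg0_le _ tau_small); apply: (@filterS _ F FF _ _ _ rt1) => x r1; have [t0 _ _ _ _] := tau_parts x.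
by rewrite ger0_norm// ler_peMl// exprn_ege1.
Qed.

Let v_lln : nrm (row v x) ^+ 2 - Ev2 (projT1 x) @[x --> F] --> 0.
Proof.
(* The constant row 1 as second factor specializes the law of large numbers to [v ^ 2]. *)
apply: cvg_ext (array_lln q4 mom_v mom_one (ad_ind a_v a_one)) => x.
rewrite nrm_sq ipff /Ev2; congr (_ - _).
  by congr avg; apply/funext => i; rewrite expr1n mulr1.
by congr Eavg; apply/funext => i; apply/funext => w; rewrite expr1n mulr1.
Qed.

Let near_bound (u : nat -> R) (a b : R) : (forall n, (0 < n)%N -> a <= u n <= b) ->
  (\forall x \near F, a <= u (projT1 x)) /\ (\forall x \near F, u (projT1 x) <= b).
Proof. by move=> h; split; apply: (@filterS _ F FF _ _ _ posx) => x n0; case/andP: (h _ n0). Qed.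

Let ee_cvg : ee x - Ev2 (projT1 x) @[x --> F] --> 0.
Proof.
apply: (cvg_ext (Y := fun x => nrm (er x) ^+ 2 - Ev2 (projT1 x))) => [x|]; first by rewrite nrm_sq.
apply: (cvg0_sq_transfer _ v_lln (proj2 (near_bound Ev2_bounds))).
apply: (cvg0_le _ (cvg0Z 3 tau_cvg)).
apply: (@filterS _ F FF _ _ _ master) => x [[h _ _ _] _].
exact: (le_trans (nrm_dist _ _)).
Qed.

Let ee_low : \forall x \near F, c / 2 <= ee x.
Proof.
have c2 : 0 < c / 2 by rewrite divr_gt0.
apply: (@filterS2 _ F FF _ _ _ _ (cvg0_near_le c2 ee_cvg) (proj1 (near_bound Ev2_bounds))) => x.
by rewrite ler_norml => /andP[h1 h2] h3; move: h1 h3; lra.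
Qed.

(** A rate [o(n ^ (- 3/8))], weaker than the true one, obtained from [array_ip_root8]. It suffices:
    [nrm d] is [o(n ^ (1/8))], so the product of both is still [o(n ^ (- 1/4))]. *)
Let Da_small : rt x ^+ 3 * Da x @[x --> F] --> 0.
Proof.
have h : (rt x)^-1 * Sx x + (rt x)^-1 * R1 x @[x --> F] --> 0.
  apply: cvg0D; last exact: cvg0M.
  exact: (array_ip_root8 q4 mom_v mom_ze (ad_ind a_v a_ze) orth_vz).
apply: (cvg0_le _ (cvg0Z (2 / c) (cvg0_norm h))); apply: (@filterS2 _ F FF _ _ _ _ posx ee_low) => x n0 he.
have r0 : 0 < rt x by exact: rt0.
have e0 : 0 < ee x by apply: lt_le_trans he; rewrite divr_gt0.
have -> : (rt x)^-1 * Sx x + (rt x)^-1 * R1 x = (rt x ^+ 3 * Da x) * ee x.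
  by rewrite /R1 -root8_pow4 -/(rt x); field; rewrite gt_eqF.
have nM (a : R) : `|a * ee x| = `|a| * ee x by rewrite normrM (ger0_norm (ltW e0)).
rewrite nM mulrCA ler_peMr//.
by rewrite mulrC -ler_pdivrMr ?divr_gt0// div1r invf_div.
Qed.

Let d_small : (rt x)^-1 * nrm (row d x) @[x --> F] --> 0.
Proof.
apply: cvg0_of_sq.
have h : (rt x)^-1 * (rt x)^-1 * avg (fun i => row d x i ^+ 2) @[x --> F] --> 0.
  apply: (markov_avg (f := fun n i w => d n i w ^+ 2) (u := fun n => (root8 n)^-1 * (root8 n)^-1) (K := fun=> C)).
  - by move=> n i w; exact: sqr_ge0.
  - by move=> n; rewrite mulr_ge0 ?invr_ge0 ?root8_ge0.
  - by move=> n n0; exact: (d_sq n0 (@hy_meas n) (@hd_meas n) (@hz_meas n) (@hPd_meas n) (hm_meas n) (hSM n)).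
  - have rr : (root8 n)^-1 * (root8 n)^-1 @[n --> \oo] --> (0 : R) by apply: cvg0M; exact: root8V_cvg.
    by apply: (cvg0_bounded (B := C) rr); apply: nearW => n; rewrite ger0_norm ?(ltW C0).
by apply: cvg_ext h => x; rewrite exprMn nrm_sq ipff expr2.
Qed.

Let am_small : rt x ^+ 2 * nrm (am x) @[x --> F] --> 0.
Proof.
apply: (cvg0_le _ (cvg0Z 4 tau_small)).
apply: (@filterS _ F FF _ _ _ master) => x [[_ h _ _] _].
by rewrite ger0_norm ?mulr_ge0 ?nrm_ge0 ?exprn_ge0 ?root8_ge0// mulrCA ler_wpM2l ?exprn_ge0 ?root8_ge0.
Qed.

Let ag_small : rt x ^+ 2 * nrm (ag x) @[x --> F] --> 0.
Proof.
pose Y x := 4 * (rt x ^+ 2 * tau x) + `|rt x ^+ 3 * Da x| * ((rt x)^-1 * nrm (row d x)).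
apply: (cvg0_le (Y := Y)); last first.
  by apply: cvg0D; [exact: cvg0Z|apply: cvg0M => //; exact: cvg0_norm].
pose proof (filterI posx master) as near1.
apply: (@filterS _ F FF _ _ _ near1) => x [n0 [[_ _ _ h] _]].
have r0 : 0 < rt x by exact: rt0.
rewrite ger0_norm ?mulr_ge0 ?nrm_ge0 ?exprn_ge0 ?root8_ge0//.
apply: (le_trans (ler_wpM2l _ h)); first by rewrite exprn_ge0 ?root8_ge0.
rewrite /Y normrM ger0_norm ?exprn_ge0 ?(ltW r0)// le_eqVlt; apply/orP; left; apply/eqP.
by field; rewrite gt_eqF.
Qed.

(** Bounds the maximum of [am] over the observations, by sparsity and the size of the regressors. It
    vanishes because [X2 * s] is [o(sqrt n)] and [nrm am] is [o(n ^ (- 1/4))]. *)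
Let smu x : R := Num.sqrt (X2 x) * Num.sqrt (kx x / kap1) * nrm (am x).

Let smu_ge0 x : 0 <= smu x.
Proof. by rewrite /smu mulr_ge0 ?nrm_ge0// mulr_ge0 ?sqrtr_ge0. Qed.

Let smu_small : smu x @[x --> F] --> 0.
Proof.
have h : Num.sqrt ((1 + C) / kap1 * delta (projT1 x)) @[x --> F] --> 0.
  by apply: cvg0_sqrt; exact: cvg0Z.
apply: (cvg0_le (Y := fun x => Num.sqrt ((1 + C) / kap1 * delta (projT1 x)) * (rt x ^+ 2 * nrm (am x)))).
  apply: (@filterS _ F FF _ _ _ x_small) => x xs.
  rewrite (ger0_norm (smu_ge0 x)) mulrA ler_wpM2r ?nrm_ge0//.
  have k0 : 0 <= (1 + C) / kap1 by rewrite divr_ge0 ?addr_ge0 ?(ltW C0) ?(ltW kap0).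
  have -> : rt x ^+ 2 = Num.sqrt (rt x ^+ 4) by rewrite (exprM _ 2 2) sqrtr_sqr ger0_norm ?sqr_ge0.
  rewrite -!sqrtrM; [|by rewrite mulr_ge0 ?(ltW (hdelta_pos _))|exact: bigmax_ge_id].
  apply: ler_wsqrtr; rewrite /kx.
  have -> : X2 x * ((1 + C) * sx x / kap1) = (1 + C) / kap1 * (X2 x * sx x) by ring.
  by rewrite -[leRHS]mulrA ler_wpM2l.
by apply: cvg0M => //; exact: am_small.
Qed.

(** * Consistency of the variance estimators *)

Unset Implicit Arguments.
Let zr (x : {n & T n}) : 'I_(projT1 x) -> R := fun i =>
  row y x i - row d x i * ac (projT1 x) (projT2 x) - Xb (Xr x) (bc (projT1 x) (projT2 x)) i.
Set Implicit Arguments.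

(** The approximation error is absorbed in [zt], so what is left is a sparse combination [ag], to
    which eigenvalue bounds apply, and the error on the coefficient of [d]. *)
Let zrE x i : zr x i = row zt x i + ag x i - Da x * row d x i.
Proof.
rewrite /zr /ag XbB /row /zt /ze /rg /zeta /rerr /Da -/(Xb (Xr x) (bg0 (projT1 x)) i); ring.
Qed.

Let erE x i : er x i = row vt x i + am x i.
Proof.
rewrite /er /am XbB /row /vt /v /rm /vres /rerr -/(Xb (Xr x) (bm0 (projT1 x)) i); ring.
Qed.

Let row_sup' a x : (0 < projT1 x)%N -> forall i, `|row a x i| <= rt x ^+ 2 * Num.sqrt (U a x).
Proof.
move=> n0 i; rewrite -[leLHS]ger0_norm// -sqrtr_sqr.
have -> : rt x ^+ 2 = Num.sqrt (rt x ^+ 4) by rewrite (exprM _ 2 2) sqrtr_sqr ger0_norm ?sqr_ge0.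
rewrite -sqrtrM ?exprn_ge0 ?root8_ge0// ler_wsqrtr// real_normK ?num_real//; exact: row_sup.
Qed.

(** After expansion each term pairs a factor bounded in maximum with one bounded in norm. Rows of
    [vt] and [zt] have maxima [o(n ^ (1/4))], compensated by the norms of [am], [ag] and of [Da]
    times [d]; for [am] even the maximum vanishes, which settles the terms without [vt] and [zt]. *)
Let prod_small : nrm (fun i => er x i * zr x i - row vt x i * row zt x i) @[x --> F] --> 0.
Proof.
pose Y x := Num.sqrt (U zt x) * (rt x ^+ 2 * nrm (am x)) + Num.sqrt (U vt x) * (rt x ^+ 2 * nrm (ag x)) +
  smu x * (rt x ^+ 2 * nrm (ag x)) +
  (`|rt x ^+ 3 * Da x| * ((rt x)^-1 * nrm (row d x))) * (Num.sqrt (U vt x) + smu x).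
have uz := cvg0_sqrt (U0 q1_zt); have uv := cvg0_sqrt (U0 q1_vt).
apply: (cvg0_le (Y := Y)); last first.
  apply: cvg0D; last by apply: cvg0M; [apply: cvg0M => //; exact: cvg0_norm|exact: cvg0D].
  apply: cvg0D; last by apply: cvg0M => //; exact: ag_small.
  by apply: cvg0D; apply: cvg0M.
pose proof (filterI (filterI posx rt1) master) as near1.
apply: (@filterS _ F FF _ _ _ near1) => x [[n0 r1] [_ [ha _ _]]].
have r0 : 0 < rt x by exact: rt0.
rewrite (ger0_norm (nrm_ge0 _)).
have -> : (fun i => er x i * zr x i - row vt x i * row zt x i) =
   (fun i => ((row zt x i * am x i + row vt x i * ag x i) + am x i * ag x i) +
      (- Da x) * (row vt x i * row d x i + am x i * row d x i)).
  by apply/funext => i; rewrite erE zrE; ring.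
have p1 : 0 <= rt x ^+ 2 * Num.sqrt (U zt x) by rewrite mulr_ge0 ?sqrtr_ge0 ?exprn_ge0 ?(ltW r0).
have p2 : 0 <= rt x ^+ 2 * Num.sqrt (U vt x) by rewrite mulr_ge0 ?sqrtr_ge0 ?exprn_ge0 ?(ltW r0).
have b1 := nrm_mul_sup (am x) p1 (row_sup' zt n0).
have b2 := nrm_mul_sup (ag x) p2 (row_sup' vt n0).
have b3 := nrm_mul_sup (ag x) (smu_ge0 x) ha.
have b4 := nrm_mul_sup (row d x) p2 (row_sup' vt n0).
have b5 := nrm_mul_sup (row d x) (smu_ge0 x) ha.
apply: (le_trans (nrmD _ _)); rewrite /Y; apply: lerD.
  apply: (le_trans (nrmD _ _)); apply: lerD.
    apply: (le_trans (nrmD _ _)); apply: lerD.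
      by rewrite mulrA [Num.sqrt _ * _]mulrC.
    by rewrite mulrA [Num.sqrt _ * _]mulrC.
  apply: (le_trans b3); rewrite ler_wpM2l// ler_peMl ?nrm_ge0//.
  by rewrite exprn_ege1.
rewrite nrmZ normrN.
have -> : `|rt x ^+ 3 * Da x| * ((rt x)^-1 * nrm (row d x)) * (Num.sqrt (U vt x) + smu x) =
    `|Da x| * (rt x ^+ 2 * Num.sqrt (U vt x) * nrm (row d x) + rt x ^+ 2 * (smu x * nrm (row d x))).
  rewrite normrM [`|rt x ^+ 3|]ger0_norm ?exprn_ge0 ?(ltW r0)//.
  by field; rewrite gt_eqF.
rewrite ler_wpM2l//; apply: (le_trans (nrmD _ _)); apply: lerD => //.
apply: (le_trans b5); rewrite ler_peMl ?mulr_ge0 ?nrm_ge0//.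
by rewrite exprn_ege1.
Qed.

Let E2 x : R := avg (fun i => er x i ^+ 2 * zr x i ^+ 2).

(** The fitted products are close in norm to those of [vt] and [zt], which obey the law of large
    numbers. Condition ASTE(v) then ties their second moment to [sg]. *)
Let E2_cvg : E2 x - sg (projT1 x) @[x --> F] --> 0.
Proof.
have nE n (f h : 'I_n -> R) : avg (fun i => f i ^+ 2 * h i ^+ 2) = nrm (fun i => f i * h i) ^+ 2.
  by rewrite nrm_sq ipff; congr avg; apply/funext => i; rewrite exprMn.
have h0 : nrm (fun i => row vt x i * row zt x i) ^+ 2 - sg (projT1 x) @[x --> F] --> 0.
  pose Eq n := Eavg (P n) (fun i w => vt n i w ^+ 2 * zt n i w ^+ 2).
  have h1 := array_lln q4 mom_vt mom_zt (ad_ind a_vt a_zt).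
  have h2 : Eq (projT1 x) - sg (projT1 x) @[x --> F] --> 0.
    apply: (cvg0_le (Y := fun x => delta (projT1 x)) _ dx).
    apply: (@filterS _ F FF _ _ _ posx) => x n0.
    exact: (tilde_diff n0 C0 (@hy_meas _) (@hd_meas _) (@hz_meas _) (@hPd_meas _)
      (hg_meas _) (hm_meas _) (hASTE _) (hSM _)).
  apply: cvg_ext (cvg0D h1 h2) => x; rewrite -nE /row /=.
  by rewrite [RHS]addrA subrK.
apply: (cvg_ext (Y := fun x => nrm (fun i => er x i * zr x i) ^+ 2 - sg (projT1 x))) => [x|].
  by rewrite -nE.
apply: (cvg0_sq_transfer _ h0 (proj2 (near_bound sg_bounds))).
apply: (cvg0_le _ prod_small); apply: nearW => x; exact: nrm_dist.
Qed.

Let cvg_near_ext (X Y : {n & T n} -> R) (l : R) : (\forall x \near F, Y x = X x) ->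
  Y x @[x --> F] --> l -> X x @[x --> F] --> l.
Proof. by move=> h hY; apply: cvg_trans hY; exact: near_eq_cvg. Qed.

Let fac x : R := (projT1 x)%:R / ((projT1 x)%:R - #|Is x|%:R - 1).

(** The number of selected regressors is at most [C * s = o(sqrt n)], negligible against [n]; in
    particular the denominator is eventually positive. *)
Let fac_cvg : fac x @[x --> F] --> (1 : R).
Proof.
pose w (x : {n & T n}) : R := 1 - (#|Is x|%:R + 1) / (projT1 x)%:R.
have hw : w x - 1 @[x --> F] --> 0.
  apply: (cvg0_le (Y := fun x => (C + 1) * `|rho (projT1 x)|)).
    pose proof (filterI posx master) as near1.
    pose proof (whp_near P s_rho) as near2.
    apply: (@filterS2 _ F FF _ _ _ _ near1 near2) => x [n0 [_ [_ _ cI]]] sr.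
    have np : 0 < ((projT1 x)%:R : R) by rewrite ltr0n.
    have sn : 1 <= Num.sqrt ((projT1 x)%:R : R) by rewrite -[leLHS]sqrtr1 ler_wsqrtr// ler1n.
    rewrite /w addrAC subrr add0r normrN ger0_norm; last by rewrite divr_ge0 ?addr_ge0.
    rewrite ler_pdivrMr//; apply: (@le_trans _ _ ((C + 1) * sx x)).
      by rewrite mulrDl mul1r; apply: lerD => //; exact: s1.
    rewrite -mulrA ler_wpM2l ?addr_ge0 ?(ltW C0)//; apply: (le_trans sr).
    rewrite -[X in _ <= _ * X](sqr_sqrtr (ltW np)) expr2 mulrA; apply: (@le_trans _ _ (`|rho (projT1 x)| * Num.sqrt (projT1 x)%:R)).
      by rewrite ler_wpM2r ?sqrtr_ge0// ler_norm.
    by rewrite ler_peMr// mulr_ge0 ?sqrtr_ge0.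
  by apply: cvg0Z; apply: cvg0_norm; exact: (whp_seq P rho0).
have o1 : \forall x \near F, 1 <= (1 : R) by exact: nearW.
apply: (cvg_near_ext _ (cvg_ratio ltr01 o1 hw)).
apply: (@filterS _ F FF _ _ _ posx) => x n0.
have np : ((projT1 x)%:R : R) != 0 by rewrite pnatr_eq0 -lt0n.
rewrite /fac /w; set I := _%:R in np *; set J := _%:R.
by have -> : I - J - 1 = I * (1 - (J + 1) / I); [field|rewrite invfM mulrA divff].
Qed.

Let E2h x : R := avg (fun i => er x i ^+ 2 * (zr x i * Num.sqrt (fac x)) ^+ 2).

Let E2h_cvg : E2h x - sg (projT1 x) @[x --> F] --> 0.
Proof.
have f0 : fac x - 1 @[x --> F] --> 0.
  by rewrite -[X in _ --> X](subrr (1 : R)); apply: cvgB; [exact: fac_cvg|exact: cvg_cst].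
have E2b : \forall x \near F, `|E2 x| <= C ^+ 2 + 1.
  apply: (@filterS2 _ F FF _ _ _ _ (cvg0_near_le ltr01 E2_cvg) (proj2 (near_bound sg_bounds))) => x.
  rewrite ler_norml => /andP[_ h1] h2; rewrite ger0_norm; first by move: h1 h2; lra.
  by apply: avg_ge0 => i; rewrite mulr_ge0 ?sqr_ge0.
pose proof (cvg0D (cvg0_bounded f0 E2b) E2_cvg) as h.
apply: (cvg_near_ext _ h); apply: (@filterS _ F FF _ _ _ (cvg0_near_le ltr01 f0)) => x; rewrite ler_norml => /andP[h1 _].
have fp : 0 <= fac x by move: h1; lra.
have -> : E2h x = fac x * E2 x.
  rewrite /E2 -avgZ; congr avg; apply/funext => i.
  by rewrite exprMn sqr_sqrtr//; ring.
by ring.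
Qed.

(** * Normalization and conclusion *)

Unset Implicit Arguments.
Let Sn n (w : T n) : R := Num.sqrt n%:R * ip (fun i => v n i w) (fun i => ze n i w) / Num.sqrt (sg n).
Set Implicit Arguments.

Let Sn_meas n : measurable_fun setT (Sn n).
Proof.
apply: measurable_funM => //; apply: measurable_funM => //; apply: measurable_avg => i.
by apply: measurable_funM; [exact: (ad_m a_v)|exact: (ad_m a_ze)].
Qed.

Let Sn_clt (u : R) : fine (P n [set w | Sn n w <= u]) @[n --> \oo] --> Phi u.
Proof.
have c20 : 0 < c ^+ 2 by rewrite exprn_gt0.
have hM n i : (0 < n)%N -> Ex (P n) (fun w => v n i w ^+ 2 * ze n i w ^+ 2) <= M.
  move=> n0; have /andP[_ h] := vz_between i n0; apply: (le_trans h).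
  by have [_ []] := momM_bounds q1 q2 C0.
have hc n : (0 < n)%N -> c ^+ 2 <= sg n by move=> n0; case/andP: (sg_bounds n0).
exact: (array_clt q4 c20 mom_v mom_ze (ad_ind a_v a_ze) orth_vz hM hc).
Qed.

(** For [A > 0] the event [Z <= t] is [Sn <= t / A - Rm], with a random threshold that tends to
    [t]. *)
Let slutsky (Z : forall n, T n -> R) (A : {n & T n} -> R) : (forall n, measurable_fun setT (Z n)) ->
  A x @[x --> F] --> (1 : R) ->
  (\forall x \near F, Z (projT1 x) (projT2 x) = A x * ((Sx x + R1 x) / Num.sqrt (sg (projT1 x)))) ->
  converges_to_std_normal P Z.
Proof.
move=> mZ hA hZ t.
pose Rm x := R1 x / Num.sqrt (sg (projT1 x)).
have hR : Rm x @[x --> F] --> 0.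
  apply: (cvg0_bounded (B := c^-1) R1_small).
  apply: (@filterS _ F FF _ _ _ posx) => x n0; have /andP[h _] := sg_bounds n0.
  rewrite ger0_norm ?invr_ge0 ?sqrtr_ge0// lef_pV2 ?posrE// ?sqrtr_gt0.
    by rewrite -(ger0_norm (ltW c0)) -sqrtr_sqr ler_wsqrtr.
  by apply: lt_le_trans h; rewrite exprn_gt0.
have hA0 : \forall x \near F, 0 < A x.
  have /cvgrPdist_lt/(_ _ ltr01) h1 := hA.
  apply: (@filterS _ F FF _ _ _ h1) => x h; have := le_lt_trans (ler_norm _) h; lra.
apply: (@whp_slutsky _ _ _ P Sn Z (fun x => t / A x - Rm x)).
- by apply: nearW.
- by apply: nearW.
- exact: Sn_clt.
- have hV : (A x)^-1 @[x --> F] --> (1 : R)^-1 by apply: cvgV => //; exact: oner_neq0.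
  have ht : t / A x @[x --> F] --> t.
    by rewrite -[X in _ --> X](divr1 t); apply: cvgM => //; exact: cvg_cst.
  by rewrite -[X in _ --> X](subr0 t); exact: cvgB.
- apply: (@filterS2 _ F FF _ _ _ _ hZ hA0) => x -> A0.
  by rewrite lerBrDr ler_pdivlMr// mulrC /Rm -mulrDl.
Qed.

Let sqrt_sandwich (a b : R) : 0 < a -> 0 < b -> (Num.sqrt (a^-1 * b * a^-1))^-1 = a / Num.sqrt b.
Proof.
move=> a0 b0; have -> : a^-1 * b * a^-1 = a^-1 ^+ 2 * b by ring.
by rewrite sqrtrM ?sqr_ge0// sqrtr_sqr ger0_norm ?invr_ge0 ?(ltW a0)// invfM invrK.
Qed.

Let SR x : Sx x + R1 x = Num.sqrt (projT1 x)%:R * (Da x * ee x).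
Proof. by rewrite /R1 addrC subrK. Qed.

(** The expansion of the estimator is divided by the empirical [ee], the statistic is normalized by
    the deterministic [Ev2]; their ratio is the factor [A] tending to 1. *)
Lemma oracle_clt : converges_to_std_normal P
  (fun n => stat_oracle (P n) (y n) (d n) (z n) (alpha0 n) (g n) (m n) (ac n)).
Proof.
apply: (slutsky (A := fun x => Ev2 (projT1 x) / ee x)).
- by move=> n; apply: measurable_funM => //; apply: measurable_funB.
- exact: (cvg_ratio c0 (proj1 (near_bound Ev2_bounds)) ee_cvg).
pose proof (filterI posx ee_low) as near1.
apply: (@filterS _ F FF _ _ _ near1) => x [n0 el].
have /andP[e1 _] := Ev2_bounds n0; have /andP[e2 _] := sg_bounds n0.
have E0 : 0 < Ev2 (projT1 x) by apply: lt_le_trans e1.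
have s0 : 0 < sg (projT1 x) by apply: lt_le_trans e2; rewrite exprn_gt0.
have ee0 : 0 < ee x by apply: lt_le_trans el; rewrite divr_gt0.
rewrite /stat_oracle SR.
rewrite (Ebar_itgE (fun i => (v_sq' i).1)).
rewrite (Ebar_itgE (fun i => vz_itg n0 C0 (@hy_meas _) (@hd_meas _) (@hz_meas _) (@hPd_meas _)
  (hg_meas _) (hm_meas _) (hASTE _) (hSM _) i)) /=.
rewrite -/(Ev2 (projT1 x)) -/(sg (projT1 x)) sqrt_sandwich// -/(Da x).
have : 0 < Num.sqrt (sg (projT1 x)) by rewrite sqrtr_gt0.
by move: (Num.sqrt (sg _)) => r r0; field; rewrite !gt_eqF.
Qed.

Let measurable_funVr n (f : T n -> R) : measurable_fun setT f -> measurable_fun setT (fun w => (f w)^-1).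
Proof.
(* Inversion is not continuous at 0, but with the convention that the inverse of 0 is 0, this
   product formula with a measurable power holds there too. *)
move=> mf; have -> : (fun w => (f w)^-1) = (fun w => f w * (f w ^+ 2) `^ (-1)).
  apply/funext => w; rewrite powR_inv1 ?sqr_ge0//.
  have [->|f0] := eqVneq (f w) 0; first by rewrite invr0 mul0r.
  by field.
apply: measurable_funM => //; apply: (measurableT_comp (measurable_powR (-1))).
exact: measurable_funX.
Qed.

Let measurable_fun_sqrt n (f : T n -> R) : measurable_fun setT f -> measurable_fun setT (fun w => Num.sqrt (f w)).
Proof.
move=> mf; apply: (measurableT_comp (f := @Num.sqrt R)) => //.
exact: (@continuous_measurable_fun R (@Num.sqrt R) (@sqrt_continuous R)).
Qed.

Let card_meas n : measurable_fun setT (fun w => (#|I1 n w :|: I2 n w :|: I3 n w|%:R : R)).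
Proof.
move=> _ B mB; rewrite setTI.
pose A (S1 S2 S3 : {set 'I_(p n)}) : set (T n) := [set w | B (#|S1 :|: S2 :|: S3|%:R : R)].
have mA S1 S2 S3 : measurable (A S1 S2 S3).
  rewrite /A; have [h|h] := pselect (B (#|S1 :|: S2 :|: S3|%:R : R)).
    by rewrite (_ : [set w | _] = setT)//; apply/seteqP; split.
  by rewrite (_ : [set w | _] = set0)//; apply/seteqP; split.
exact: (measurable_selected (hI1_meas n) (hI2_meas n) (hI3_meas n) mA).
Qed.

(** The estimate of the variance of [v] is exactly [ee], the divisor in the expansion of the
    estimator, and cancels against it. Only the ratio of [sg] to its estimate has to tend to 1. *)
Lemma plugin_clt : converges_to_std_normal P
  (fun n => stat_plugin (y n) (d n) (z n) (Pd n) (alpha0 n)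
    (fun w => I1 n w :|: I2 n w :|: I3 n w) (ac n) (bc n) (bh n)).
Proof.
have c20 : 0 < c ^+ 2 by rewrite exprn_gt0.
apply: (slutsky (A := fun x => Num.sqrt (sg (projT1 x) / E2h x))).
- move=> n; have mX i b : (forall j, measurable_fun setT (fun w => b w j)) ->
      measurable_fun setT (fun w => xdot (Pd n (z n i w)) (b w)).
    exact: (measurable_Xb (hz_meas n) (hPd_meas n)).
  have mv i : measurable_fun setT (fun w => d n i w - xdot (Pd n (z n i w)) (bh n w)).
    by apply: measurable_funB => //; exact: mX.
  have mz i : measurable_fun setT (fun w => (y n i w - d n i w * ac n w - xdot (Pd n (z n i w)) (bc n w)) *
      Num.sqrt (n%:R / (n%:R - #|I1 n w :|: I2 n w :|: I3 n w|%:R - 1))).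
    apply: measurable_funM.
      apply: measurable_funB; last exact: mX.
      by apply: measurable_funB => //; exact: measurable_funM.
    apply: measurable_fun_sqrt; apply: measurable_funM => //; apply: measurable_funVr.
    by apply: measurable_funB => //; exact: measurable_funB.
  apply: measurable_funM; last exact: measurable_funB.
  apply: measurable_funM => //; apply: measurable_funVr; apply: measurable_fun_sqrt.
  have m1 : measurable_fun setT (fun w => (avg (fun i => (d n i w - xdot (Pd n (z n i w)) (bh n w)) ^+ 2))^-1).
    by apply: measurable_funVr; apply: measurable_avg => i; exact: measurable_funX.
  apply: measurable_funM => //; apply: measurable_funM => //.
  by apply: measurable_avg => i; apply: measurable_funM; exact: measurable_funX.
- rewrite -[X in _ --> X]sqrtr1.
  pose proof (cvg_ratio c20 (proj1 (near_bound sg_bounds)) E2h_cvg) as h.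
  by apply: (cvg_comp _ (@Num.sqrt R) h); exact: sqrt_continuous.
have cc : 0 < c ^+ 2 / 2 by rewrite divr_gt0.
pose proof (filterI posx ee_low) as near1.
apply: (@filterS2 _ F FF _ _ _ _ near1 (cvg0_near_le cc E2h_cvg)) => x [n0 el] hE.
have /andP[e2 _] := sg_bounds n0.
have s0 : 0 < sg (projT1 x) by apply: lt_le_trans e2.
have ee0 : 0 < ee x by apply: lt_le_trans el; rewrite divr_gt0.
have E0 : 0 < E2h x by move: hE; rewrite ler_norml => /andP[h _]; move: h e2 c20; lra.
transitivity ((Num.sqrt ((ee x)^-1 * E2h x * (ee x)^-1))^-1 * Num.sqrt (projT1 x)%:R * Da x).
  by rewrite /ee ipff.
rewrite SR sqrt_sandwich//.
have -> : Num.sqrt (sg (projT1 x) / E2h x) = Num.sqrt (sg (projT1 x)) / Num.sqrt (E2h x).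
  by rewrite sqrtrM ?(ltW s0)// sqrtrV ?(ltW E0).
have : 0 < Num.sqrt (sg (projT1 x)) by rewrite sqrtr_gt0.
have : 0 < Num.sqrt (E2h x) by rewrite sqrtr_gt0.
by move: (Num.sqrt (sg _)) (Num.sqrt (E2h x)) => r1 r2 h1 h2; field; rewrite !gt_eqF.
Qed.
End Assembly.

Unset Implicit Arguments.

Theorem theorem2
  (R : realType) (dZ : measure_display) (Zt : measurableType dZ)
  (dT : nat -> measure_display) (T : forall n, measurableType (dT n))
  (P : forall n, probability (T n) R)
  (p : nat -> nat)
  (y d : forall n, 'I_n -> T n -> R) (z : forall n, 'I_n -> T n -> Zt)
  (Pd : forall n, Zt -> 'I_(p n) -> R)
  (alpha0 : nat -> R) (g m : nat -> Zt -> R)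
  (s : nat -> R) (bm0 bg0 : forall n, 'I_(p n) -> R)
  (I1 I2 I3 : forall n, T n -> {set 'I_(p n)})
  (ac : forall n, T n -> R) (bc bh : forall n, T n -> 'I_(p n) -> R)
  (c C q1 q2 kap1 kap2 : R) (ell delta Delta : nat -> R)
  (* absolute constants and sequences *)
  (hcC : 0 < c < C) (hkap : 0 < kap1 < kap2)
  (hell_pos : forall n, 0 < ell n)
  (hell_mono : forall n k, (n <= k)%N -> ell n <= ell k)
  (hell_lim : ell n @[n --> \oo] --> +oo)
  (hdelta_pos : forall n, 0 < delta n)
  (hdelta_mono : forall n k, (n <= k)%N -> delta k <= delta n)
  (hdelta_lim : delta n @[n --> \oo] --> 0)
  (hDelta_pos : forall n, 0 < Delta n)
  (hDelta_mono : forall n k, (n <= k)%N -> Delta k <= Delta n)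
  (hDelta_lim : Delta n @[n --> \oo] --> 0)
  (* measurability of the data, dictionary, model functions, selectors, estimators *)
  (hy_meas : forall n i, measurable_fun setT (y n i))
  (hd_meas : forall n i, measurable_fun setT (d n i))
  (hz_meas : forall n i, measurable_fun setT (z n i))
  (hPd_meas : forall n j, measurable_fun setT (fun zz => Pd n zz j))
  (hg_meas : forall n, measurable_fun setT (g n))
  (hm_meas : forall n, measurable_fun setT (m n))
  (hI1_meas : forall n S, measurable [set w | I1 n w = S])
  (hI2_meas : forall n S, measurable [set w | I2 n w = S])
  (hI3_meas : forall n S, measurable [set w | I3 n w = S])
  (hac_meas : forall n, measurable_fun setT (ac n))
  (hbc_meas : forall n j, measurable_fun setT (fun w => bc n w j))
  (hbh_meas : forall n j, measurable_fun setT (fun w => bh n w j))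
  (* independence of omega_1, ..., omega_n under Pr_n *)
  (hindep : forall n, mutually_independent (P n) (sig_omega (y n) (d n) (z n)))
  (* Conditions ASTE(Pr_n), SM(Pr_n), SE(Pr_n), HLMS(Pr_n) for each n *)
  (hASTE : forall n, ASTE (P n) (y n) (d n) (z n) (Pd n) (alpha0 n) (g n) (m n)
                         (s n) (bm0 n) (bg0 n) (I1 n) (I2 n) (I3 n)
                         C q1 (delta n) (Delta n))
  (hSM : forall n, SM (P n) (y n) (d n) (z n) (Pd n) (alpha0 n) (g n) (m n)
                      (s n) c C q2 (delta n) (Delta n))
  (hSE : forall n, SE (P n) (z n) (Pd n) (s n) kap1 kap2 (ell n) (Delta n))
  (hHLMS : forall n, HLMS (P n) (z n) (Pd n) (g n) (m n) (s n) (I1 n) (I2 n) (I3 n)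
                          C (delta n) (Delta n))
  (* the generic post-double-selection estimator based on I = I1 u I2 u I3,
     and the auxiliary projection betahat of d on x_I *)
  (hcheck : forall n, is_pds_estimator (y n) (d n) (z n) (Pd n)
                        (fun w => I1 n w :|: I2 n w :|: I3 n w) (ac n) (bc n))
  (hhat : forall n, is_d_projection (d n) (z n) (Pd n)
                      (fun w => I1 n w :|: I2 n w :|: I3 n w) (bh n)) :
  converges_to_std_normal P
    (fun n => stat_oracle (P n) (y n) (d n) (z n) (alpha0 n) (g n) (m n) (ac n))
  /\
  converges_to_std_normal P
    (fun n => stat_plugin (y n) (d n) (z n) (Pd n) (alpha0 n)
                (fun w => I1 n w :|: I2 n w :|: I3 n w) (ac n) (bc n) (bh n)).
Proof.
by split; [apply: oracle_clt hASTE hSM hSE hHLMS hcheck hhat|apply: plugin_clt hASTE hSM hSE hHLMS hcheck hhat].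
Qed.
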